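(* Let $\ell\in\mathbb{Z}_{\ge 0}$ and $a\in\mathbb{R}$. (In the formulas below, an expression in $t$ denotes the corresponding function of $t\in\mathbb{R}_{>0}$.) (1) The operator $\mathcal{L}^{-1}\mathcal{C}_a\mathcal{L}$ is a conjugation on $\mathbf{Lb}^2(\mathbb{R}_{\ge0})$ and $$\mathcal{L}^{-1}\mathcal{C}_a\mathcal{L}\left(\frac{2^\ell}{\ell!}t^{\ell+1}e^{-t\overline z}\right)=\frac{2^\ell}{\ell!}t^{\ell+1}e^{-t(z-ia)},\qquad z\in\mathbb{C}_+.$$ In particular, for $a=0$, writing $\mathcal{J}=\mathcal{C}_0$, one has the explicit form $$(\mathcal{L}^{-1}\mathcal{J}\mathcal{L})\mathbf{h}(t)=\overline{\mathbf{h}(t)},\qquad\forall\,\mathbf{h}\in\mathbf{Lb}^2(\mathbb{R}_{\ge0}).$$ (2) The operator $\mathcal{L}^{-1}\mathcal{C}_\star\mathcal{L}$ is a conjugation on $\mathbf{Lb}^2(\mathbb{R}_{\ge0})$ and $$\mathcal{L}^{-1}\mathcal{C}_\star\mathcal{L}\left(\frac{2^\ell}{\ell!}t^{\ell+1}e^{-t\overline z}\right)=\frac{2^\ell}{z^{\ell+2}\,\ell!}t^{\ell+1}e^{-\frac{t}{z}},\qquad z\in\mathbb{C}_+.$$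
   Context: $\mathbb{C}_+=\{z\in\mathbb{C}:\operatorname{Re}z>0\}$. For $\ell\in\mathbb{Z}_{\ge0}$, the weighted Bergman space $\mathbb{B}_\ell(\mathbb{C}_+)$ is the Hilbert space of analytic functions $h:\mathbb{C}_+\to\mathbb{C}$ with $\|h\|^2=\frac1\pi\int_{-\infty}^{\infty}\int_0^\infty x^\ell|h(x+iy)|^2\,dx\,dy<\infty$. The Lebesgue space $\mathbf{Lb}^2(\mathbb{R}_{\ge0})$ consists of (classes of) measurable functions $\mathbf{h}:\mathbb{R}_{>0}\to\mathbb{C}$ with $\|\mathbf{h}\|^2=\int_0^\infty|\mathbf{h}(t)|^2\dfrac{\Gamma(1+\ell)}{2^\ell t^{1+\ell}}\,dt<\infty$. The Laplace transform $\mathcal{L}(\mathbf{h})(z)=\int_0^\infty\mathbf{h}(t)e^{-zt}\,dt$, $z\in\mathbb{C}_+$, is an isometric isomorphism of $\mathbf{Lb}^2(\mathbb{R}_{\ge0})$ onto $\mathbb{B}_\ell(\mathbb{C}_+)$ (Paley–Wiener theorem). A conjugation is an anti-linear isometric involution. On $\mathbb{B}_\ell(\mathbb{C}_+)$ the following conjugations are used: $\mathcal{C}_a h(z)=\overline{h(\overline z+ia)}$ for $a\in\mathbb{R}$ (so $\mathcal{J}h(z)=\mathcal{C}_0h(z)=\overline{h(\overline z)}$), and $\mathcal{C}_\star h(z)=\dfrac{1}{z^{\ell+2}}\overline{h\left(\dfrac{1}{\overline z}\right)}$. *)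

(* Defs.v *)
From HB Require Import structures.
From mathcomp Require Import all_boot all_order all_algebra.
From mathcomp Require Import all_classical all_reals all_analysis.
From mathcomp Require Import complex.

Set Implicit Arguments.
Unset Strict Implicit.
Unset Printing Implicit Defensive.

Import Order.TTheory GRing.Theory Num.Theory.
Import numFieldNormedType.Exports.

Local Open Scope classical_set_scope.
Local Open Scope ring_scope.
Local Open Scope complex_scope.

(* Conventions. A function on R_{>0} (resp. on the half-plane C_+) is a total  *)
(* function on R (resp. R[i]) of which only the restriction to `]0, +oo[       *)
(* (resp. Cplus) matters; elements of the Lebesgue space are taken up to       *)
(* equality almost everywhere on `]0, +oo[ (relation eq_Rpos).                 *)

Section Defs.
Variable R : realType.
Notation mu := (@lebesgue_measure R).
Notation Rpos := (`]0%R, +oo[%classic : set R).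

Definition Cplus : set R[i] := [set z | 0 < complex.Re z].

Definition cexp (z : R[i]) : R[i] :=
  (expR (complex.Re z))%:C *
  (cos (complex.Im z) +i* sin (complex.Im z)).

Definition cintegral (D : set R) (f : R -> R[i]) : R[i] :=
  (\int[mu]_(t in D) complex.Re (f t)) +i* (\int[mu]_(t in D) complex.Im (f t)).

Definition cmeasurable (D : set R) (f : R -> R[i]) : Prop :=
  measurable_fun D (fun t => complex.Re (f t)) /\
  measurable_fun D (fun t => complex.Im (f t)).

Definition Gamma (s : R) : R :=
  \int[mu]_(t in Rpos) (t `^ (s - 1) * expR (- t)).

Definition eq_Rpos (f g : R -> R[i]) : Prop :=
  {ae mu, forall t, Rpos t -> f t = g t}.

Definition Lb2_sqnorm (l : nat) (h : R -> R[i]) : \bar R :=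
  (\int[mu]_(t in Rpos)
     (Normc.normc (h t) ^+ 2 *
      (Gamma (1 + l%:R) / (2 ^+ l * t ^+ (1 + l))))%:E)%E.

Definition Lb2 (l : nat) : set (R -> R[i]) :=
  [set h | cmeasurable Rpos h /\ (Lb2_sqnorm l h < +oo)%E].

Definition bergman_sqnorm (l : nat) (h : R[i] -> R[i]) : \bar R :=
  ((pi^-1)%:E *
   \int[mu]_y \int[mu]_(x in Rpos)
     (x ^+ l * Normc.normc (h (x +i* y)) ^+ 2)%:E)%E.

(* R[i]^o is R[i] as a normed space over itself: derivability in the direction *)
(* 1 is complex differentiability.                                             *)
Definition analytic_Cplus (h : R[i] -> R[i]) : Prop :=
  forall z, Cplus z -> derivable (h : R[i]^o -> R[i]^o) z 1.

Definition bergman (l : nat) : set (R[i] -> R[i]) :=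
  [set h | analytic_Cplus h /\ (bergman_sqnorm l h < +oo)%E].

Definition laplace (h : R -> R[i]) (z : R[i]) : R[i] :=
  cintegral Rpos (fun t => h t * cexp (- (z * t%:C))).

(* The inverse of laplace : Lb2 l -> bergman l, as a representative of the     *)
(* preimage; the value is the junk 0 when F is not in bergman l or has no      *)
(* preimage in Lb2 l.                                                          *)
Definition laplace_inv (l : nat) (F : R[i] -> R[i]) : R -> R[i] :=
  xget (fun=> 0)
    [set h | [/\ bergman l F, Lb2 l h & forall z, Cplus z -> laplace h z = F z]].

Definition calC (a : R) (h : R[i] -> R[i]) (z : R[i]) : R[i] :=
  conjc (h (conjc z + a *i)).

Definition calJ : (R[i] -> R[i]) -> R[i] -> R[i] := calC 0.

Definition calC_star (l : nat) (h : R[i] -> R[i]) (z : R[i]) : R[i] :=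
  (z ^+ (l + 2))^-1 * conjc (h (conjc z)^-1).

(* T is an operator on classes (first two clauses) which is an anti-linear     *)
(* isometric involution.                                                       *)
Definition is_conjugation_Lb2 (l : nat) (T : (R -> R[i]) -> R -> R[i]) : Prop :=
  [/\ forall f, Lb2 l f -> Lb2 l (T f),
      forall f g, Lb2 l f -> Lb2 l g -> eq_Rpos f g -> eq_Rpos (T f) (T g),
      forall (c d : R[i]) f g, Lb2 l f -> Lb2 l g ->
        eq_Rpos (T (fun t => c * f t + d * g t))
                (fun t => conjc c * T f t + conjc d * T g t),
      forall f, Lb2 l f -> Lb2_sqnorm l (T f) = Lb2_sqnorm l f
    & forall f, Lb2 l f -> eq_Rpos (T (T f)) f].

End Defs.

(* Main.v *)
Require Import Defs.
From mathcomp Require Import all_boot all_order all_algebra.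
From mathcomp Require Import all_classical all_reals all_analysis.
From mathcomp Require Import complex.
From mathcomp Require Import measurable_realfun ring lra.

(** If [C] is one of the two conjugations of the Bergman space, then the
    transported operator is pinned down by [laplace (T f) = C (laplace f)], so
    everything follows from three facts.

    Injectivity: if the real transform of [g] vanishes on [x > 0], then [g e^{-t}]
    integrates to 0 against [(1 - e^{-nxt})^(2^n)], which tends to the indicator of
    [t > ln 2 / x]; hence all tail integrals vanish and [g = 0] a.e.

    The transform of an element of Lb2 is in the Bergman space: for fixed [x],
    Plancherel's inequality in [y] is obtained from the regularisation [e^{-ey}],
    whose transform is the Poisson kernel, by Schur's test; integrating against
    [x^l dx] gives the weight [l! / (2t)^(l+1)].

    [C (laplace f)] is again a transform, of a function with the norm of [f]. For
    [calC a] it is the transform of [conj f e^{iat}]. For [calC_star] the kernels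
    [k_x(t) = t^(l+1) e^{-xt}] are sent to [x^{-(l+2)} k_{1/x}]; this map is
    isometric on the span of the kernels, which is dense by injectivity, and
    extends to Lb2 by completeness. *)

Set Implicit Arguments.
Unset Strict Implicit.
Unset Printing Implicit Defensive.

Import Order.TTheory GRing.Theory Num.Theory.
Import numFieldNormedType.Exports.

Local Open Scope classical_set_scope.
Local Open Scope ring_scope.
Local Open Scope complex_scope.

(** * Weighted L2 spaces *)

(** [laplace_inv] returns a preimage only for functions already in [bergman], so each evaluation of
    a transported operator needs a preimage in [Lb2] together with Bergman membership of its
    transform. Membership asks for a finite norm only, so inequalities with generous constants
    serve; the isometry clause compares norms in [Lb2] and is settled where the preimage is built.

    For [calC_star] the preimage would be a Bessel integral; it is obtained abstractly instead. The
    kernels fit because [k_x] has transform [(l+1)! / (z + x)^(l+2)] and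
    [z (1/z + x) = x (z + 1/x)], which is the origin of the factor [x^{-(l+2)}]. Moreover the
    transform of a real function commutes with complex conjugation, so on such transforms
    [calC_star] is the linear map sending [F(z)] to [z^{-(l+2)} F(1/z)]. The extension is therefore
    carried out in a real L2 space with real [x], and a complex function is reassembled from its two
    parts, the imaginary one with its sign changed. *)

Section real_integrable.
Context d (T : measurableType d) (R : realType).
Variables (mu : {measure set T -> \bar R}) (D : set T).
Hypothesis mD : measurable D.
Implicit Types f g h : T -> R.

Lemma integrable_EFin_measurable f :
  mu.-integrable D (EFin \o f) -> measurable_fun D f.
Proof. by move=> /measurable_int/measurable_EFinP. Qed.

Lemma le_integrable_EFin f g : measurable_fun D f ->
  (forall x, D x -> `|f x| <= g x) ->
  mu.-integrable D (EFin \o g) -> mu.-integrable D (EFin \o f).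
Proof.
move=> mf fg; apply: le_integrable => //; first exact/measurable_EFinP.
by move=> x Dx /=; rewrite lee_fin (le_trans (fg x Dx))// ler_norm.
Qed.

Lemma integrable_EFinD f g : mu.-integrable D (EFin \o f) ->
  mu.-integrable D (EFin \o g) -> mu.-integrable D (EFin \o (fun x => f x + g x)).
Proof. by move=> f_ g_; apply: (integrableD mD f_ g_). Qed.

Lemma integrable_EFinB f g : mu.-integrable D (EFin \o f) ->
  mu.-integrable D (EFin \o g) -> mu.-integrable D (EFin \o (fun x => f x - g x)).
Proof. by move=> f_ g_; apply: (integrableB mD f_ g_). Qed.

Lemma integrable_EFinZl (c : R) f : mu.-integrable D (EFin \o f) ->
  mu.-integrable D (EFin \o (fun x => c * f x)).
Proof. by move=> f_; apply: (integrableZl mD c f_). Qed.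

Lemma RintegralK f : mu.-integrable D (EFin \o f) ->
  ((\int[mu]_(x in D) f x)%:E = \int[mu]_(x in D) (f x)%:E)%E.
Proof. by move=> f_; rewrite /Rintegral fineK//; exact: integrable_fin_num. Qed.

Lemma ge0_integrable_EFin f : measurable_fun D f -> (forall x, D x -> 0 <= f x) ->
  (\int[mu]_(x in D) (f x)%:E < +oo)%E -> mu.-integrable D (EFin \o f).
Proof.
move=> mf f0 foo; apply/integrableP; split; first exact/measurable_EFinP.
by under eq_integral => x /set_mem Dx do rewrite /= ger0_norm ?f0//.
Qed.

Lemma integrable_EFinM_bounded (K : R) f h : mu.-integrable D (EFin \o f) ->
  measurable_fun D h -> (forall x, D x -> `|h x| <= K) ->
  mu.-integrable D (EFin \o (fun x => f x * h x)).
Proof.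
move=> fi mh hK.
apply: (le_integrable_EFin _ _ (integrable_EFinZl K (integrable_norm fi))).
  by apply: measurable_funM => //; exact: integrable_EFin_measurable fi.
by move=> x Dx; rewrite normrM mulrC ler_wpM2r// hK.
Qed.

Lemma Rintegral_le_abse f (c : R) : measurable_fun D f ->
  (\int[mu]_(x in D) (`|f x|)%:E <= c%:E)%E -> \int[mu]_(x in D) f x <= c.
Proof.
move=> mf fc; have fi : mu.-integrable D (EFin \o f).
  apply/integrableP; split; first exact/measurable_EFinP.
  by apply: le_lt_trans fc _; rewrite ltry.
rewrite -lee_fin RintegralK//; apply: le_trans fc; apply: le_trans (lee_abs _) _.
by apply: le_abse_integral => //; exact/measurable_EFinP.
Qed.
End real_integrable.

(** Stated for abstract coefficients because it serves both Cauchy-Schwarz and the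
    near-orthogonality in [approximating_pairs], where [e] is the excess over an infimum. For
    [a > 0] one evaluates at the vertex [c = - b / a]. *)
Lemma discriminant_le (R : realFieldType) (a b e : R) : 0 <= a ->
  (forall c, 0 <= e + 2 * c * b + c ^+ 2 * a) -> b ^+ 2 <= e * a.
Proof.
rewrite le0r => /predU1P[-> H|a0 H].
  have [->|b0] := eqVneq b 0; first by rewrite expr0n mulr0.
  (* With [a = 0] the form is affine in [c]; this [c] gives it the value -1. *)
  have := H (- (e + 1) / (2 * b)).
  rewrite mulr0 addr0 (_ : 2 * _ * b = - (e + 1)); first lra.
  by field.
have := H (- b / a).
rewrite (_ : _ + _ = e - b ^+ 2 / a); last by field; rewrite gt_eqF.
by rewrite subr_ge0 ler_pdivrMr.
Qed.

Section weighted_L2.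
Context d (T : measurableType d) (R : realType).
Variables (mu : {measure set T -> \bar R}) (D : set T) (w : T -> R).
Hypotheses (mD : measurable D) (mw : measurable_fun D w).
Hypothesis w0 : forall t, D t -> 0 < w t.
Implicit Types f g h : T -> R.

(** Elements are functions, not classes, so [wdot] is only semidefinite and vanishing is expressed
    as [wdot f f = 0]. *)
Definition wsqint f : Prop :=
  measurable_fun D f /\ mu.-integrable D (EFin \o (fun t => f t ^+ 2 * w t)).

Definition wdot f g : R := \int[mu]_(t in D) (f t * g t * w t).

Let mdot f g : measurable_fun D f -> measurable_fun D g ->
  measurable_fun D (fun t => f t * g t * w t).
Proof. by move=> mf mg; apply: measurable_funM => //; apply: measurable_funM. Qed.

Lemma integrable_dot f g : wsqint f -> wsqint g ->
  mu.-integrable D (EFin \o (fun t => f t * g t * w t)).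
Proof.
move=> [mf f2] [mg g2].
apply: (le_integrable_EFin mD _ _ (integrable_EFinD mD f2 g2)); first exact: mdot.
move=> t Dt; have := w0 Dt; move: (w t) (f t) (g t) => W a b W0.
rewrite normrM (ger0_norm (ltW W0)) -mulrDl ler_wpM2r ?(ltW W0)// normrM.
rewrite -(real_normK (num_real a)) -(real_normK (num_real b)).
by nra.
Qed.

Lemma sqintD f g : wsqint f -> wsqint g -> wsqint (fun t => f t + g t).
Proof.
move=> fL gL; split; first exact: measurable_funD fL.1 gL.1.
have := integrable_EFinD mD (integrable_EFinD mD fL.2 gL.2)
  (integrable_EFinZl mD 2 (integrable_dot fL gL)).
by apply: eq_integrable => // t _ /=; congr EFin; ring.
Qed.

Lemma sqintZ c f : wsqint f -> wsqint (fun t => c * f t).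
Proof.
move=> fL; split; first exact: measurable_funM (measurable_cst _) fL.1.
have := integrable_EFinZl mD (c ^+ 2) fL.2.
by apply: eq_integrable => // t _ /=; congr EFin; ring.
Qed.

Lemma sqintB f g : wsqint f -> wsqint g -> wsqint (fun t => f t - g t).
Proof.
move=> fL gL; have := sqintD fL (sqintZ (-1) gL).
by congr wsqint; apply/funext => t; rewrite mulN1r.
Qed.

Lemma sqint0 : wsqint (fun=> 0).
Proof.
split; first exact: measurable_cst.
apply: (@eq_integrable _ _ _ _ _ mD (cst 0%E)); last exact: integrable0.
by move=> t _ /=; rewrite expr0n mul0r.
Qed.

Lemma dotC f g : wdot f g = wdot g f.
Proof. by apply: eq_Rintegral => t _; ring. Qed.

Lemma dotDl f g h : wsqint f -> wsqint g -> wsqint h ->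
  wdot (fun t => f t + g t) h = wdot f h + wdot g h.
Proof.
move=> fL gL hL; rewrite /wdot -RintegralD//; try exact: integrable_dot.
by apply: eq_Rintegral => t _; ring.
Qed.

Lemma dotZl c f g : wsqint f -> wsqint g -> wdot (fun t => c * f t) g = c * wdot f g.
Proof.
move=> fL gL; rewrite /wdot -RintegralZl//; try exact: integrable_dot.
by apply: eq_Rintegral => t _; ring.
Qed.

Lemma dotBl f g h : wsqint f -> wsqint g -> wsqint h ->
  wdot (fun t => f t - g t) h = wdot f h - wdot g h.
Proof.
move=> fL gL hL; rewrite /wdot -RintegralB//; try exact: integrable_dot.
by apply: eq_Rintegral => t _; ring.
Qed.

Lemma dot_ge0 f : 0 <= wdot f f.
Proof. by apply: Rintegral_ge0 => t Dt; rewrite -expr2 mulr_ge0 ?sqr_ge0 ?ltW ?w0. Qed.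

Lemma dotDDE c f g : wsqint f -> wsqint g ->
  wdot (fun t => f t + c * g t) (fun t => f t + c * g t) =
  wdot f f + 2 * c * wdot f g + c ^+ 2 * wdot g g.
Proof.
move=> fL gL; have cgL := sqintZ c gL; have sL := sqintD fL cgL.
rewrite dotDl// dotZl// ![wdot _ (fun t => f t + _)]dotC !dotDl// !dotZl//.
by rewrite (dotC g f); ring.
Qed.

Lemma dot_CS f g : wsqint f -> wsqint g -> wdot f g ^+ 2 <= wdot f f * wdot g g.
Proof.
move=> fL gL; apply: discriminant_le (dot_ge0 g) _ => c.
by rewrite -dotDDE//; exact: dot_ge0.
Qed.

Lemma sqint_sqnormE f : wsqint f ->
  ((wdot f f)%:E = \int[mu]_(t in D) (f t ^+ 2 * w t)%:E)%E.
Proof. by move=> fL; rewrite RintegralK//; exact: fL.2. Qed.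

End weighted_L2.

(** * Fatou's lemma and completeness of weighted L2 *)

Lemma limn_einf_le (R : realType) (u : (\bar R)^nat) (c : \bar R) :
  (forall n, u n <= c)%E -> (limn_einf u <= c)%E.
Proof.
move=> uc; rewrite limn_einf_lim; apply: lime_le; first exact: is_cvg_einfs.
apply: nearW => n; apply: le_trans (uc n).
by apply: ereal_inf_lbound; exists n => //=.
Qed.

Lemma fatou_le d (T : measurableType d) (R : realType)
    (mu : {measure set T -> \bar R}) (D : set T) (f : (T -> R)^nat) (g : T -> R)
    (c : \bar R) :
  measurable D -> (forall n, measurable_fun D (f n)) -> measurable_fun D g ->
  (forall n t, D t -> 0 <= f n t) -> (forall t, D t -> 0 <= g t) ->
  {ae mu, forall t, D t -> f n t @[n --> \oo] --> g t} ->
  (forall n, (\int[mu]_(t in D) (f n t)%:E <= c)%E) ->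
  (\int[mu]_(t in D) (g t)%:E <= c)%E.
Proof.
move=> mD mf mg f0 g0 fg fc.
have mF n : measurable_fun D (fun t => (f n t)%:E) by exact/measurable_EFinP.
have F0 n t : D t -> (0 <= (f n t)%:E)%E by move=> Dt; rewrite lee_fin f0.
apply: le_trans (limn_einf_le fc); apply: le_trans (fatou mu mD mF F0).
apply: ae_ge0_le_integral => //.
- exact/measurable_EFinP.
- move=> t Dt; rewrite limn_einf_lim; apply: lime_ge; first exact: is_cvg_einfs.
  by apply: nearW => n; apply: le_ereal_inf_tmp => _ [k _ <-]; exact: F0.
- rewrite [X in measurable_fun _ X](_ : _ =
    fun t => (- limn_esup (fun n => - (f n t)%:E))%E).
    apply: measurableT_comp => //; apply: measurable_fun_limn_esup => n.
    exact: measurableT_comp.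
  by apply/funext => t; rewrite -limn_einfN; congr limn_einf; apply/funext => n /=;
      rewrite opprK.
- apply: filterS fg => t + Dt => /(_ Dt) fgt.
  have /cvg_limn_einf_sup[-> _] // : (f n t)%:E @[n --> \oo] --> (g t)%:E.
  by apply: cvg_EFin => //; exact: nearW.
Qed.

Section completeness.
Context d (T : measurableType d) (R : realType).
Variables (mu : {measure set T -> \bar R}) (D : set T) (w : T -> R).
Hypotheses (mD : measurable D) (mw : measurable_fun D w).
Hypothesis w0 : forall t, D t -> 0 < w t.
Notation sqint := (wsqint mu D w).
Notation dot := (wdot mu D w).
Variables (C : R) (v : (T -> R)^nat).
Hypothesis vL : forall n, sqint (v n).
Hypothesis v_cauchy : forall n m, (n <= m)%N ->
  dot (fun t => v m t - v n t) (fun t => v m t - v n t) <= C / 4 ^+ n.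

(** The weight [2 ^+ n] is small enough against [C / 4 ^+ n] for the integral of [Phi] to be a
    convergent geometric sum, and large enough for [Phi t] to control the sum of the
    [|v n.+1 t - v n t|]. *)
Let Phi t := (\sum_(n <oo) (2 ^+ n * (v n.+1 t - v n t) ^+ 2 * w t)%:E)%E.

Let dL n : sqint (fun t => v n.+1 t - v n t).
Proof. exact: sqintB. Qed.

Let Phi_ge0 n t : D t -> (0 <= (2 ^+ n * (v n.+1 t - v n t) ^+ 2 * w t)%:E)%E.
Proof.
by move=> Dt; rewrite lee_fin mulr_ge0 ?(ltW (w0 Dt))// mulr_ge0 ?sqr_ge0// exprn_ge0.
Qed.

Let mPhi n : measurable_fun D
  (fun t => (2 ^+ n * (v n.+1 t - v n t) ^+ 2 * w t)%:E).
Proof.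
apply/measurable_EFinP; apply: measurable_funM => //; apply: measurable_funM => //.
by apply: measurable_funX; apply: (dL n).1.
Qed.

Let integrable_Phi : mu.-integrable D Phi.
Proof.
apply/integrableP; split.
  exact: (ge0_emeasurable_sum (P := xpredT) (fun k t Dt _ => Phi_ge0 k Dt)
    (fun k _ => mPhi k)).
have C0 : 0 <= C.
  have := v_cauchy (leqnn 0); rewrite expr0 divr1; apply: le_trans.
  exact: dot_ge0.
rewrite (eq_integral Phi); last first.
  by move=> t /set_mem Dt; rewrite gee0_abs//; apply: nneseries_ge0 => n _ _; exact:
      Phi_ge0.
rewrite integral_nneseries//.
apply: (@le_lt_trans _ _ (\sum_(n <oo) ((C * 2) / (2 ^ (n + 1))%:R)%:E)%E); last first.
  by have /cvg_lim -> := @cvg_geometric_eseries_half R (C * 2) 0; rewrite ?ltry.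
apply: lee_nneseries => [n _ _|n _].
  by apply: integral_ge0 => t; exact: Phi_ge0.
rewrite [X in (X <= _)%E](_ : _ = (2 ^+ n * dot (fun t => v n.+1 t - v n t) (fun t => v
    n.+1 t - v n t))%:E); last first.
  rewrite EFinM sqint_sqnormE// -integralZl//; last exact: (dL n).2.
  by apply: eq_integral => t _; rewrite -EFinM; congr EFin; ring.
rewrite lee_fin.
apply: (le_trans (ler_wpM2l _ (v_cauchy (leqnSn n)))); first exact: exprn_ge0.
rewrite addn1 natrX exprS (_ : 4 = 2 * 2)%R; last by rewrite -natrM.
rewrite exprMn le_eqVlt; apply/orP; left; apply/eqP.
have : (2 : R) ^+ n != 0 by rewrite expf_neq0.
by move=> h; field.
Qed.

Let cvg_v t : D t -> Phi t \is a fin_num -> cvgn (v ^~ t).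
Proof.
move=> Dt Phioo; have wt := w0 Dt.
suff : cvgn (series (telescope (v ^~ t))).
  rewrite telescopeK => h.
  have := is_cvgD h (is_cvg_cst (v 0%N t)).
  rewrite (_ : (fun n => v n t) = [sequence v n t - v 0%N t]_n + (fun=> v 0%N t)).
    by apply.
  by apply/funext => n; rewrite addrfctE /= subrK.
apply: normed_cvg; apply: nondecreasing_is_cvgn.
  apply/nondecreasing_seqP => n.
  by rewrite [leRHS]seriesSr lerDl; exact: normr_ge0.
exists (1 + fine (Phi t) / w t) => _ [n _ <-] /=.
(* Termwise [a <= 1 / 2^(k+1) + 2^k a^2] for the increment [a], by completing the square: the first
   summand is geometric, the second is a term of [Phi t] divided by the weight. *)
apply: (@le_trans _ _ (\sum_(0 <= k < n) (1 / (2 ^ (k + 1))%:R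
    + (2 ^+ k * (v k.+1 t - v k t) ^+ 2 * w t) / w t))).
  apply: ler_sum => k _; rewrite /telescope.
  rewrite addn1 natrX exprS.
  rewrite -(real_normK (num_real (v k.+1 t - _))).
  move: (`|_|) (normr_ge0 (v k.+1 t - v k t)) => a a0.
  have p0 : 0 < (2 : R) ^+ k by exact: exprn_gt0.
  move: (2 ^+ k) p0 => p p0.
  rewrite mulfK ?gt_eqF// -subr_ge0.
  rewrite (_ : _ - _ = ((p * a - 1/2) ^+ 2 + 1/4) / p).
    by rewrite divr_ge0 ?(ltW p0)// addr_ge0 ?sqr_ge0//; lra.
  by field; rewrite gt_eqF.
rewrite big_split /= lerD//.
  rewrite -lee_fin -sumEFin.
  have /cvg_lim := @cvg_geometric_eseries_half R 1 0.
  rewrite expr0 divr1 => <- //.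
  by apply: nneseries_lim_ge => i _ _; rewrite lee_fin divr_ge0.
rewrite -mulr_suml ler_wpM2r ?invr_ge0 ?(ltW wt)//.
rewrite -lee_fin -sumEFin fineK//.
by apply: nneseries_lim_ge => i _ _; exact: Phi_ge0.
Qed.

(* 2^n (v_{n+1} - v_n)^2 is summable almost everywhere, so v converges almost
   everywhere, and Fatou's lemma transfers the rate to the limit. *)
Lemma sqint_complete : exists g, sqint g /\ forall n,
  dot (fun t => g t - v n t) (fun t => g t - v n t) <= C / 4 ^+ n.
Proof.
(* The upper limit is measurable whether or not [v ^~ t] converges, and it is the limit wherever
   there is one. *)
pose g t := fine (limn_esup (fun n => (v n t)%:E)).
have mg : measurable_fun D g.
  apply: (measurableT_comp (@fine_measurable R setT measurableT)).
  apply: measurable_fun_limn_esup => n; apply/measurable_EFinP.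
  by have [] := vL n.
have vg : {ae mu, forall t, D t -> v n t @[n --> \oo] --> g t}.
  apply: filterS (integrable_ae mD integrable_Phi) => t + Dt => /(_ Dt).
  move=> /(cvg_v Dt) /cvg_ex[l vl]; rewrite /g.
  have /cvg_limn_einf_sup[_ ->] // : (v n t)%:E @[n --> \oo] --> l%:E.
  by apply: cvg_EFin => //; exact: nearW.
have Hn n : (\int[mu]_(t in D) ((g t - v n t) ^+ 2 * w t)%:E <= (C / 4 ^+ n)%:E)%E.
  have mvn k : measurable_fun D (v k) by have [] := vL k.
  apply: (fatou_le mD (f := fun m t => (v (m + n)%N t - v n t) ^+ 2 * w t)).
  - move=> m; apply: measurable_funM => //; apply: measurable_funX.
    exact: measurable_funB.
  - by apply: measurable_funM => //; apply: measurable_funX; exact: measurable_funB.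
  - by move=> m t Dt; rewrite mulr_ge0 ?sqr_ge0// ltW ?w0.
  - by move=> t Dt; rewrite mulr_ge0 ?sqr_ge0// ltW ?w0.
  - apply: filterS vg => t + Dt => /(_ Dt) vgt.
    apply: cvgM; last exact: cvg_cst.
    apply: (@cvg_comp _ _ _ (fun m => v (m + n)%N t - v n t) (fun x => x ^+ 2) _ (nbhs
        (g t - v n t))).
      apply: cvgB; last exact: cvg_cst.
      by rewrite (cvg_shiftn n (v ^~ t)).
    exact: exprn_continuous.
  - move=> m; rewrite -sqint_sqnormE//; last exact: sqintB.
    by rewrite lee_fin v_cauchy// leq_addl.
have gvL n : sqint (fun t => g t - v n t).
  have mh : measurable_fun D (fun t => g t - v n t).
    by apply: measurable_funB => //; have [] := vL n.
  split=> //.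
  apply: ge0_integrable_EFin => //.
  - by apply: measurable_funM => //; apply: measurable_funX.
  - by move=> t Dt; rewrite mulr_ge0 ?sqr_ge0// ltW ?w0.
  - by apply: le_lt_trans (Hn n) _; rewrite ltry.
exists g; split; last by move=> n; rewrite -lee_fin sqint_sqnormE.
have := sqintD mD mw w0 (gvL 0) (vL 0); congr (wsqint _ _ _ _).
by apply/funext => t; rewrite subrK.
Qed.

End completeness.

Lemma le0_geometric (R : realType) (x K : R) :
  (forall n, x <= K / 4 ^+ n) -> x <= 0.
Proof.
move=> xK; have K4 : geometric K (4^-1 : R) @ \oo --> (0 : R).
  by apply: cvg_geometric; rewrite ger0_norm ?invr_ge0// invf_lt1 ?ltr1n.
by apply: (cvgr_to_ge K4); apply: nearW => n /=; rewrite exprVn.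
Qed.

(** * Extension of an isometry defined on a total subspace *)

Section isometric_extension.
Context d (T : measurableType d) (R : realType).
Variables (mu : {measure set T -> \bar R}) (D : set T) (w : T -> R).
Hypotheses (mD : measurable D) (mw : measurable_fun D w).
Hypothesis w0 : forall t, D t -> 0 < w t.
Notation sqint := (wsqint mu D w).
Notation dot := (wdot mu D w).
(** The isometry is given by its graph, so that it can be generated inductively from pairs of
    kernels without first showing that the image of a linear combination is independent of how it is
    written. *)
Variable G : (T -> R) -> (T -> R) -> Prop.
Hypothesis G0 : G (fun=> 0) (fun=> 0).
Hypothesis GDZ : forall c u u' v v', G u u' -> G v v' ->
  G (fun t => u t + c * v t) (fun t => u' t + c * v' t).
Hypothesis GL : forall u u', G u u' -> sqint u /\ sqint u'.
Hypothesis Giso : forall u u', G u u' -> dot u u = dot u' u'.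
Hypothesis Gtotal : forall f, sqint f ->
  (forall u u', G u u' -> dot f u = 0) -> dot f f = 0.

(** Polarisation of [Giso]. *)
Let Gdot u u' v v' : G u u' -> G v v' -> dot u v = dot u' v'.
Proof.
move=> Gu Gv; have [uL u'L] := GL Gu; have [vL v'L] := GL Gv.
have := Giso (GDZ 1 Gu Gv); rewrite !dotDDE//.
by rewrite (Giso Gu) (Giso Gv); lra.
Qed.

Let dotBB u v : sqint u -> sqint v -> dot (fun t => u t - v t) (fun t => u t - v t) =
  dot u u - 2 * dot u v + dot v v.
Proof.
move=> uL vL; have := dotDDE mD mw w0 (-1) uL vL.
rewrite (_ : (fun t => u t + -1 * v t) = (fun t => u t - v t)).
  by move=> ->; ring.
by apply/funext => t; rewrite mulN1r.
Qed.

Section approximation.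
Variable f : T -> R.
Hypothesis fL : sqint f.

Let sq u := dot (fun t => f t - u t) (fun t => f t - u t).
Let dist := inf [set x | exists u u', G u u' /\ x = sq u].

Let dist_le u u' : G u u' -> dist <= sq u.
Proof.
move=> Gu; apply: ge_inf; last by exists u, u'.
by exists 0 => _ [v [v' [_ ->]]]; exact: dot_ge0.
Qed.

Let minimizing : exists v : nat -> (T -> R) * (T -> R),
  forall n, G (v n).1 (v n).2 /\ sq (v n).1 <= dist + 1 / 4 ^+ n.
Proof.
suff /choice[v vP] : forall n, exists v : (T -> R) * (T -> R),
    G v.1 v.2 /\ sq v.1 <= dist + 1 / 4 ^+ n by exists v.
move=> n; have e0 : (0 : R) < 1 / 4 ^+ n by rewrite divr_gt0// exprn_gt0.
have hi : has_inf [set x | exists u u', G u u' /\ x = sq u].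
  split; first by exists (sq (fun=> 0)), (fun=> 0), (fun=> 0).
  by exists 0 => _ [v [v' [_ ->]]]; exact: dot_ge0.
have [_ [u [u' [Gu ->]]] /ltW lt] := inf_adherent e0 hi.
by exists (u, u').
Qed.

(** Applied to two near-minimisers: their midpoint is again in the domain of [G], so its [sq] is at
    least [dist], and what remains is bounded by the two excesses. This makes a minimising sequence
    Cauchy. *)
Let parallelogram u v : sqint u -> sqint v ->
  dot (fun t => u t - v t) (fun t => u t - v t) =
  2 * sq u + 2 * sq v - 4 * sq (fun t => 2^-1 * u t + 2^-1 * v t).
Proof.
move=> uL vL; rewrite /sq.
have uZ := sqintZ mD 2^-1 uL; have vZ := sqintZ mD 2^-1 vL.
have sL := sqintD mD mw w0 uZ vZ.
rewrite !dotBB// dotDDE// !dotZl//.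
rewrite (dotC _ _ _ u (fun t => _ * u t)) (dotC _ _ _ f (fun t => _ + _)).
by rewrite dotDl// !dotZl// (dotC _ _ _ u f) (dotC _ _ _ v f); field.
Qed.

(** Hilbert's projection argument: a minimising sequence converges to some [p], the difference
    [f - p] is orthogonal to the domain of [G], and [Gtotal] forces its norm to be 0. Hence the
    sequence approximates [f] itself. *)
Lemma approximating_pairs : exists u u' : (T -> R)^nat,
  (forall n, G (u n) (u' n)) /\
  (forall n m, (n <= m)%N ->
     dot (fun t => u m t - u n t) (fun t => u m t - u n t) <= 4 / 4 ^+ n) /\
  (forall n, sq (u n) <= 4 / 4 ^+ n).
Proof.
have [v vP] := minimizing.
have vG n : G (v n).1 (v n).2 by have [] := vP n.
have vL n : sqint (v n).1 by have [] := GL (vG n).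
have cau n m : (n <= m)%N ->
    dot (fun t => (v m).1 t - (v n).1 t) (fun t => (v m).1 t - (v n).1 t) <= 4 / 4 ^+ n.
  move=> nm; rewrite parallelogram//.
  have Gm : G (fun t => 2^-1 * (v m).1 t + 2^-1 * (v n).1 t)
              (fun t => 2^-1 * (v m).2 t + 2^-1 * (v n).2 t).
    have := GDZ 2^-1 (GDZ 2^-1 G0 (vG m)) (vG n).
    by congr G; apply/funext => t; rewrite add0r.
  have := dist_le Gm; have [_ +] := vP n; have [_ +] := vP m.
  have : (1 : R) / 4 ^+ m <= 1 / 4 ^+ n.
    by rewrite ler_pM2l// lef_pV2 ?posrE ?exprn_gt0// ler_eXn2l// ltr1n.
  move: (sq _) (sq _) (sq _) => a b c.
  by lra.
have [p [pL pP]] := sqint_complete mD mw w0 vL cau.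
have rL := sqintB mD mw w0 fL pL.
have pvL n := sqintB mD mw w0 pL (vL n).
have fvL n := sqintB mD mw w0 fL (vL n).
have r0 : dot (fun t => f t - p t) (fun t => f t - p t) = 0.
  apply: Gtotal => // u u' Gu; have [uL _] := GL Gu.
  apply/eqP; rewrite -sqrf_eq0 eq_le sqr_ge0 andbT.
  (* The pairing is a difference of two terms whose squares are at most [1 / 4^n] and [4 / 4^n]
     times [dot u u]; since [(a - b)^2 <= 2 (a^2 + b^2)], the constant is [2 (1 + 4)]. *)
  apply: (@le0_geometric _ _ (10 * dot u u)) => n.
  have H1 : dot (fun t => f t - (v n).1 t) u ^+ 2 <= 1 / 4 ^+ n * dot u u.
    apply: discriminant_le; first exact: dot_ge0.
    move=> c; have := dist_le (GDZ (- c) (vG n) Gu); rewrite /sq.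
    rewrite (_ : (fun t => f t - _) = (fun t => (f t - (v n).1 t) + c * u t)).
      by rewrite dotDDE//; have [_] := vP n; rewrite /sq; lra.
    by apply/funext => t; ring.
  have H2 := le_trans (dot_CS mD mw w0 (pvL n) uL)
    (ler_wpM2r (dot_ge0 mu w0 u) (pP n)).
  rewrite (_ : dot (fun t => f t - p t) u =
      dot (fun t => f t - (v n).1 t) u - dot (fun t => p t - (v n).1 t) u).
    move: (dot _ u) (dot (fun t => p t - _) u) H1 H2 => a b H1 H2.
    have : 2 * (a ^+ 2 + b ^+ 2) <= (10 * dot u u) / 4 ^+ n by move: H1 H2; lra.
    by apply: le_trans; have := sqr_ge0 (a + b); rewrite !expr2; lra.
  by rewrite !dotBl//; ring.
exists (fun n => (v n).1), (fun n => (v n).2); split=> //; split=> // n.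
apply: le_trans (pP n); rewrite /sq.
(* [f - p] has norm 0 without being 0 pointwise, so its cross term is removed by Cauchy-Schwarz. *)
have rp0 : dot (fun t => f t - p t) (fun t => p t - (v n).1 t) = 0.
  apply/eqP; rewrite -sqrf_eq0 eq_le sqr_ge0 andbT.
  by have := dot_CS mD mw w0 rL (pvL n); rewrite r0 mul0r.
rewrite (_ : (fun t => f t - _) = (fun t => (f t - p t) + 1 * (p t - (v n).1 t))).
  by rewrite dotDDE// r0 rp0; lra.
by apply/funext => t; ring.
Qed.

(** The last clause determines [g] by duality: any identity between a functional of [u'] and a
    functional of [u] valid on [G] passes to the pair [(g, f)]. Evaluation of a Laplace transform at
    a point is such a functional. *)
Lemma isometric_extension : exists g, [/\ sqint g, dot g g = dot f f &
  forall p q, sqint p -> sqint q -> (forall u u', G u u' -> dot u' p = dot u q) ->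
    dot g p = dot f q].
Proof.
have [u [u' [uG [ucau uf]]]] := approximating_pairs.
have uL n : sqint (u n) by have [] := GL (uG n).
have u'L n : sqint (u' n) by have [] := GL (uG n).
have u'cau n m : (n <= m)%N ->
    dot (fun t => u' m t - u' n t) (fun t => u' m t - u' n t) <= 4 / 4 ^+ n.
  by move=> nm; rewrite dotBB// -!(Gdot (uG _) (uG _)) -dotBB// ucau.
have [g [gL gP]] := sqint_complete mD mw w0 u'L u'cau.
have gu'L n := sqintB mD mw w0 gL (u'L n).
have fuL n := sqintB mD mw w0 fL (uL n).
have pairing p q : sqint p -> sqint q ->
    (forall u u', G u u' -> dot u' p = dot u q) -> dot g p = dot f q.
  move=> pL qL pq; apply/eqP; rewrite -subr_eq0 -sqrf_eq0 eq_le sqr_ge0 andbT.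
  (* Again [(a - b)^2 <= 2 (a^2 + b^2)], both approximations now having rate [4 / 4^n]. *)
  apply: (@le0_geometric _ _ (8 * (dot p p + dot q q))) => n.
  have H1 := le_trans (dot_CS mD mw w0 (gu'L n) pL)
    (ler_wpM2r (dot_ge0 mu w0 p) (gP n)).
  have H2 := le_trans (dot_CS mD mw w0 (fuL n) qL)
    (ler_wpM2r (dot_ge0 mu w0 q) (uf n)).
  rewrite (_ : dot g p - dot f q =
     dot (fun t => g t - u' n t) p - dot (fun t => f t - u n t) q); last first.
    by rewrite !dotBl// (pq _ _ (uG n)); ring.
  move: (dot _ p) (dot _ q) H1 H2 => a b H1 H2.
  have : 2 * (a ^+ 2 + b ^+ 2) <= 8 * (dot p p + dot q q) / 4 ^+ n by move: H1 H2; lra.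
  by apply: le_trans; have := sqr_ge0 (a + b); rewrite !expr2; lra.
exists g; split=> //.
(* An exact identity: the cross terms agree by [pairing] for the pair [(u' n, u n)], and the norms
   of [u' n] and [u n] agree by [Giso]. Both terms on the right are at most [4 / 4^n]. *)
have gf n : dot g g - dot f f = dot (fun t => g t - u' n t) (fun t => g t - u' n t) -
    sq (u n).
  rewrite /sq !dotBB// (pairing (u' n) (u n))// ?(Giso (uG n)); first by ring.
  by move=> v v' Gv; rewrite (Gdot Gv (uG n)).
apply/eqP; rewrite eq_le; apply/andP; split; rewrite -subr_le0;
  apply: (@le0_geometric _ _ 4) => n.
  by rewrite (gf n); have := gP n; have := dot_ge0 mu w0 (fun t => f t - u n t);
      rewrite /sq; lra.
by rewrite -opprB (gf n); have := uf n; have := dot_ge0 mu w0 (fun t => g t - u' n t);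
    lra.
Qed.

End approximation.
End isometric_extension.

(** * Laplace moments on the half-line *)

Lemma dominated_cvg_Rintegral d (T : measurableType d) (R : realType)
    (mu : {measure set T -> \bar R}) (D : set T) (f_ : (T -> R)^nat) (f g : T -> R) :
  measurable D -> (forall n, measurable_fun D (f_ n)) -> measurable_fun D f ->
  {ae mu, forall t, D t -> f_ n t @[n --> \oo] --> f t} ->
  mu.-integrable D (EFin \o g) ->
  (forall n t, D t -> `|f_ n t| <= g t) ->
  mu.-integrable D (EFin \o f) /\
  (\int[mu]_(t in D) f_ n t) @[n --> \oo] --> \int[mu]_(t in D) f t.
Proof.
move=> mD mf_ mf f_f gi f_g.
have mf_E n : measurable_fun D (EFin \o f_ n) by exact/measurable_EFinP.
have mfE : measurable_fun D (EFin \o f) by exact/measurable_EFinP.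
have f_fE : {ae mu, forall t, D t -> (EFin \o f_ n) t @[n --> \oo] --> (EFin \o f) t}.
  by apply: filterS f_f => t f_f Dt; apply: cvg_EFin (f_f Dt); exact: nearW.
have f_gE : {ae mu, forall t (n : nat), D t -> (`|(EFin \o f_ n) t| <= (EFin \o g) t)%E}.
  by apply: aeW => t n Dt; rewrite lee_fin f_g.
have [fi _ cv] := dominated_convergence mD mf_E mfE f_fE gi f_gE.
split=> //; apply: fine_cvg; rewrite fineK//.
exact: integrable_fin_num.
Qed.

Section half_line.
Variable R : realType.
Notation mu := (@lebesgue_measure R).
Notation Rpos := (`]0%R, +oo[%classic : set R).

(** The integrands it is meant for oscillate, so the fundamental theorem is applied on []0, n]] and
    dominated convergence lets [n] grow. *)
Lemma Rintegral_Rpos_derive (F f : R -> R) :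
  (forall t : R, is_derive t 1 F (f t)) -> continuous f ->
  mu.-integrable Rpos (EFin \o f) -> F t @[t --> +oo] --> 0 ->
  \int[mu]_(t in Rpos) f t = - F 0.
Proof.
move=> dF cf fi F0.
have mf : measurable_fun setT f by exact: continuous_measurable_fun.
pose fn (n : nat) := f \_ `]0, n%:R].
have mfn n : measurable_fun Rpos (fn n).
  by apply/measurable_restrict => //; apply: measurable_funTS.
have fnf t : Rpos t -> fn n t @[n --> \oo] --> f t.
  rewrite /= in_itv/= andbT => t0.
  apply: cvg_near_cst; near=> n; rewrite /fn patchE ifT// inE/= in_itv/= t0/=.
  by near: n; exact: nbhs_infty_ger.
have fn_le n t : Rpos t -> `|fn n t| <= `|f t|.
  by move=> _; rewrite /fn patchE; case: ifP => //; rewrite normr0.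
have [_ cv] := @dominated_cvg_Rintegral _ _ R mu Rpos fn f _ (measurable_itv _) mfn
  (measurable_funTS mf) (aeW mu fnf) (integrable_norm fi) fn_le.
have intE n : (0 < n)%N -> \int[mu]_(t in Rpos) fn n t = F n%:R - F 0.
  move=> n0; rewrite /fn -Rintegral_mkcondr.
  rewrite (_ : _ `&` _ = `]0, n%:R]%classic); last first.
    apply/seteqP; split=> [t []//|t]; rewrite /= !in_itv/= => /andP[t0 tn].
    by rewrite t0 tn.
  have n0' : (0 : R) < n%:R by rewrite ltr0n.
  rewrite Rintegral_itv_obnd_cbnd; last first.
    by apply: integrableS fi => //; exact: subset_itvl.
  rewrite /Rintegral (@continuous_FTC2 _ _ F)//.
  - exact: continuous_subspaceT.
  - have cF : continuous F.
      by move=> t; apply: differentiable_continuous; apply/derivable1_diffP; exact: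
          ex_derive.
    split=> [t _||]; first exact: ex_derive.
    + exact: cvg_at_right_filter (cF 0).
    + exact: cvg_at_left_filter (cF _).
  - by move=> t _; rewrite derive1E derive_val.
have /(cvg_unique (@Rhausdorff R) cv) -> : (\int[mu]_(t in Rpos) fn n t) @[n --> \oo]
    --> 0 - F 0; last by rewrite sub0r.
  apply: (@cvg_trans _ ((F n%:R - F 0) @[n --> \oo])).
    apply: near_eq_cvg; near=> n; rewrite intE//.
    by near: n; exact: nbhs_infty_gt.
  apply: cvgB; last exact: cvg_cst.
  exact: (cvg_comp _ _ cvgr_idn F0).
Unshelve. all: by end_near. Qed.

(** The constant [n! / c^n] comes from keeping the single term [(c t)^n / n!] of the exponential
    series. *)
Lemma exprn_le_expR (n : nat) (c : R) : 0 < c ->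
  exists2 K : R, 0 <= K & forall t : R, 0 <= t -> t ^+ n <= K * expR (c * t).
Proof.
move=> c0; exists (n`!%:R / c ^+ n); first by rewrite divr_ge0// exprn_ge0// ltW.
move=> t t0; have ct0 : 0 <= c * t by rewrite mulr_ge0// ltW.
rewrite mulrAC ler_pdivlMr ?exprn_gt0// -exprMn (mulrC t).
case: n => [|n]; first by rewrite expr0 fact0 mul1r -expR0 ler_expR.
have h := expR_ge1Dxn n ct0.
rewrite -ler_pdivrMl ?ltr0n ?fact_gt0// [leLHS]mulrC.
by apply: (le_trans _ h); rewrite lerDr.
Qed.

Lemma cvg_expRN_mul (c : R) : 0 < c -> expR (- (c * t)) @[t --> +oo] --> (0 : R).
Proof.
move=> c0; apply: (@cvg_comp _ _ _ (fun t => c * t) (fun t => expR (- t)) _ (+oo :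
    set_system R)).
  by apply: gt0_cvgMry => //; exact: cvg_id.
exact: cvgr_expR.
Qed.

Lemma is_derive_expRM (c t : R) :
  is_derive t 1 (fun t => expR (c * t)) (c * expR (c * t)).
Proof.
have dc : is_derive t 1 (fun t => c * t) c.
  by apply: is_derive_eq; rewrite /GRing.scale /= mulr1.
have := is_derive1_comp (is_derive_expR (c * t)) dc.
by rewrite mulrC.
Qed.

Lemma continuous_expRM (c : R) : continuous (fun t : R => expR (c * t)).
Proof.
move=> t; apply: differentiable_continuous; apply/derivable1_diffP.
exact: (@ex_derive _ _ _ _ _ _ _ (is_derive_expRM c t)).
Qed.

Lemma measurable_expRM (c : R) : measurable_fun setT (fun t : R => expR (c * t)).
Proof. by apply: continuous_measurable_fun; exact: continuous_expRM. Qed.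

Lemma integral_expRN (c : R) : 0 < c ->
  (\int[mu]_(t in Rpos) (expR (- c * t))%:E = (c^-1)%:E)%E.
Proof.
move=> c0; rewrite integral_itv_obnd_cbnd; last first.
  by apply/measurable_EFinP; exact: measurable_funTS (measurable_expRM _).
have dF (t : R) : is_derive t 1 (fun t => - c^-1 * expR (- c * t)) (expR (- c * t)).
  have := is_derive_expRM (- c) t => h.
  apply: is_derive_eq; rewrite /GRing.scale /= mulrA mulrNN mulVf ?gt_eqF//.
  by rewrite mul1r.
rewrite [LHS](@ge0_continuous_FTC2y _ (fun t => expR (- c * t))
  (fun t => - c^-1 * expR (- c * t)) 0 0).
- by rewrite mulr0 expR0 mulr1 sub0e EFinN oppeK.
- by move=> t _; exact: expR_ge0.
- by apply: continuous_subspaceT; exact: continuous_expRM.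
- rewrite -[X in _ --> X](mulr0 (- c^-1)); apply: cvgM; first exact: cvg_cst.
  by under eq_fun do rewrite mulNr; exact: cvg_expRN_mul.
- by move=> t _; exact: ex_derive.
- apply: cvg_at_right_filter; apply: cvgM; first exact: cvg_cst.
  exact: continuous_expRM.
- by move=> t _; rewrite derive1E; exact: derive_val.
Qed.

Lemma measurable_exprn_expR n (c : R) :
  measurable_fun setT (fun t : R => t ^+ n * expR (c * t)).
Proof.
apply: continuous_measurable_fun => t; apply: cvgM; last exact: continuous_expRM.
exact: exprn_continuous.
Qed.

Lemma integrable_exprn_expR n (x : R) : 0 < x ->
  mu.-integrable Rpos (EFin \o (fun t => t ^+ n * expR (- x * t))).
Proof.
move=> x0; have x20 : 0 < x / 2 by rewrite divr_gt0.
have [K K0 HK] := exprn_le_expR n x20.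
apply: (@le_integrable_EFin _ _ R mu Rpos _ _ (fun t => K * expR (- (x / 2) * t))) => //.
- exact: measurable_funTS (measurable_exprn_expR _ _).
- move=> t; rewrite /= in_itv/= andbT => t0.
  rewrite ger0_norm ?mulr_ge0 ?exprn_ge0 ?(ltW t0) ?expR_ge0//.
  apply: le_trans (ler_wpM2r (expR_ge0 _) (HK _ (ltW t0))) _.
  by rewrite -[leLHS]mulrA -expRD (_ : _ + _ = - (x / 2) * t)//; field.
- apply: integrable_EFinZl => //; apply: ge0_integrable_EFin => //.
  + exact: measurable_funTS (measurable_expRM _).
  + by rewrite [ltLHS](integral_expRN x20) ltry.
Qed.

Lemma integrable_exprn_expR_le1 n (x : R) (h : R -> R) : 0 < x ->
  measurable_fun setT h -> (forall t, `|h t| <= 1) ->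
  mu.-integrable Rpos (EFin \o (fun t => t ^+ n * (expR (- x * t) * h t))).
Proof.
move=> x0 mh h1; apply: le_integrable_EFin (integrable_exprn_expR n x0) => //.
- apply: measurable_funTS.
  under eq_fun do rewrite mulrA.
  by apply: measurable_funM => //; exact: measurable_exprn_expR.
- move=> t; rewrite /= in_itv/= andbT => t0.
  rewrite mulrA normrM ger0_norm; last by rewrite mulr_ge0 ?exprn_ge0 ?(ltW t0) ?expR_ge0.
  by rewrite ler_piMr// mulr_ge0 ?exprn_ge0 ?(ltW t0) ?expR_ge0.
Qed.

Lemma continuous_cosM (y : R) : continuous (fun t : R => cos (y * t)).
Proof.
move=> t; apply: (@continuous_comp _ _ _ ( *%R y) cos); first exact: mulrl_continuous.
exact: continuous_cos.
Qed.

Lemma continuous_sinM (y : R) : continuous (fun t : R => sin (y * t)).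
Proof.
move=> t; apply: (@continuous_comp _ _ _ ( *%R y) sin); first exact: mulrl_continuous.
exact: continuous_sin.
Qed.

Lemma is_derive_cosM (y t : R) :
  is_derive t 1 (fun t => cos (y * t)) (- (y * sin (y * t))).
Proof.
have dc : is_derive t 1 (fun t => y * t) y.
  by apply: is_derive_eq; rewrite /GRing.scale /= mulr1.
have := is_derive1_comp (is_derive_cos (y * t)) dc.
by rewrite mulNr mulrC.
Qed.

Lemma is_derive_sinM (y t : R) :
  is_derive t 1 (fun t => sin (y * t)) (y * cos (y * t)).
Proof.
have dc : is_derive t 1 (fun t => y * t) y.
  by apply: is_derive_eq; rewrite /GRing.scale /= mulr1.
have := is_derive1_comp (is_derive_sin (y * t)) dc.
by rewrite mulrC.
Qed.

Definition mcos n x y : R :=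
  \int[mu]_(t in Rpos) (t ^+ n * (expR (- x * t) * cos (y * t))).
Definition msin n x y : R :=
  \int[mu]_(t in Rpos) (t ^+ n * (expR (- x * t) * sin (y * t))).

Lemma integrable_mcos n (x y : R) : 0 < x ->
  mu.-integrable Rpos (EFin \o (fun t => t ^+ n * (expR (- x * t) * cos (y * t)))).
Proof.
move=> x0; apply: integrable_exprn_expR_le1 => //; last by move=> t; exact: cos_max.
by apply: continuous_measurable_fun; exact: continuous_cosM.
Qed.

Lemma integrable_msin n (x y : R) : 0 < x ->
  mu.-integrable Rpos (EFin \o (fun t => t ^+ n * (expR (- x * t) * sin (y * t)))).
Proof.
move=> x0; apply: integrable_exprn_expR_le1 => //; last by move=> t; exact: sin_max.
by apply: continuous_measurable_fun; exact: continuous_sinM.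
Qed.

Lemma cvg_exprn_expR_le1 n (x : R) (h : R -> R) : 0 < x ->
  (forall t, `|h t| <= 1) ->
  t ^+ n * (expR (- x * t) * h t) @[t --> +oo] --> (0 : R).
Proof.
move=> x0 h1; have x20 : 0 < x / 2 by rewrite divr_gt0.
have [K K0 HK] := exprn_le_expR n x20.
have HK0 : K * expR (- (x / 2 * t)) @[t --> +oo] --> (0 : R).
  by rewrite -[X in _ --> X](mulr0 K); apply: cvgM; [exact: cvg_cst|exact: cvg_expRN_mul].
have HKN0 : - (K * expR (- (x / 2 * t))) @[t --> +oo] --> (0 : R).
  by rewrite -oppr0; exact: cvgN.
apply: squeeze_cvgr HKN0 HK0.
near=> t; have t0 : 0 <= t by near: t; exact: nbhs_pinfty_ge.
rewrite -ler_norml mulrA normrM ger0_norm; last by rewrite mulr_ge0 ?exprn_ge0 ?expR_ge0.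
apply: (@le_trans _ _ (t ^+ n * expR (- x * t))).
  by rewrite ler_piMr// mulr_ge0 ?exprn_ge0 ?expR_ge0.
apply: le_trans (ler_wpM2r (expR_ge0 _) (HK _ t0)) _.
by rewrite -[leLHS]mulrA -expRD (_ : _ + _ = - (x / 2 * t))//; field.
Unshelve. all: by end_near. Qed.

End half_line.

(** * The integrals of [t^n e^{-zt}] *)

Section moments.
Variable R : realType.
Notation mu := (@lebesgue_measure R).
Notation Rpos := (`]0%R, +oo[%classic : set R).

Lemma is_derive_exprn n (t : R) :
  is_derive t 1 (fun t => t ^+ n) (n%:R * t ^+ n.-1).
Proof.
have := is_deriveX n (is_derive_id t (1 : R)).
rewrite /GRing.scale /= mulr1.
suff -> : (id : R -> R) ^+ n = (fun t => t ^+ n) by [].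
by apply/funext => s; rewrite exprfctE.
Qed.

(** Integrates the derivative of [t^n e^{-xt} cos(yt)], whose value at 0 is 1 exactly when [n = 0];
    in that case the coefficient [n%:R] cancels the term where [n.-1] is only the default
    predecessor. *)
Lemma mcos_rec n (x y : R) : 0 < x ->
  n%:R * mcos n.-1 x y - x * mcos n x y - y * msin n x y = - (n == 0)%:R.
Proof.
move=> x0.
pose f (t : R) := n%:R * (t ^+ n.-1 * (expR (- x * t) * cos (y * t)))
  - x * (t ^+ n * (expR (- x * t) * cos (y * t)))
  - y * (t ^+ n * (expR (- x * t) * sin (y * t))).
have cE : continuous (fun t : R => expR (- x * t)) by exact: continuous_expRM.
have cC : continuous (fun t : R => cos (y * t)) by exact: continuous_cosM.
have cS : continuous (fun t : R => sin (y * t)) by exact: continuous_sinM.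
have iC m := integrable_mcos m y x0.
have iS m := integrable_msin m y x0.
rewrite /mcos /msin -!RintegralZl// -!RintegralB//; try exact: integrable_EFinZl.
  rewrite [LHS](@Rintegral_Rpos_derive _ (fun t => t ^+ n * (expR (- x * t) * cos (y *
      t))) f).
  - by rewrite !mulr0 expR0 cos0 !mulr1 expr0n.
  - move=> t; have := is_derive_expRM (- x) t; have := is_derive_cosM y t => dC dE.
    have := is_deriveM (is_derive_exprn n t) (is_deriveM dE dC).
    move=> h;  apply: (is_derive_eq h).
    by rewrite /f /GRing.scale /= mulrfctE /=; ring.
  - move=> t; apply: cvgB; first apply: cvgB.
    + by apply: cvgM; [exact: cvg_cst|apply: cvgM; [exact: exprn_continuous|apply:
        cvgM; [exact: cE|first [exact: cC|exact: cS]]]].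
    + by apply: cvgM; [exact: cvg_cst|apply: cvgM; [exact: exprn_continuous|apply:
        cvgM; [exact: cE|first [exact: cC|exact: cS]]]].
    + by apply: cvgM; [exact: cvg_cst|apply: cvgM; [exact: exprn_continuous|apply:
        cvgM; [exact: cE|first [exact: cC|exact: cS]]]].
  - apply: integrable_EFinB => //; last exact: integrable_EFinZl.
    by apply: integrable_EFinB => //; exact: integrable_EFinZl.
  - by apply: cvg_exprn_expR_le1 => // t; exact: cos_max.
by apply: integrable_EFinB => //; exact: integrable_EFinZl.
Qed.

Lemma msin_rec n (x y : R) : 0 < x ->
  n%:R * msin n.-1 x y - x * msin n x y + y * mcos n x y = 0.
Proof.
move=> x0.
pose f (t : R) := n%:R * (t ^+ n.-1 * (expR (- x * t) * sin (y * t)))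
  - x * (t ^+ n * (expR (- x * t) * sin (y * t)))
  + y * (t ^+ n * (expR (- x * t) * cos (y * t))).
have cE : continuous (fun t : R => expR (- x * t)) by exact: continuous_expRM.
have cC : continuous (fun t : R => cos (y * t)) by exact: continuous_cosM.
have cS : continuous (fun t : R => sin (y * t)) by exact: continuous_sinM.
have iC m := integrable_mcos m y x0.
have iS m := integrable_msin m y x0.
rewrite /mcos /msin -!RintegralZl// -?RintegralB// -?RintegralD//; try exact:
    integrable_EFinZl.
  rewrite [LHS](@Rintegral_Rpos_derive _ (fun t => t ^+ n * (expR (- x * t) * sin (y *
      t))) f).
  - by rewrite !mulr0 sin0 !mulr0 oppr0.
  - move=> t; have := is_derive_expRM (- x) t; have := is_derive_sinM y t => dC dE.
    have := is_deriveM (is_derive_exprn n t) (is_deriveM dE dC).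
    move=> h; apply: (is_derive_eq h).
    by rewrite /f /GRing.scale /= mulrfctE /=; ring.
  - move=> t; apply: cvgD; first apply: cvgB.
    + by apply: cvgM; [exact: cvg_cst|apply: cvgM; [exact: exprn_continuous|apply:
        cvgM; [exact: cE|first [exact: cC|exact: cS]]]].
    + by apply: cvgM; [exact: cvg_cst|apply: cvgM; [exact: exprn_continuous|apply:
        cvgM; [exact: cE|first [exact: cC|exact: cS]]]].
    + by apply: cvgM; [exact: cvg_cst|apply: cvgM; [exact: exprn_continuous|apply:
        cvgM; [exact: cE|first [exact: cC|exact: cS]]]].
  - apply: integrable_EFinD => //; last exact: integrable_EFinZl.
    by apply: integrable_EFinB => //; exact: integrable_EFinZl.
  - by apply: cvg_exprn_expR_le1 => // t; exact: sin_max.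
by apply: integrable_EFinB => //; exact: integrable_EFinZl.
Qed.

(** The two real recurrences are the parts of [z M_n = n M_{n-1} + [n = 0]], where [M_n] is the
    integral of [t^n e^{-zt}]; induction on [n] follows. *)
Lemma moment_complex n (z : R[i]) : 0 < complex.Re z ->
  (mcos n (complex.Re z) (complex.Im z)) +i* (- msin n (complex.Re z) (complex.Im z))
  = n`!%:R / z ^+ n.+1.
Proof.
case: z => x y /= x0.
have z0 : (x +i* y) != 0 by rewrite eq_complex /= negb_and gt_eqF.
have rec m : (x +i* y) * (mcos m x y +i* (- msin m x y)) =
    m%:R * (mcos m.-1 x y +i* (- msin m.-1 x y)) + (m == 0)%:R.
  have hc := mcos_rec m y x0; have hs := msin_rec m y x0.
  rewrite -!(rmorph_nat (real_complex R)).
  by apply/eqP; rewrite eq_complex /=; apply/andP; split; apply/eqP;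
    rewrite ?mul0r ?addr0 ?subr0; lra.
elim: n => [|n IHn].
  have := rec 0; rewrite mul0r add0r eqxx => h.
  by rewrite expr1 fact0; apply: (mulfI z0); rewrite h mulrCA mulfV ?mulr1.
have := rec n.+1; rewrite /= IHn addr0 => h.
apply: (mulfI z0); rewrite h factS natrM [in RHS]exprS; field.
by rewrite z0 expf_neq0.
Qed.

Lemma mcos0 n (x : R) : 0 < x -> mcos n x 0 = n`!%:R / x ^+ n.+1.
Proof.
move=> x0; have := @moment_complex n (x +i* 0) x0.
rewrite /= => /(congr1 (@complex.Re R)) /= ->.
rewrite -[x +i* 0]/(x%:C) -(rmorphXn (real_complex R)) -(rmorph_nat (real_complex R)).
by rewrite -(fmorphV (real_complex R)) -(rmorphM (real_complex R)).
Qed.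

Lemma mcosE0 n (x : R) : mcos n x 0 = \int[mu]_(t in Rpos) (t ^+ n * expR (- x * t)).
Proof. by apply: eq_Rintegral => t _; rewrite mul0r cos0 mulr1. Qed.

Lemma Gamma_nat l : Gamma (1 + l%:R : R) = l`!%:R.
Proof.
have := @mcos0 l 1 ltr01; rewrite mcosE0 expr1n divr1 => <-.
apply: eq_Rintegral => t; rewrite inE /= in_itv/= andbT => t0.
by rewrite addrAC subrr add0r powR_mulrn ?(ltW t0)// mulN1r.
Qed.
End moments.

(** * Injectivity of the Laplace transform *)

Lemma bernoulli_le (R : realDomainType) (y : R) N : -1 <= y -> 1 + N%:R * y <= (1 + y)
    ^+ N.
Proof.
move=> y1; elim: N => [|N IH]; first by rewrite mul0r addr0.
have y1' : 0 <= 1 + y by lra.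
rewrite exprS; apply: le_trans (ler_wpM2l y1' IH); rewrite -natr1.
have : 0 <= N%:R * y ^+ 2 by rewrite mulr_ge0 ?sqr_ge0.
by rewrite expr2; lra.
Qed.

Section injectivity.
Variable R : realType.
Notation mu := (@lebesgue_measure R).
Notation Rpos := (`]0%R, +oo[%classic : set R).

Section tail.
Variables (G : R -> R) (c : R).
Hypothesis c0 : 0 < c.
Hypothesis Gi : mu.-integrable Rpos (EFin \o G).
(** Chosen so that [2 * s t] crosses 1 exactly at [t = c]; this is what the exponents [n] and
    [2 ^ n] in [q] compare. *)
Let x := ln 2 / c.
Hypothesis G0 : forall m, \int[mu]_(t in Rpos) (G t * expR (- x * t) ^+ m) = 0.

Let s t := expR (- x * t).
Let q (n : nat) t := (1 - s t ^+ n) ^+ (2 ^ n).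

Let x0 : 0 < x. Proof. by rewrite divr_gt0// ln_gt0// ltr1n. Qed.

Let ms : measurable_fun setT s. Proof. exact: measurable_expRM. Qed.

Let s01 t : Rpos t -> 0 < s t < 1.
Proof.
rewrite /= in_itv/= andbT => t0.
by rewrite expR_gt0 -expR0 ltr_expR mulNr oppr_lt0 mulr_gt0.
Qed.

Let p01 n k t : Rpos t -> 0 <= (1 - s t ^+ n) ^+ k <= 1.
Proof.
move=> /s01/andP[s0 s1].
have sn0 : 0 <= s t ^+ n by rewrite exprn_ge0// ltW.
have sn1 : s t ^+ n <= 1 by rewrite exprn_ile1// ltW.
have h0 : 0 <= 1 - s t ^+ n by lra.
have h1 : 1 - s t ^+ n <= 1 by lra.
by rewrite exprn_ge0//= exprn_ile1.
Qed.

Let mp n k : measurable_fun setT (fun t => (1 - s t ^+ n) ^+ k).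
Proof. by apply: measurable_funX; apply: measurable_funB => //; exact: measurable_funX.
    Qed.

Let Gp_int (h : R -> R) : measurable_fun setT h -> (forall t, Rpos t -> 0 <= h t <= 1) ->
  mu.-integrable Rpos (EFin \o (fun t => G t * h t)).
Proof.
move=> mh h1; apply: (@le_integrable_EFin _ _ R mu Rpos _ _ (fun t => `|G t|)) => //.
- apply: measurable_funM; first exact: integrable_EFin_measurable Gi.
  exact: measurable_funTS mh.
- by move=> t /h1/andP[h0 ?]; rewrite normrM ler_piMr// ger0_norm.
- exact: integrable_norm.
Qed.

(** The extra factor [s t ^+ m] closes the induction on [k]: expanding one factor [1 - s t ^+ n]
    replaces [m] by [n + m]. *)
Let Gp n k m : \int[mu]_(t in Rpos) (G t * ((1 - s t ^+ n) ^+ k * s t ^+ m)) = 0.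
Proof.
have hi k' m' : mu.-integrable Rpos (EFin \o (fun t => G t * ((1 - s t ^+ n) ^+ k' * s
    t ^+ m'))).
  apply: Gp_int.
    by apply: measurable_funM; [exact: mp|exact: measurable_funX].
  move=> t tp; have /andP[a0 a1] := p01 n k' tp; have /andP[s0 s1] := s01 tp.
  have b0 : 0 <= s t ^+ m' by rewrite exprn_ge0// ltW.
  have b1 : s t ^+ m' <= 1 by rewrite exprn_ile1// ltW.
  by rewrite mulr_ge0//= mulr_ile1.
elim: k m => [|k IH] m.
  by rewrite -[RHS](G0 m); apply: eq_Rintegral => t _; rewrite expr0 mul1r.
rewrite -[RHS](subrr (0 : R)) -[X in X - _](IH m) -[X in _ - X](IH (n + m)%N)
    -RintegralB//.
by apply: eq_Rintegral => t _; rewrite exprSr exprD; ring.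
Qed.

(** Bernoulli's inequality bounds [q n t] below by [1 - (2 * s t) ^+ n], and here [2 * s t < 1]. *)
Let q_gt t : c < t -> q n t @[n --> \oo] --> (1 : R).
Proof.
move=> ct; have t0 : Rpos t by rewrite /= in_itv/= andbT (lt_trans c0).
have /andP[s0 s1] := s01 t0.
have s2 : 2 * s t < 1.
  rewrite -[2]lnK ?posrE// -expRD -[ltRHS]expR0 ltr_expR mulNr subr_lt0.
  by rewrite mulrAC ltr_pdivlMr// ltr_pM2l// ln_gt0// ltr1n.
have h : (2 * s t) ^+ n @[n --> \oo] --> (0 : R).
  by apply: cvg_expr; rewrite ger0_norm// mulr_ge0// ltW.
have h1 : 1 - (2 * s t) ^+ n @[n --> \oo] --> (1 : R).
  by rewrite -[X in _ --> X]subr0; apply: cvgB => //; exact: cvg_cst.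
apply: squeeze_cvgr h1 (cvg_cst _); apply: nearW => n.
have /andP[_ ->] := p01 n (2 ^ n) t0; rewrite andbT.
have := @bernoulli_le R (- s t ^+ n) (2 ^ n).
have sn1 : s t ^+ n <= 1 by rewrite exprn_ile1// ltW.
by rewrite lerN2 mulrN natrX -exprMn; exact.
Qed.

(** Multiplied by [(1 + s t ^+ n) ^+ (2 ^ n)], [q n t] becomes a power of [1 - s t ^+ (2n)], hence
    at most 1. By Bernoulli the multiplier is at least [(2 * s t) ^+ n], which tends to infinity. *)
Let q_lt t : 0 < t < c -> q n t @[n --> \oo] --> (0 : R).
Proof.
move=> /andP[t0 ct]; have Pt : Rpos t by rewrite /= in_itv/= andbT.
have /andP[s0 s1] := s01 Pt.
have s2 : 1 < 2 * s t.
  rewrite -[2]lnK ?posrE// -expRD -[ltLHS]expR0 ltr_expR mulNr subr_gt0.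
  by rewrite mulrAC ltr_pdivrMr// ltr_pM2l// ln_gt0// ltr1n.
have s20 : 0 < 2 * s t by exact: lt_trans s2.
have h : (2 * s t)^-1 ^+ n @[n --> \oo] --> (0 : R).
  apply: cvg_expr; rewrite ger0_norm ?invr_ge0 ?(ltW s20)//.
  by rewrite invf_lt1.
apply: squeeze_cvgr (cvg_cst _) h; apply: nearW => n.
have /andP[q0 _] := p01 n (2 ^ n) Pt; rewrite q0/=.
have sn0 : 0 <= s t ^+ n by rewrite exprn_ge0// ltW.
have B := @bernoulli_le R (s t ^+ n) (2 ^ n) (le_trans (lerN10 R) sn0).
rewrite exprVn -[leRHS]mul1r ler_pdivlMr ?exprn_gt0//.
apply: (@le_trans _ _ (q n t * (1 + s t ^+ n) ^+ (2 ^ n))).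
  apply: ler_wpM2l => //; apply: le_trans B.
  by rewrite exprMn natrX lerDr.
rewrite -exprMn -subr_sqr expr1n exprn_ile1//.
  by rewrite subr_ge0 expr2 mulr_ile1 // exprn_ile1 ?ltW.
by rewrite gerBl sqr_ge0.
Qed.

Lemma Rintegral_tail_eq0 : \int[mu]_(t in `]c, +oo[) G t = 0.
Proof.
have mRp : measurable Rpos by exact: measurable_itv.
have mq n : measurable_fun Rpos (fun t => G t * q n t).
  apply: measurable_funM; first exact: integrable_EFin_measurable Gi.
  exact: measurable_funTS (mp _ _).
pose f := G \_ `]c, +oo[.
have mf : measurable_fun Rpos f.
  apply/measurable_restrict => //; apply: measurable_funS (integrable_EFin_measurable
      Gi) => //.
have qf : {ae mu, forall t, Rpos t -> G t * q n t @[n --> \oo] --> f t}.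
  (* At [t = c] the sequence [q n t] is [(1 - 2^-n)^(2^n)], which tends to 1/e; this point is
     discarded as a null set. *)
  exists [set c]; split; [exact: measurable_set1|exact: lebesgue_measure_set1|].
  move=> t /= /not_implyP[t0 h]; apply/eqP/negP => /negP tc; apply: h.
  rewrite /f patchE; case: ifPn; rewrite ?notin_setE ?inE /= in_itv/= andbT => ct.
    by rewrite -[X in _ --> X]mulr1; apply: cvgM; [exact: cvg_cst|exact: q_gt].
  rewrite -[X in _ --> X](mulr0 (G t)); apply: cvgM; [exact: cvg_cst|apply: q_lt].
  move: t0; rewrite in_itv/= andbT => ->/=; move/negP: ct; rewrite -leNgt le_eqVlt.
  by rewrite (negbTE tc).
have q_le n t : Rpos t -> `|G t * q n t| <= `|G t|.
  move=> t0; have /andP[a b] := p01 n (2 ^ n) t0.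
  by rewrite normrM ler_piMr// ger0_norm.
have [_] := @dominated_cvg_Rintegral _ _ R mu Rpos _ f _ mRp mq mf qf (integrable_norm
    Gi) q_le.
rewrite -Rintegral_mkcondr (_ : _ `&` _ = `]c, +oo[%classic); last first.
  apply/seteqP; split=> [t []//|t]; rewrite /= !in_itv/= !andbT => ct.
  by rewrite ct (lt_trans c0).
move=> cv; apply: (cvg_unique (@Rhausdorff R) cv).
apply: cvg_near_cst; apply: nearW => n.
by rewrite -[RHS](Gp n (2 ^ n) 0); apply: eq_Rintegral => t _; rewrite expr0 mulr1.
Qed.

End tail.

Lemma laplace_eq0 (g : R -> R) :
  (forall x, 0 < x -> mu.-integrable Rpos (EFin \o (fun t => g t * expR (- x * t)))) ->
  (forall x, 0 < x -> \int[mu]_(t in Rpos) (g t * expR (- x * t)) = 0) ->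
  {ae mu, forall t, Rpos t -> g t = 0}.
Proof.
move=> gi g0; have mRp : measurable Rpos by exact: measurable_itv.
(* [g] alone need not be integrable; the factor [e^{-t}] makes it so, and the abscissas used become
   [1 + m ln 2 / c], positive even for [m = 0]. *)
pose G t := g t * expR (- 1 * t).
have Gi : mu.-integrable Rpos (EFin \o G) by exact: gi.
have tail c : 0 < c -> \int[mu]_(t in `]c, +oo[) G t = 0.
  move=> c0; apply: Rintegral_tail_eq0 => // m.
  have x0 : 0 < ln 2 / c by rewrite divr_gt0// ln_gt0// ltr1n.
  rewrite -[RHS](g0 (1 + m%:R * (ln 2 / c))); last first.
    by rewrite ltr_wpDr// mulr_ge0// ltW.
  apply: eq_Rintegral => t _; rewrite /G -expRM_natl -mulrA -expRD.
  by congr (_ * expR _); ring.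
have Fc c : 0 < c -> \int[mu]_(t in `]0, c]) G t = 0.
  move=> c0; have := @Rintegral_itvB R G (BRight 0) +oo%O c Gi.
  rewrite !bnd_simp (ltW c0) (tail c c0) => /(_ isT isT)/eqP.
  rewrite (_ : \int[mu]_(t in Rpos) G t = 0); last exact: g0.
  by rewrite sub0r oppr_eq0 => /eqP.
pose f := G \_ Rpos.
have fi y : mu.-integrable `]0, y] (EFin \o f).
  apply: eq_integrable (integrableS _ _ _ Gi) => //; last by apply: subset_itvl.
  by move=> t; rewrite inE/= in_itv/= => /andP[t0 _]; rewrite /f patchE mem_set//=
      in_itv/= t0.
have lf : locally_integrable setT f by exact: integrable_locally.
(* Lebesgue differentiation: the primitive of [f] is constantly 0 near each [t > 0], so its
   derivative, almost everywhere [f t], is 0. *)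
have := FTC1 (a := BRight 0) fi lf.
apply: filterS; first exact: (ae_filter_ringOfSetsType mu).
move=> t /= h t0; have t0' := t0; rewrite /= in_itv/= andbT in t0'.
have [_] := h t0'; rewrite derive1E.
rewrite (@near_eq_derive _ _ _ _ (fun=> 0)).
  rewrite derive_cst /f patchE mem_set// => /esym/eqP.
  by rewrite mulf_eq0 (gt_eqF (expR_gt0 _)) orbF => /eqP.
near=> y; have y0 : 0 < y by near: y; exact: lt_nbhsr.
rewrite -[RHS](Fc y y0); apply: eq_Rintegral => u; rewrite inE/= in_itv/= => /andP[u0 _].
by rewrite /f patchE mem_set//= in_itv/= u0.
Unshelve. all: by end_near. Qed.

End injectivity.

(** * Fubini on product domains and Plancherel's inequality *)

Section product_domain.
Context d1 d2 (T1 : measurableType d1) (T2 : measurableType d2) (R : realType).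
Variables (m1 : {sigma_finite_measure set T1 -> \bar R}).
Variables (m2 : {sigma_finite_measure set T2 -> \bar R}).
Variables (D1 : set T1) (D2 : set T2).
Hypotheses (mD1 : measurable D1) (mD2 : measurable D2).
Local Open Scope ereal_scope.

(** Iterated integrals over [D1] and [D2] are those of the extension by 0, to which the whole-space
    theorems of Tonelli and Fubini apply. *)
Let section1 (f : T1 * T2 -> \bar R) x :
  ((fun x => \int[m2]_(y in D2) f (x, y)) \_ D1) x =
  \int[m2]_y (f \_ (D1 `*` D2)) (x, y).
Proof.
rewrite patchE; case: ifPn => xD.
  rewrite integral_mkcond; apply: eq_integral => y _.
  by rewrite !patchE in_setX xD.
rewrite -[LHS](integral0 m2 setT); apply: eq_integral => y _.
by rewrite patchE in_setX (negbTE xD).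
Qed.

Let section2 (f : T1 * T2 -> \bar R) y :
  ((fun y => \int[m1]_(x in D1) f (x, y)) \_ D2) y =
  \int[m1]_x (f \_ (D1 `*` D2)) (x, y).
Proof.
rewrite patchE; case: ifPn => yD.
  rewrite integral_mkcond; apply: eq_integral => x _.
  by rewrite !patchE in_setX yD andbT.
rewrite -[LHS](integral0 m1 setT); apply: eq_integral => x _.
by rewrite patchE in_setX (negbTE yD) andbF.
Qed.

Let mX : measurable (D1 `*` D2). Proof. exact: measurableX. Qed.

Let mf_restrict (f : T1 * T2 -> \bar R) : measurable_fun (D1 `*` D2) f ->
  measurable_fun setT (f \_ (D1 `*` D2)).
Proof.
by move=> mf; apply/(measurable_restrictT _ mX).
Qed.

Let f_restrict_ge0 (f : T1 * T2 -> \bar R) :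
  (forall x y, D1 x -> D2 y -> 0 <= f (x, y)) -> forall z, 0 <= (f \_ (D1 `*` D2)) z.
Proof.
move=> f0 [x y]; rewrite patchE; case: ifPn => // /[!inE] -[/= ? ?]; exact: f0.
Qed.

Lemma tonelli_on (f : T1 * T2 -> \bar R) : measurable_fun (D1 `*` D2) f ->
  (forall x y, D1 x -> D2 y -> 0 <= f (x, y)) ->
  \int[m1]_(x in D1) \int[m2]_(y in D2) f (x, y) =
  \int[m2]_(y in D2) \int[m1]_(x in D1) f (x, y).
Proof.
move=> mf f0; rewrite integral_mkcond (eq_integral _ _ (fun x _ => section1 f x)).
rewrite [RHS]integral_mkcond (eq_integral _ _ (fun y _ => section2 f y)).
by apply: fubini_tonelli; [exact: mf_restrict|exact: f_restrict_ge0].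
Qed.

Lemma measurable_integral_on (f : T1 * T2 -> \bar R) : measurable_fun (D1 `*` D2) f ->
  (forall x y, D1 x -> D2 y -> 0 <= f (x, y)) ->
  measurable_fun D1 (fun x => \int[m2]_(y in D2) f (x, y)).
Proof.
move=> mf f0; apply/(measurable_restrictT _ mD1).
rewrite (funext (section1 f)).
by apply: measurable_fun_fubini_tonelli_F; [exact: mf_restrict|exact: f_restrict_ge0].
Qed.

Local Close Scope ereal_scope.

Lemma measurable_Rintegral_on (f : T1 * T2 -> R) : measurable_fun (D1 `*` D2) f ->
  measurable_fun D1 (fun x => \int[m2]_(y in D2) f (x, y)).
Proof.
move=> mf.
have mF : measurable_fun (D1 `*` D2) (EFin \o f) by exact/measurable_EFinP.
apply: (measurableT_comp (@fine_measurable R setT measurableT)).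
rewrite (_ : (fun x => _) = fun x => (\int[m2]_(y in D2) (EFin \o f)^\+%E (x, y) -
    \int[m2]_(y in D2) (EFin \o f)^\-%E (x, y))%E).
  apply: emeasurable_funB; apply: measurable_integral_on => //.
  - exact: measurable_funepos.
  - exact: measurable_funeneg.
apply/funext => x; rewrite integralE; congr (_ - _)%E; apply: eq_integral => y _.
  by rewrite !funeposE.
by rewrite !funenegE.
Qed.

Lemma Fubini_on (f : T1 * T2 -> R) : measurable_fun (D1 `*` D2) f ->
  (\int[m1]_(x in D1) \int[m2]_(y in D2) (`|f (x, y)|)%:E < +oo)%E ->
  (forall x, D1 x -> m2.-integrable D2 (EFin \o (fun y => f (x, y)))) ->
  (forall y, D2 y -> m1.-integrable D1 (EFin \o (fun x => f (x, y)))) ->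
  m1.-integrable D1 (EFin \o (fun x => \int[m2]_(y in D2) f (x, y))) /\
  \int[m1]_(x in D1) \int[m2]_(y in D2) f (x, y) =
  \int[m2]_(y in D2) \int[m1]_(x in D1) f (x, y).
Proof.
move=> mf foo f1 f2.
have mF : measurable_fun (D1 `*` D2) (EFin \o f) by exact/measurable_EFinP.
have mFr := mf_restrict mF.
have Fi : (m1 \x m2)%E.-integrable setT ((EFin \o f) \_ (D1 `*` D2)).
  apply/(integrable12ltyP _ _ mFr).
  rewrite (_ : (\int[m1]_x _ = \int[m1]_(x in D1) \int[m2]_(y in D2) (`|f (x,
      y)|)%:E)%E)//.
  rewrite [RHS]integral_mkcond (eq_integral _ _ (fun x _ => section1 (fun z => (`|f
      z|)%:E) x)).
  apply: eq_integral => x _; apply: eq_integral => y _.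
  by rewrite !patchE; case: ifPn => //= _; rewrite normr0.
have E1 : {in D1, forall x, ((\int[m2]_(y in D2) f (x, y))%:E = \int[m2]_(y in D2) (f
    (x, y))%:E)%E}.
  by move=> x /set_mem xD; rewrite RintegralK//; exact: f1.
have E2 : {in D2, forall y, ((\int[m1]_(x in D1) f (x, y))%:E = \int[m1]_(x in D1) (f
    (x, y))%:E)%E}.
  by move=> y /set_mem yD; rewrite RintegralK//; exact: f2.
split.
  have := integrable_fubini_F Fi.
  rewrite /fubini_F -(funext (section1 (EFin \o f))).
  move/(integrable_mkcond _ mD1).
  by apply: eq_integrable => // x xD /=; rewrite E1.
rewrite /Rintegral; congr fine.
rewrite (eq_integral _ _ E1) (eq_integral _ _ E2).
rewrite integral_mkcond (eq_integral _ _ (fun x _ => section1 (EFin \o f) x)).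
rewrite [RHS]integral_mkcond (eq_integral _ _ (fun y _ => section2 (EFin \o f) y)).
exact: Fubini.
Qed.

Lemma measurable_fst_on (g : T1 -> R) : measurable_fun D1 g ->
  measurable_fun (D1 `*` D2) (fun z => g z.1).
Proof.
move=> mg; apply: (measurable_comp (F := D1) (g := fst)) => //.
  by move=> _ [z [? ?] <-].
exact: measurable_funTS measurable_fst.
Qed.

Lemma measurable_snd_on (g : T2 -> R) : measurable_fun D2 g ->
  measurable_fun (D1 `*` D2) (fun z => g z.2).
Proof.
move=> mg; apply: (measurable_comp (F := D2) (g := snd)) => //.
  by move=> _ [z [? ?] <-].
exact: measurable_funTS measurable_snd.
Qed.
End product_domain.

Section bounded_kernel.
Context d1 d2 (T1 : measurableType d1) (T2 : measurableType d2) (R : realType).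
Variables (m1 : {sigma_finite_measure set T1 -> \bar R}).
Variables (m2 : {sigma_finite_measure set T2 -> \bar R}).
Variables (D1 : set T1) (D2 : set T2).
Hypotheses (mD1 : measurable D1) (mD2 : measurable D2).
Variables (a : T1 -> R) (b : T2 -> R) (h : T1 -> T2 -> R) (M : R).
Hypotheses (ai : m1.-integrable D1 (EFin \o a)) (bi : m2.-integrable D2 (EFin \o b)).
Hypothesis mh : measurable_fun (D1 `*` D2) (fun z => h z.1 z.2).
Hypothesis mh1 : forall x, measurable_fun D2 (h x).
Hypothesis mh2 : forall y, measurable_fun D1 (h ^~ y).
Hypothesis hM : forall x y, `|h x y| <= M.

(** Serves twice in the Plancherel estimate: with the kernel [cos (y * (t - s))] and with the kernel
    [fcosB]. Absolute integrability holds because [M |a| |b|] is a product. *)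
Lemma Fubini_bounded_kernel :
  m1.-integrable D1 (EFin \o
    (fun x => \int[m2]_(y in D2) (a x * (b y * h x y)))) /\
  \int[m1]_(x in D1) \int[m2]_(y in D2) (a x * (b y * h x y)) =
  \int[m2]_(y in D2) \int[m1]_(x in D1) (a x * (b y * h x y)).
Proof.
have bhi x : m2.-integrable D2 (EFin \o (fun y => b y * h x y)).
  by apply: (integrable_EFinM_bounded mD2 bi (mh1 x)) => y _; exact: hM.
have f1 x : m2.-integrable D2 (EFin \o (fun y => a x * (b y * h x y))).
  exact: integrable_EFinZl.
have f2 y : m1.-integrable D1 (EFin \o (fun x => a x * (b y * h x y))).
  apply: (@integrable_EFinM_bounded _ _ _ _ _ mD1 (`|b y| * M) a (fun x => b y * h x y)
      ai).
    by apply: measurable_funM => //; exact: mh2.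
  by move=> x _; rewrite normrM ler_wpM2l.
have ma := integrable_EFin_measurable ai; have mb := integrable_EFin_measurable bi.
have mf : measurable_fun (D1 `*` D2) (fun z => a z.1 * (b z.2 * h z.1 z.2)).
  apply: measurable_funM; first exact: measurable_fst_on.
  by apply: measurable_funM => //; exact: measurable_snd_on.
apply: (Fubini_on mD1 mD2 mf) => [|x _|y _]; [|exact: f1|exact: f2].
pose K := \int[m2]_(y in D2) `|b y|.
have Mbi : m2.-integrable D2 (EFin \o (fun y => M * `|b y|)).
  by apply: integrable_EFinZl => //; exact: integrable_norm.
apply: (@le_lt_trans _ _ (\int[m1]_(x in D1) (M * K * `|a x|)%:E)%E); last first.
  apply: integrable_lty => //.
  by apply: integrable_EFinZl => //; exact: integrable_norm.
apply: ge0_le_integral => //.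
- by move=> x _; exact: integral_ge0.
- apply: (measurable_integral_on m2 mD1 mD2 (f := fun z => (`|a z.1 * (b z.2 * h z.1
    z.2)|)%:E)) => //.
  by apply/measurable_EFinP; exact: measurableT_comp.
- by apply/measurable_EFinP; apply: measurable_funM => //; exact: measurableT_comp.
move=> x _; rewrite mulrC /K -(RintegralZl _ mD2 (integrable_norm bi)).
rewrite -(RintegralZl _ mD2 Mbi) RintegralK//; last exact: integrable_EFinZl.
apply: ge0_le_integral => //.
- apply/measurable_EFinP; apply: measurableT_comp => //.
  exact: (integrable_EFin_measurable (f1 x)).
- apply/measurable_EFinP; do 2 apply: measurable_funM => //.
  exact: measurableT_comp.
- move=> y _; rewrite lee_fin !normrM ler_wpM2l//.
  by rewrite mulrC ler_wpM2r.
Qed.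
End bounded_kernel.

(** * Schur's test *)

Section schur.
Context d (T : measurableType d) (R : realType).
Variable m : {sigma_finite_measure set T -> \bar R}.
Variable D : set T.
Hypothesis mD : measurable D.
Variables (u : T -> R) (k : T -> T -> R) (c M : R).
Hypothesis ui : m.-integrable D (EFin \o u).
Hypothesis u2i : m.-integrable D (EFin \o (fun t => u t ^+ 2)).
Hypothesis mk : measurable_fun (D `*` D) (fun z => k z.1 z.2).
Hypothesis mks : forall s, measurable_fun D (k s).
Hypothesis k0 : forall s t, 0 <= k s t.
Hypothesis ksym : forall s t, k s t = k t s.
Hypothesis kM : forall s t, k s t <= M.
Hypothesis kc : forall s, (\int[m]_(t in D) (k s t)%:E <= c%:E)%E.

Let uk_int s : m.-integrable D (EFin \o (fun t => u t * k s t)).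
Proof.
by apply: (integrable_EFinM_bounded mD ui (mks s)) => t _; rewrite ger0_norm.
Qed.

Let mu_ : measurable_fun D u := integrable_EFin_measurable ui.
Let mu2 : measurable_fun D (fun t => u t ^+ 2) := integrable_EFin_measurable u2i.

Let uk0 s t r : (0 <= (u s ^+ 2 * k t r)%:E)%E.
Proof. by rewrite lee_fin mulr_ge0 ?sqr_ge0. Qed.

Let mf1 : measurable_fun (D `*` D) (fun z => (u z.1 ^+ 2 * k z.1 z.2)%:E).
Proof.
by apply/measurable_EFinP; apply: measurable_funM mk; exact: measurable_fst_on mu2.
Qed.

Let mf2 : measurable_fun (D `*` D) (fun z => (u z.2 ^+ 2 * k z.1 z.2)%:E).
Proof.
by apply/measurable_EFinP; apply: measurable_funM mk; exact: measurable_snd_on mu2.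
Qed.

Let mfs s (v : T -> R) : measurable_fun D v ->
  measurable_fun D (fun t => (v t ^+ 2 * k s t)%:E).
Proof.
by move=> mv; apply/measurable_EFinP; apply: measurable_funM => //; exact:
    measurable_funX.
Qed.

Let I1 := (\int[m]_(s in D) \int[m]_(t in D) (u s ^+ 2 * k s t)%:E)%E.
Let I2 := (\int[m]_(s in D) \int[m]_(t in D) (u t ^+ 2 * k s t)%:E)%E.

Let mI1 : measurable_fun D (fun s => \int[m]_(t in D) (u s ^+ 2 * k s t)%:E)%E.
Proof. by apply: (measurable_integral_on m mD mD mf1). Qed.

Let mI2 : measurable_fun D (fun s => \int[m]_(t in D) (u t ^+ 2 * k s t)%:E)%E.
Proof. by apply: (measurable_integral_on m mD mD mf2). Qed.

Let I1_le : (I1 <= (c * \int[m]_(t in D) (u t ^+ 2))%:E)%E.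
Proof.
rewrite -RintegralZl// RintegralK//; last exact: integrable_EFinZl.
apply: ge0_le_integral => //.
- by move=> s _; exact: integral_ge0.
- by apply/measurable_EFinP; exact: measurable_funM.
- move=> s _; under eq_integral do rewrite EFinM.
  rewrite ge0_integralZl//.
  + rewrite (mulrC c) [leRHS]EFinM; apply: lee_wpmul2l; first by rewrite lee_fin sqr_ge0.
    exact: kc.
  + exact/measurable_EFinP.
  + by move=> t _; rewrite lee_fin.
  + by rewrite lee_fin sqr_ge0.
Qed.

Let I12_le : (2^-1%:E * (I1 + I2) <= (c * \int[m]_(t in D) (u t ^+ 2))%:E)%E.
Proof.
rewrite (_ : I2 = I1).
  by rewrite -mule2n -mule_natl muleA -EFinM mulVf// mul1e I1_le.
rewrite /I2 (tonelli_on m m mD mD mf2 (fun s t _ _ => uk0 t s t)).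
by apply: eq_integral => t _; apply: eq_integral => s _ /=; rewrite ksym.
Qed.

(* Schur's test for a symmetric kernel, via 2|u(s)u(t)| <= u(s)^2 + u(t)^2. *)
Lemma schur_test :
  (\int[m]_(s in D) (`|u s * \int[m]_(t in D) (u t * k s t)|)%:E <=
   (c * \int[m]_(t in D) (u t ^+ 2))%:E)%E.
Proof.
have mV : measurable_fun D (fun s => \int[m]_(t in D) (u t * k s t)).
  apply: (measurable_Rintegral_on m mD mD (f := fun z => u z.2 * k z.1 z.2)).
  by apply: measurable_funM mk; exact: measurable_snd_on.
apply: le_trans I12_le.
have I10 s : D s -> (0 <= \int[m]_(t in D) (u s ^+ 2 * k s t)%:E)%E.
  by move=> _; exact: integral_ge0.
have I20 s : D s -> (0 <= \int[m]_(t in D) (u t ^+ 2 * k s t)%:E)%E.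
  by move=> _; exact: integral_ge0.
rewrite -(ge0_integralD m mD I10 mI1 I20 mI2).
rewrite -ge0_integralZl//; last 2 first.
- exact: emeasurable_funD.
- by move=> s _; apply: adde_ge0; exact: integral_ge0.
apply: ge0_le_integral => //.
- by apply/measurable_EFinP; apply: measurableT_comp => //; exact: measurable_funM.
- by apply: emeasurable_funM => //; exact: emeasurable_funD.
move=> s _.
have ms1 : measurable_fun D (fun t => (u s ^+ 2 * k s t)%:E) by exact: (mfs s (v :=
    fun=> u s)).
have ms2 : measurable_fun D (fun t => (u t ^+ 2 * k s t)%:E) by exact: mfs.
rewrite -(ge0_integralD m mD (fun t _ => uk0 s s t) ms1 (fun t _ => uk0 t s t) ms2).
rewrite -ge0_integralZl//; last 2 first.
- exact: emeasurable_funD.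
- by move=> t _; rewrite adde_ge0.
have uki := integrable_norm (uk_int s).
apply: (@le_trans _ _ (\int[m]_(t in D) (`|u s| * `|u t * k s t|)%:E)%E).
  rewrite -(RintegralK mD (integrable_EFinZl mD `|u s| uki)).
  rewrite lee_fin (RintegralZl _ mD uki) normrM ler_wpM2l//.
  exact: le_normr_Rintegral.
apply: ge0_le_integral => //.
- apply/measurable_EFinP; apply: measurable_funM => //; apply: measurableT_comp => //.
  exact: (integrable_EFin_measurable (uk_int s)).
- by apply: emeasurable_funM => //; exact: emeasurable_funD.
move=> t _; rewrite -EFinD -EFinM lee_fin normrM (ger0_norm (k0 _ _)).
rewrite mulrA -mulrDl mulrA ler_wpM2r//.
rewrite -(real_normK (num_real (u s))) -(real_normK (num_real (u t))).
have := sqr_ge0 (`|u s| - `|u t|); rewrite !expr2; lra.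
Qed.
End schur.

(** * The Poisson kernel and Plancherel's inequality *)

Section plancherel.
Variable R : realType.
Notation mu := (@lebesgue_measure R).
Notation Rpos := (`]0%R, +oo[%classic : set R).

Definition poisson (e s : R) : R := e / (e ^+ 2 + s ^+ 2).

(** For [n = 0] the two recurrences form a linear system in [mcos 0 e s] and [msin 0 e s] with
    determinant [e^2 + s^2] up to sign. *)
Lemma mcos0_poisson (e s : R) : 0 < e -> mcos 0 e s = poisson e s.
Proof.
move=> e0; have /= := mcos_rec 0 s e0; have /= := msin_rec 0 s e0.
rewrite !mul0r => h1 h2; rewrite /poisson.
have d0 : e ^+ 2 + s ^+ 2 != 0 by rewrite gt_eqF// ltr_wpDr ?sqr_ge0// exprn_gt0.
apply: (mulIf d0); rewrite divfK//.
move: (mcos 0 e s) (msin 0 e s) h1 h2 => C S h1 h2.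
have -> : C * (e ^+ 2 + s ^+ 2) = e * (e * C + s * S) - s * (e * S - s * C) by ring.
have -> : e * C + s * S = 1 by lra.
have -> : e * S - s * C = 0 by lra.
by ring.
Qed.

Lemma poisson_ge0 (e s : R) : 0 < e -> 0 <= poisson e s.
Proof. by move=> e0; rewrite divr_ge0 ?addr_ge0 ?sqr_ge0// ltW. Qed.

Lemma poissonN (e s : R) : poisson e (- s) = poisson e s.
Proof. by rewrite /poisson sqrrN. Qed.

Lemma continuous_poisson (e s : R) : 0 < e -> continuous (fun t => poisson e (t - s)).
Proof.
move=> e0 t; apply: cvgM; first exact: cvg_cst.
apply: cvgV; first by rewrite gt_eqF// ltr_wpDr ?sqr_ge0// exprn_gt0.
apply: cvgD; first exact: cvg_cst.
apply: (@continuous_comp _ _ _ (fun t => t - s) (fun t => t ^+ 2)); last exact: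
    exprn_continuous.
by apply: cvgB; [exact: cvg_id|exact: cvg_cst].
Qed.

(** The primitive is [atan ((t - s) / e)], whose total variation on the line is [pi]. The bound is
    uniform in [s], as Schur's test demands, and in [e], as the removal of the regularisation
    demands. *)
Lemma integral_poisson_le (e s : R) : 0 < e ->
  (\int[mu]_(t in Rpos) (poisson e (t - s))%:E <= pi%:E)%E.
Proof.
move=> e0.
have mP : measurable_fun setT (fun t : R => poisson e (t - s)).
  by apply: continuous_measurable_fun; exact: continuous_poisson.
pose F (t : R) := atan (e^-1 * (t - s)).
have dF (t : R) : is_derive t 1 F (poisson e (t - s)).
  have dc : is_derive t 1 (fun t => e^-1 * (t - s)) e^-1.
    by apply: is_derive_eq; rewrite /GRing.scale /= subr0 mulr1.
  have h := @is_derive1_comp R atan (fun t => e^-1 * (t - s)) t _ _ (is_derive1_atan _)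
      dc.
  apply: (is_derive_eq h); rewrite /poisson; field.
  by rewrite (gt_eqF e0) gt_eqF// ltr_wpDr ?sqr_ge0// exprn_gt0.
rewrite integral_itv_obnd_cbnd; last first.
  by apply/measurable_EFinP; exact: measurable_funTS mP.
rewrite (@ge0_continuous_FTC2y _ (fun t => poisson e (t - s)) F 0 (pi / 2)).
- rewrite -EFinB lee_fin /F; have := atan_gtNpi2 (e^-1 * (0 - s)).
  by lra.
- by move=> t _; exact: poisson_ge0.
- by apply: continuous_subspaceT; exact: continuous_poisson.
- apply: (@cvg_comp _ _ _ (fun t => e^-1 * (t - s)) atan _ (+oo : set_system R)); last
    exact: cvgy_atan.
  apply: gt0_cvgMry; first by rewrite invr_gt0.
  by apply: cvg_addrr.
- by move=> t _; exact: ex_derive.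
- apply: cvg_at_right_filter; apply: differentiable_continuous; apply/derivable1_diffP.
  exact: ex_derive.
- by move=> t _; rewrite derive1E; exact: derive_val.
Qed.

End plancherel.

Section plancherel.
Variable R : realType.
Notation mu := (@lebesgue_measure R).
Notation Rpos := (`]0%R, +oo[%classic : set R).

Variable u : R -> R.
Hypothesis ui : mu.-integrable Rpos (EFin \o u).
Hypothesis u2i : mu.-integrable Rpos (EFin \o (fun t => u t ^+ 2)).

Definition fcos (y : R) := \int[mu]_(t in Rpos) (u t * cos (y * t)).
Definition fsin (y : R) := \int[mu]_(t in Rpos) (u t * sin (y * t)).

Let mRp : measurable (Rpos : set (measurableTypeR R)). Proof. exact: measurable_itv. Qed.
Let mu_ : measurable_fun Rpos u. Proof. exact: integrable_EFin_measurable ui. Qed.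

Let mcosM : measurable_fun setT (fun z : R * R => cos (z.1 * z.2)).
Proof.
apply: (@measurableT_comp _ _ _ _ _ _ (@cos R)).
  exact: continuous_measurable_fun (@continuous_cos R).
exact: measurable_funM measurable_fst measurable_snd.
Qed.

Let msinM : measurable_fun setT (fun z : R * R => sin (z.1 * z.2)).
Proof.
apply: (@measurableT_comp _ _ _ _ _ _ (@sin R)).
  exact: continuous_measurable_fun (@continuous_sin R).
exact: measurable_funM measurable_fst measurable_snd.
Qed.

Lemma measurable_fcos : measurable_fun Rpos fcos.
Proof.
apply: (@measurable_Rintegral_on _ _ _ _ _ mu Rpos Rpos mRp mRp (fun z => u z.2 * cos
    (z.1 * z.2))).
by apply: measurable_funM; [exact: measurable_snd_on|exact: measurable_funTS mcosM].
Qed.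

Lemma measurable_fsin : measurable_fun Rpos fsin.
Proof.
apply: (@measurable_Rintegral_on _ _ _ _ _ mu Rpos Rpos mRp mRp (fun z => u z.2 * sin
    (z.1 * z.2))).
by apply: measurable_funM; [exact: measurable_snd_on|exact: measurable_funTS msinM].
Qed.

Let K := \int[mu]_(t in Rpos) `|u t|.
(** With [F(y) = fcos y - i fsin y], the Fourier transform of [u], this is the real part of
    [e^{iys} F(y)]. Integrated against [u s] it gives [|F(y)|^2], now written as a double
    integral. *)
Definition fcosB y s := \int[mu]_(t in Rpos) (u t * cos (y * (t - s))).

Let mcosS (y s : R) : measurable_fun setT (fun t : R => cos (y * (t - s))).
Proof.
apply: (@measurableT_comp _ _ _ _ _ _ (@cos R)).
  exact: continuous_measurable_fun (@continuous_cos R).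
by apply: measurable_funM => //; exact: measurable_funB.
Qed.

Let mcosy y : measurable_fun setT (fun t : R => cos (y * t)).
Proof. by apply: continuous_measurable_fun; exact: continuous_cosM. Qed.

Let msiny y : measurable_fun setT (fun t : R => sin (y * t)).
Proof. by apply: continuous_measurable_fun; exact: continuous_sinM. Qed.

Let u_int (h : R -> R) : measurable_fun setT h -> (forall t, `|h t| <= 1) ->
  mu.-integrable Rpos (EFin \o (fun t => u t * h t)).
Proof.
move=> mh h1; apply: (@integrable_EFinM_bounded _ _ R mu Rpos mRp 1 u h ui) => //.
exact: measurable_funTS mh.
Qed.

Let J_int y s : mu.-integrable Rpos (EFin \o (fun t => u t * cos (y * (t - s)))).
Proof. by apply: u_int => [|t]; [exact: mcosS|exact: cos_max]. Qed.

Let cos_int y : mu.-integrable Rpos (EFin \o (fun t => u t * cos (y * t))).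
Proof. by apply: u_int => [|t]; [exact: mcosy|exact: cos_max]. Qed.

Let sin_int y : mu.-integrable Rpos (EFin \o (fun t => u t * sin (y * t))).
Proof. by apply: u_int => [|t]; [exact: msiny|exact: sin_max]. Qed.

Let J_le y s : `|fcosB y s| <= K.
Proof.
apply: le_trans (@le_normr_Rintegral _ _ R mu Rpos _ mRp (J_int y s)) _.
apply: le_Rintegral => //; [exact: integrable_norm|exact: integrable_norm|].
by move=> t _; rewrite normrM ler_piMr// cos_max.
Qed.

Lemma fcosBE y s : fcosB y s = fcos y * cos (y * s) + fsin y * sin (y * s).
Proof.
rewrite /fcosB /fcos /fsin -!RintegralZr// -RintegralD//.
- by apply: eq_Rintegral => t _; rewrite mulrBr cosB; ring.
- by have := integrable_EFinZl mRp (cos (y * s)) (cos_int y);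
    apply: eq_integrable => // t _ /=; rewrite mulrC.
- by have := integrable_EFinZl mRp (sin (y * s)) (sin_int y);
    apply: eq_integrable => // t _ /=; rewrite mulrC.
Qed.

Let mJ : measurable_fun (Rpos `*` Rpos) (fun z => fcosB z.1 z.2).
Proof.
rewrite (_ : (fun z => _) = fun z => fcos z.1 * cos (z.1 * z.2) + fsin z.1 * sin (z.1 *
    z.2)).
  apply: measurable_funD; apply: measurable_funM.
  - exact: measurable_fst_on measurable_fcos.
  - exact: measurable_funTS mcosM.
  - exact: measurable_fst_on measurable_fsin.
  - exact: measurable_funTS msinM.
by apply/funext => z; rewrite fcosBE.
Qed.

Lemma fcos_fsin_sqrE y : fcos y ^+ 2 + fsin y ^+ 2 = \int[mu]_(s in Rpos) (u s * fcosB
    y s).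
Proof.
rewrite !expr2 {1}/fcos {1}/fsin -!RintegralZr// -RintegralD//.
- by apply: eq_Rintegral => t _; rewrite fcosBE; ring.
- by have := integrable_EFinZl mRp (fcos y) (cos_int y);
    apply: eq_integrable => // t _ /=; rewrite mulrC.
- by have := integrable_EFinZl mRp (fsin y) (sin_int y);
    apply: eq_integrable => // t _ /=; rewrite mulrC.
Qed.

Section regularised.
Variable e : R.
Hypothesis e0 : 0 < e.
Let E y := expR (- e * y).

Let E_int : mu.-integrable Rpos (EFin \o E).
Proof.
by apply: eq_integrable (integrable_exprn_expR 0 e0) => // t _ /=; rewrite mul1r.
Qed.

Let mJs s : measurable_fun Rpos (fcosB ^~ s).
Proof.
rewrite (_ : fcosB ^~ s = fun y => fcos y * cos (s * y) + fsin y * sin (s * y)).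
  apply: measurable_funD; apply: measurable_funM.
  - exact: measurable_fcos.
  - exact: measurable_funTS (mcosy s).
  - exact: measurable_fsin.
  - exact: measurable_funTS (msiny s).
by apply/funext => y; rewrite fcosBE (mulrC y s).
Qed.

Let mJy y : measurable_fun Rpos (fcosB y).
Proof.
rewrite (_ : fcosB y = fun s => fcos y * cos (y * s) + fsin y * sin (y * s)).
  apply: measurable_funD; apply: measurable_funM => //.
  - exact: measurable_funTS (mcosy y).
  - exact: measurable_funTS (msiny y).
by apply/funext => s; rewrite fcosBE.
Qed.


Let V s := \int[mu]_(t in Rpos) (u t * poisson e (t - s)).

Let P_le s t : `|poisson e (t - s)| <= e^-1.
Proof.
rewrite ger0_norm ?poisson_ge0// /poisson.
have d0 : 0 < e ^+ 2 + (t - s) ^+ 2 by rewrite ltr_wpDr ?sqr_ge0// exprn_gt0.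
rewrite ler_pdivrMr// ler_pdivlMl// -expr2 lerDl sqr_ge0//.
Qed.

Let mP s : measurable_fun setT (fun t : R => poisson e (t - s)).
Proof. by apply: continuous_measurable_fun; exact: continuous_poisson. Qed.

Let mP2 : measurable_fun setT (fun z : R * R => poisson e (z.2 - z.1)).
Proof.
apply: (@measurableT_comp _ _ _ _ _ _ (poisson e)).
  by have := mP 0; under eq_fun do rewrite subr0.
exact: measurable_funB measurable_snd measurable_fst.
Qed.

Lemma Rintegral_fcosB s : \int[mu]_(y in Rpos) (E y * fcosB y s) = V s.
Proof.
rewrite /V.
have c1 z : `|cos z| <= 1 :> R by exact: cos_max.
have mc : measurable_fun (Rpos `*` Rpos) (fun z : R * R => cos (z.1 * (z.2 - s))).
  apply: measurable_funTS; apply: (@measurableT_comp _ _ _ _ _ _ (@cos R)).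
    exact: continuous_measurable_fun (@continuous_cos R).
  apply: measurable_funM; first exact: measurable_fst.
  by apply: measurable_funB => //; exact: measurable_snd.
have mcy y : measurable_fun Rpos (fun t : R => cos (y * (t - s))).
  exact: measurable_funTS (mcosS y s).
have mct t : measurable_fun Rpos (fun y : R => cos (y * (t - s))).
  apply: measurable_funTS.
  by have := mcosy (t - s); under eq_fun do rewrite mulrC.
have [_] := @Fubini_bounded_kernel _ _ _ _ R mu mu Rpos Rpos mRp mRp E u
  (fun y t => cos (y * (t - s))) 1 E_int ui mc mcy mct (fun _ _ => c1 _).
rewrite (_ : \int[mu]_(y in Rpos) (E y * fcosB y s) =
  \int[mu]_(y in Rpos) \int[mu]_(t in Rpos) (E y * (u t * cos (y * (t - s))))).
  move=> ->; apply: eq_Rintegral => t _.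
  rewrite -(mcos0_poisson _ e0) /mcos -RintegralZl//; last exact: integrable_mcos.
  by apply: eq_Rintegral => y _; rewrite /E expr0 mul1r (mulrC (t - s)); ring.
apply: eq_Rintegral => y _; rewrite /fcosB -(@RintegralZl _ _ R mu Rpos _ _ mRp)//.
Qed.

(** The weight [E] supplies the integrability in [y] that Fubini needs. Fubini is used twice: to
    bring the [y]-integral inside the [s]-integral, then inside the [t]-integral hidden in [fcosB],
    where it produces the Poisson kernel. *)
Lemma regularised_le :
  (\int[mu]_(y in Rpos) (E y * (fcos y ^+ 2 + fsin y ^+ 2))%:E <=
   (pi * \int[mu]_(t in Rpos) (u t ^+ 2))%:E)%E.
Proof.
have JK y s : `|fcosB y s| <= K by exact: J_le.
have [Ei EF] := @Fubini_bounded_kernel _ _ _ _ R mu mu Rpos Rpos mRp mRp E u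
  fcosB K E_int ui mJ mJy mJs JK.
have uJ_int y : mu.-integrable Rpos (EFin \o (fun s => u s * fcosB y s)).
  exact: (@integrable_EFinM_bounded _ _ R mu Rpos mRp K u _ ui (mJy y) (fun s _ => JK y
      s)).
have -> : (\int[mu]_(y in Rpos) (E y * (fcos y ^+ 2 + fsin y ^+ 2))%:E =
    \int[mu]_(y in Rpos) (\int[mu]_(s in Rpos) (E y * (u s * fcosB y s)))%:E)%E.
  apply: eq_integral => y _; congr EFin; rewrite fcos_fsin_sqrE.
  exact: esym (@RintegralZl _ _ R mu Rpos _ (E y) mRp (uJ_int y)).
apply: (@le_trans _ _ ((\int[mu]_(y in Rpos) \int[mu]_(s in Rpos) (E y * (u s * fcosB y
    s)))%:E)%E).
  by rewrite (@RintegralK _ _ R mu Rpos mRp _ Ei).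
rewrite lee_fin {}EF.
have -> : (\int[mu]_(s in Rpos) \int[mu]_(y in Rpos) (E y * (u s * fcosB y s))) =
    \int[mu]_(s in Rpos) (u s * V s).
  apply: eq_Rintegral => s _; rewrite -Rintegral_fcosB -RintegralZl//.
    by apply: eq_Rintegral => y _; ring.
  exact: (@integrable_EFinM_bounded _ _ R mu Rpos mRp K E _ E_int (mJs s) (fun y _ =>
      JK y s)).
apply: Rintegral_le_abse => //.
  apply: measurable_funM => //.
  apply: (@measurable_Rintegral_on _ _ _ _ _ mu Rpos Rpos mRp mRp (fun z : R * R => u
      z.2 * poisson e (z.2 - z.1))).
  by apply: measurable_funM; [exact: measurable_snd_on|exact: measurable_funTS].
apply: (@schur_test _ _ R mu Rpos mRp u (fun s t => poisson e (t - s)) pi e^-1 ui u2i).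
- exact: measurable_funTS mP2.
- by move=> s; exact: measurable_funTS (mP s).
- by move=> s t; exact: poisson_ge0.
- by move=> s t; rewrite -poissonN opprB.
- by move=> s t; apply: le_trans (ler_norm _) (P_le s t).
- by move=> s; exact: integral_poisson_le.
Qed.

End regularised.

(** For real [u] the modulus of the Fourier transform is even, so the half-line [y > 0] accounts for
    [pi] out of the usual [2 pi]. Fatou's lemma removes the regularisation along
    [e = 1 / (n + 1)]. *)
Lemma plancherel_le :
  (\int[mu]_(y in Rpos) (fcos y ^+ 2 + fsin y ^+ 2)%:E <=
   (pi * \int[mu]_(t in Rpos) (u t ^+ 2))%:E)%E.
Proof.
have mf : measurable_fun Rpos (fun y => fcos y ^+ 2 + fsin y ^+ 2).
  by apply: measurable_funD; apply: measurable_funX; [exact: measurable_fcos|exact: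
      measurable_fsin].
apply: (@fatou_le _ _ R mu Rpos
  (fun n y => expR (- (n.+1%:R^-1) * y) * (fcos y ^+ 2 + fsin y ^+ 2))) => //.
- by move=> n; apply: measurable_funM => //; exact: measurable_funTS (measurable_expRM _).
- by move=> n y _; rewrite mulr_ge0 ?expR_ge0// addr_ge0 ?sqr_ge0.
- by move=> y _; rewrite addr_ge0 ?sqr_ge0.
- apply: aeW => y _; rewrite -[X in _ --> X]mul1r; apply: cvgM; last exact: cvg_cst.
  have h : - (n.+1%:R^-1) * y @[n --> \oo] --> (0 : R).
    rewrite -[X in _ --> X](mul0r y); apply: cvgM; last exact: cvg_cst.
    by rewrite -[X in _ --> X]oppr0; apply: cvgN; exact: cvg_harmonic.
  by rewrite -[X in _ --> X]expR0; exact: (cvg_comp _ _ h (@continuous_expR R 0)).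
- by move=> n; apply: regularised_le; rewrite invr_gt0.
Qed.

End plancherel.

(** * Complex-valued integrals *)

Section complex_parts.
Variable R : realType.
Implicit Types z : R[i].
Notation Re := (@complex.Re R).
Notation Im := (@complex.Im R).
Notation normc := (@Normc.normc R).

Lemma eq_complexP z1 z2 : Re z1 = Re z2 -> Im z1 = Im z2 -> z1 = z2.
Proof. by case: z1 z2 => [a b] [c d] /= -> ->. Qed.

Lemma cReM z1 z2 : Re (z1 * z2) = Re z1 * Re z2 - Im z1 * Im z2.
Proof. by case: z1 z2 => [a b] [c d]. Qed.

Lemma cImM z1 z2 : Im (z1 * z2) = Re z1 * Im z2 + Im z1 * Re z2.
Proof. by case: z1 z2 => [a b] [c d]. Qed.

Lemma cReD z1 z2 : Re (z1 + z2) = Re z1 + Re z2.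
Proof. by case: z1 z2 => [a b] [c d]. Qed.

Lemma cImD z1 z2 : Im (z1 + z2) = Im z1 + Im z2.
Proof. by case: z1 z2 => [a b] [c d]. Qed.

Lemma cReN z : Re (- z) = - Re z. Proof. by case: z. Qed.
Lemma cImN z : Im (- z) = - Im z. Proof. by case: z. Qed.
Lemma cReJ z : Re (conjc z) = Re z. Proof. by case: z. Qed.
Lemma cImJ z : Im (conjc z) = - Im z. Proof. by case: z. Qed.

Lemma normc_sqr z : normc z ^+ 2 = Re z ^+ 2 + Im z ^+ 2.
Proof. by case: z => a b /=; rewrite sqr_sqrtr// addr_ge0 ?sqr_ge0. Qed.

Lemma normc_ge0 z : 0 <= normc z.
Proof. by case: z => a b /=; exact: sqrtr_ge0. Qed.

Lemma normr_Re_le z : `|Re z| <= normc z.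
Proof.
rewrite -(ler_pXn2r (n := 2)) ?nnegrE ?normc_ge0//.
by rewrite real_normK ?num_real// normc_sqr lerDl sqr_ge0.
Qed.

Lemma normr_Im_le z : `|Im z| <= normc z.
Proof.
rewrite -(ler_pXn2r (n := 2)) ?nnegrE ?normc_ge0//.
by rewrite real_normK ?num_real// normc_sqr lerDr sqr_ge0.
Qed.

Lemma normc_le_parts z : normc z <= `|Re z| + `|Im z|.
Proof.
rewrite -(ler_pXn2r (n := 2)) ?nnegrE ?normc_ge0 ?addr_ge0//.
rewrite normc_sqr sqrrD !real_normK ?num_real//.
by rewrite -addrA lerD2l lerDr mulrn_wge0// mulr_ge0.
Qed.

Lemma Re_cexp z : Re (cexp z) = expR (Re z) * cos (Im z).
Proof. by rewrite /cexp cReM /=; ring. Qed.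

Lemma Im_cexp z : Im (cexp z) = expR (Re z) * sin (Im z).
Proof. by rewrite /cexp cImM /=; ring. Qed.

Lemma cexpD z1 z2 : cexp (z1 + z2) = cexp z1 * cexp z2.
Proof.
apply: eq_complexP.
  by rewrite cReM !Re_cexp !Im_cexp cReD cImD expRD cosD; ring.
by rewrite cImM !Re_cexp !Im_cexp cReD cImD expRD sinD; ring.
Qed.

Lemma cexpJ z : cexp (conjc z) = conjc (cexp z).
Proof.
apply: eq_complexP; rewrite !(cReJ, cImJ, Re_cexp, Im_cexp) ?cosN// sinN.
by rewrite mulrN.
Qed.

Lemma normc_cexp z : normc (cexp z) = expR (Re z).
Proof.
apply/eqP; rewrite -(eqrXn2 (n := 2)) ?normc_ge0 ?expR_ge0//.
by rewrite normc_sqr Re_cexp Im_cexp !exprMn -mulrDr cos2Dsin2 mulr1.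
Qed.

Lemma cexp0 : cexp 0 = 1 :> R[i].
Proof. by apply: eq_complexP; rewrite ?Re_cexp ?Im_cexp /= ?expR0 ?cos0 ?sin0 ?mulr1
    ?mulr0. Qed.
End complex_parts.

Section complex_integral.
Variable R : realType.
Notation mu := (@lebesgue_measure R).
Notation Rpos := (`]0%R, +oo[%classic : set R).
Notation Re := (@complex.Re R).
Notation Im := (@complex.Im R).
Notation normc := (@Normc.normc R).
Implicit Types f g : R -> R[i].

Let mRp : measurable (Rpos : set (measurableTypeR R)). Proof. exact: measurable_itv. Qed.

Definition cintegrable f : Prop :=
  mu.-integrable Rpos (EFin \o (fun t => Re (f t))) /\
  mu.-integrable Rpos (EFin \o (fun t => Im (f t))).

Lemma cintegrableD f g : cintegrable f -> cintegrable g ->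
  cintegrable (fun t => f t + g t).
Proof.
move=> [f1 f2] [g1 g2]; split.
  by apply: eq_integrable (integrable_EFinD mRp f1 g1) => // t _ /=; rewrite cReD.
by apply: eq_integrable (integrable_EFinD mRp f2 g2) => // t _ /=; rewrite cImD.
Qed.

Lemma cintegrableZ c f : cintegrable f -> cintegrable (fun t => c * f t).
Proof.
move=> [f1 f2]; split.
  apply: eq_integrable (integrable_EFinB mRp (integrable_EFinZl mRp (Re c) f1)
    (integrable_EFinZl mRp (Im c) f2)) => // t _ /=; by rewrite cReM.
apply: eq_integrable (integrable_EFinD mRp (integrable_EFinZl mRp (Re c) f2)
  (integrable_EFinZl mRp (Im c) f1)) => // t _ /=; by rewrite cImM.
Qed.

Lemma cintegralD f g : cintegrable f -> cintegrable g ->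
  cintegral Rpos (fun t => f t + g t) = cintegral Rpos f + cintegral Rpos g.
Proof.
move=> [f1 f2] [g1 g2]; apply: eq_complexP; rewrite ?cReD ?cImD /= -RintegralD//;
  by apply: eq_Rintegral => t _; rewrite ?cReD ?cImD.
Qed.

Lemma cintegralZ c f : cintegrable f ->
  cintegral Rpos (fun t => c * f t) = c * cintegral Rpos f.
Proof.
move=> [f1 f2]; apply: eq_complexP; rewrite ?cReM ?cImM /= -!RintegralZl//.
  rewrite -RintegralB//; try exact: integrable_EFinZl.
  by apply: eq_Rintegral => t _; rewrite cReM.
rewrite -RintegralD//; try exact: integrable_EFinZl.
by apply: eq_Rintegral => t _; rewrite cImM.
Qed.

Lemma cintegralJ f : cintegrable f ->
  cintegral Rpos (fun t => conjc (f t)) = conjc (cintegral Rpos f).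
Proof.
move=> [f1 f2]; apply: eq_complexP; rewrite ?cReJ ?cImJ /=.
  by apply: eq_Rintegral => t _; rewrite cReJ.
rewrite -mulN1r -RintegralZl//; apply: eq_Rintegral => t _.
by rewrite cImJ mulN1r.
Qed.

Lemma eq_cintegral f g : (forall t, Rpos t -> f t = g t) ->
  cintegral Rpos f = cintegral Rpos g.
Proof.
by move=> fg; rewrite /cintegral; congr (_ +i* _); apply: eq_Rintegral => t /set_mem/fg
    ->.
Qed.

(** The factor 2 comes from estimating the two parts separately; the intended use is a remainder
    estimate, where only the order matters. *)
Lemma normc_cintegral_le f (h : R -> R) : cintegrable f ->
  mu.-integrable Rpos (EFin \o h) -> (forall t, Rpos t -> normc (f t) <= h t) ->
  normc (cintegral Rpos f) <= 2 * \int[mu]_(t in Rpos) h t.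
Proof.
move=> [f1 f2] hi fh; apply: le_trans (normc_le_parts _) _; rewrite /= mulr2n mulrDl
    mul1r.
apply: lerD.
  apply: (le_trans (@le_normr_Rintegral _ _ R mu Rpos _ mRp f1)).
  apply: le_Rintegral => //; first exact: integrable_norm.
  by move=> t Dt; exact: le_trans (normr_Re_le _) (fh t Dt).
apply: (le_trans (@le_normr_Rintegral _ _ R mu Rpos _ mRp f2)).
apply: le_Rintegral => //; first exact: integrable_norm.
by move=> t Dt; exact: le_trans (normr_Im_le _) (fh t Dt).
Qed.
End complex_integral.

(** * The Laplace transform on Lb2 *)

Section laplace_Lb2.
Variables (R : realType) (l : nat).
Notation mu := (@lebesgue_measure R).
Notation Rpos := (`]0%R, +oo[%classic : set R).
Notation Re := (@complex.Re R).
Notation Im := (@complex.Im R).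
Notation normc := (@Normc.normc R).
Implicit Types (f g : R -> R[i]) (u : R -> R).

Let mRp : measurable (Rpos : set (measurableTypeR R)). Proof. exact: measurable_itv. Qed.

(** The weight of [Lb2] up to the constant [l! / 2^l]. *)
Definition weight (t : R) : R := (t ^+ l.+1)^-1.
Notation L2 := (wsqint mu Rpos weight).
Notation dot := (wdot mu Rpos weight).

Lemma weight_gt0 t : Rpos t -> 0 < weight t.
Proof. by rewrite /= in_itv/= andbT => t0; rewrite invr_gt0 exprn_gt0. Qed.

Lemma measurable_weight : measurable_fun Rpos weight.
Proof.
apply: open_continuous_measurable_fun; first exact: interval_open.
move=> t; rewrite inE/= in_itv/= andbT => t0.
by apply: cvgV; [rewrite gt_eqF// exprn_gt0|exact: exprn_continuous].
Qed.

Lemma weightK t : Rpos t -> t ^+ l.+1 * weight t = 1.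
Proof. by rewrite /= in_itv/= andbT => t0; rewrite mulfV// gt_eqF// exprn_gt0. Qed.

(** From [|u| b <= u^2 w + b^2 / w] with [w] the weight and [b = t^n e^{-xt}]: the second term is
    [t^(2n+l+1) e^{-2xt}]. The powers [n = 0, 1, 2] correspond to the transform, its derivative and
    its Taylor remainder. *)
Lemma L2_integrable u n (x : R) (h : R -> R) : L2 u -> 0 < x ->
  measurable_fun setT h -> (forall t, `|h t| <= 1) ->
  mu.-integrable Rpos (EFin \o (fun t => u t * (t ^+ n * (expR (- x * t) * h t)))).
Proof.
move=> uL x0 mh h1; have x2 : 0 < x + x by rewrite addr_gt0.
have gi := integrable_EFinD mRp uL.2 (integrable_exprn_expR (n + n + l.+1) x2).
apply: le_integrable_EFin gi => //.
  apply: measurable_funM; first exact: uL.1.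
  apply: measurable_funTS; under eq_fun do rewrite mulrA.
  by apply: measurable_funM => //; exact: measurable_exprn_expR.
move=> t Dt; have t0 : 0 < t by move: Dt; rewrite /= in_itv/= andbT.
have W0 : 0 < t ^+ l.+1 by rewrite exprn_gt0.
have b0 : 0 <= t ^+ n * expR (- x * t) by rewrite mulr_ge0 ?expR_ge0 ?exprn_ge0// ltW.
rewrite normrM mulrA normrM (ger0_norm b0).
apply: (@le_trans _ _ (`|u t| * (t ^+ n * expR (- x * t)))).
  by rewrite ler_wpM2l// ler_piMr.
rewrite (_ : t ^+ (n + n + l.+1) * _ = (t ^+ n * expR (- x * t)) ^+ 2 * t ^+ l.+1);
    last first.
  by rewrite opprD mulrDl expRD !exprD; ring.
rewrite /weight -(real_normK (num_real (u t))).
move: (t ^+ l.+1) (`|u t|) (normr_ge0 (u t)) (_ * expR _) W0 b0 => W a a0 b W0 b0.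
rewrite -subr_ge0 (_ : _ - _ = ((a - b * W) ^+ 2 + a * b * W) / W).
  by rewrite divr_ge0 ?(ltW W0)// addr_ge0 ?sqr_ge0// mulr_ge0 ?(ltW W0)// mulr_ge0.
by field; rewrite gt_eqF.
Qed.

Let cl : R := l`!%:R / 2 ^+ l.

Let sqnormE f t : Rpos t ->
  normc (f t) ^+ 2 * (Gamma (1 + l%:R) / (2 ^+ l * t ^+ (1 + l))) =
  cl * (Re (f t) ^+ 2 * weight t + Im (f t) ^+ 2 * weight t).
Proof.
rewrite /= in_itv/= andbT => t0.
rewrite normc_sqr Gamma_nat /cl /weight add1n; field.
by rewrite !expf_neq0 ?gt_eqF.
Qed.

Let cl0 : 0 < cl. Proof. by rewrite divr_gt0 ?exprn_gt0// ltr0n fact_gt0. Qed.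

Lemma Lb2_sqnormE f : L2 (fun t => Re (f t)) -> L2 (fun t => Im (f t)) ->
  Lb2_sqnorm l f = (l`!%:R / 2 ^+ l * (dot (fun t => Re (f t)) (fun t => Re (f t)) +
     dot (fun t => Im (f t)) (fun t => Im (f t))))%:E.
Proof.
move=> f1 f2; rewrite /Lb2_sqnorm.
transitivity (\int[mu]_(t in Rpos)
    (cl * (Re (f t) ^+ 2 * weight t + Im (f t) ^+ 2 * weight t))%:E)%E.
  by apply: eq_integral => t /set_mem Dt; rewrite sqnormE.
rewrite EFinM EFinD !sqint_sqnormE// -integralD//; [|exact: f1.2|exact: f2.2].
by rewrite -integralZl//; apply: integrableD => //; [exact: f1.2|exact: f2.2].
Qed.

Lemma Lb2P f : Lb2 l f <-> L2 (fun t => Re (f t)) /\ L2 (fun t => Im (f t)).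
Proof.
split=> [[[m1 m2] foo]|[f1 f2]]; last first.
  by split; [split; [exact: f1.1|exact: f2.1]|rewrite Lb2_sqnormE// ltry].
have mw := measurable_weight.
have m12 : measurable_fun Rpos (fun t => Re (f t) ^+ 2 * weight t + Im (f t) ^+ 2 *
    weight t).
  by apply: measurable_funD; apply: measurable_funM => //; exact: measurable_funX.
have ge0 t : Rpos t -> 0 <= Re (f t) ^+ 2 * weight t /\ 0 <= Im (f t) ^+ 2 * weight t.
  by move=> /weight_gt0/ltW w0; split; rewrite mulr_ge0 ?sqr_ge0.
have i12 : mu.-integrable Rpos (EFin \o (fun t => Re (f t) ^+ 2 * weight t + Im (f t)
    ^+ 2 * weight t)).
  have : mu.-integrable Rpos (EFin \o (fun t => cl * (Re (f t) ^+ 2 * weight t + Im (f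
      t) ^+ 2 * weight t))).
    apply: ge0_integrable_EFin => //.
    - by apply: measurable_funM.
    - by move=> t /ge0[? ?]; rewrite mulr_ge0 ?addr_ge0// ltW.
    - apply: le_lt_trans foo; rewrite le_eqVlt; apply/orP; left; apply/eqP.
      by apply: eq_integral => t /set_mem Dt; rewrite sqnormE.
  move=> /(integrable_EFinZl mRp cl^-1); apply: eq_integrable => // t _ /=.
  by rewrite mulrA mulVf ?mul1r// gt_eqF.
split; split=> //; apply: le_integrable_EFin i12 => //.
- by apply: measurable_funM => //; exact: measurable_funX.
- by move=> t /ge0[a b]; rewrite ger0_norm// lerDl.
- by apply: measurable_funM => //; exact: measurable_funX.
- by move=> t /ge0[a b]; rewrite ger0_norm// lerDr.
Qed.

Lemma Re_cexpN (z : R[i]) (t : R) :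
  Re (cexp (- (z * t%:C))) = expR (- Re z * t) * cos (Im z * t).
Proof. by rewrite Re_cexp cReN cImN cReM cImM /= !mulr0 subr0 add0r cosN mulNr. Qed.

Lemma Im_cexpN (z : R[i]) (t : R) :
  Im (cexp (- (z * t%:C))) = - (expR (- Re z * t) * sin (Im z * t)).
Proof. by rewrite Im_cexp cReN cImN cReM cImM /= !mulr0 subr0 add0r sinN mulNr mulrN. Qed.

Lemma Lb2_cintegrable f (z : R[i]) n : Lb2 l f -> Cplus z ->
  cintegrable (fun t => (t ^+ n)%:C * (f t * cexp (- (z * t%:C)))).
Proof.
move=> /Lb2P[f1 f2] z0.
have C u : L2 u -> mu.-integrable Rpos
    (EFin \o (fun t => u t * (t ^+ n * (expR (- Re z * t) * cos (Im z * t))))).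
  move=> uL; apply: L2_integrable => // [|t]; last exact: cos_max.
  by apply: continuous_measurable_fun; exact: continuous_cosM.
have S u : L2 u -> mu.-integrable Rpos
    (EFin \o (fun t => u t * (t ^+ n * (expR (- Re z * t) * sin (Im z * t))))).
  move=> uL; apply: L2_integrable => // [|t]; last exact: sin_max.
  by apply: continuous_measurable_fun; exact: continuous_sinM.
split.
  apply: eq_integrable (integrable_EFinD mRp (C _ f1) (S _ f2)) => // t _.
  rewrite /comp; congr EFin; have := Re_cexpN z t; have := Im_cexpN z t.
  by move: (cexp _) => E EI ER; rewrite !cReM !cImM ER EI /=; ring.
apply: eq_integrable (integrable_EFinB mRp (C _ f2) (S _ f1)) => // t _.
rewrite /comp; congr EFin; have := Re_cexpN z t; have := Im_cexpN z t.
by move: (cexp _) => E EI ER; rewrite !cImM !cReM ER EI /=; ring.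
Qed.

Lemma Lb2_cintegrable0 f (z : R[i]) : Lb2 l f -> Cplus z ->
  cintegrable (fun t => f t * cexp (- (z * t%:C))).
Proof.
move=> fL z0; have := Lb2_cintegrable 0 fL z0; congr cintegrable.
by apply/funext => t; rewrite expr0 mul1r.
Qed.

(** For real [u], the Laplace transform at [x + iy] is [lcos u x y - i lsin u x y]. *)
Definition lcos u (x y : R) := \int[mu]_(t in Rpos) (u t * (expR (- x * t) * cos (y *
    t))).
Definition lsin u (x y : R) := \int[mu]_(t in Rpos) (u t * (expR (- x * t) * sin (y *
    t))).

Lemma lcos_integrable u (x y : R) : L2 u -> 0 < x ->
  mu.-integrable Rpos (EFin \o (fun t => u t * (expR (- x * t) * cos (y * t)))).
Proof.
move=> uL x0; have := L2_integrable 0 uL x0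
  (continuous_measurable_fun (@continuous_cosM R y)) (fun t => cos_max (y * t)).
by apply: eq_integrable => // t _ /=; rewrite mul1r.
Qed.

Lemma lsin_integrable u (x y : R) : L2 u -> 0 < x ->
  mu.-integrable Rpos (EFin \o (fun t => u t * (expR (- x * t) * sin (y * t)))).
Proof.
move=> uL x0; have := L2_integrable 0 uL x0
  (continuous_measurable_fun (@continuous_sinM R y)) (fun t => sin_max (y * t)).
by apply: eq_integrable => // t _ /=; rewrite mul1r.
Qed.

Lemma laplaceE f (z : R[i]) : Lb2 l f -> Cplus z ->
  laplace f z =
  (lcos (fun t => Re (f t)) (Re z) (Im z) + lsin (fun t => Im (f t)) (Re z) (Im z)) +i*
  (lcos (fun t => Im (f t)) (Re z) (Im z) - lsin (fun t => Re (f t)) (Re z) (Im z)).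
Proof.
move=> /Lb2P[f1 f2] z0; rewrite /laplace /cintegral /lcos /lsin; congr (_ +i* _).
  rewrite -RintegralD//; [|exact: lcos_integrable|exact: lsin_integrable].
  by apply: eq_Rintegral => t _; rewrite cReM Re_cexpN Im_cexpN; ring.
rewrite -RintegralB//; [|exact: lcos_integrable|exact: lsin_integrable].
by apply: eq_Rintegral => t _; rewrite cImM Re_cexpN Im_cexpN; ring.
Qed.

Lemma Lb2D c d f g : Lb2 l f -> Lb2 l g -> Lb2 l (fun t => c * f t + d * g t).
Proof.
move=> /Lb2P[f1 f2] /Lb2P[g1 g2]; apply/Lb2P.
have mw := measurable_weight; have w0 := weight_gt0.
have ZB (a b : R) u v : L2 u -> L2 v -> L2 (fun t => a * u t - b * v t).
  by move=> uL vL; apply: sqintB => //; exact: sqintZ.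
have ZD (a b : R) u v : L2 u -> L2 v -> L2 (fun t => a * u t + b * v t).
  by move=> uL vL; apply: sqintD => //; exact: sqintZ.
split.
  have := sqintD mRp mw w0 (ZB (Re c) (Im c) _ _ f1 f2) (ZB (Re d) (Im d) _ _ g1 g2).
  by congr (wsqint _ _ _ _); apply/funext => t; rewrite cReD !cReM.
have := sqintD mRp mw w0 (ZD (Re c) (Im c) _ _ f2 f1) (ZD (Re d) (Im d) _ _ g2 g1).
by congr (wsqint _ _ _ _); apply/funext => t; rewrite cImD !cImM.
Qed.

Lemma laplaceD c d f g (z : R[i]) : Lb2 l f -> Lb2 l g -> Cplus z ->
  laplace (fun t => c * f t + d * g t) z = c * laplace f z + d * laplace g z.
Proof.
move=> fL gL z0; have fi := Lb2_cintegrable0 fL z0; have gi := Lb2_cintegrable0 gL z0.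
rewrite /laplace -!cintegralZ// -cintegralD//; try exact: cintegrableZ.
by apply: eq_cintegral => t _; rewrite mulrDl !mulrA.
Qed.

(** Positive real [z] suffice: the exponential is then real, so the transforms of the real and
    imaginary parts of [f - g] vanish separately. *)
Lemma laplace_inj f g : Lb2 l f -> Lb2 l g ->
  (forall z, Cplus z -> laplace f z = laplace g z) -> eq_Rpos f g.
Proof.
move=> fL gL fg; pose h t := 1 * f t + (-1) * g t.
have hL : Lb2 l h by exact: Lb2D.
have h0 x : 0 < x -> laplace h (x +i* 0) = 0.
  by move=> x0; rewrite laplaceD// fg// mulN1r mul1r subrr.
have [h1 h2] := (Lb2P h).1 hL.
have E u x : lcos u x 0 = \int[mu]_(t in Rpos) (u t * expR (- x * t)).
  by apply: eq_Rintegral => t _; rewrite mul0r cos0 mulr1.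
have S u x : lsin u x 0 = 0.
  rewrite /lsin (@eq_Rintegral _ _ R mu Rpos (fun=> 0)); last first.
    by move=> t _; rewrite mul0r sin0 !mulr0.
  by rewrite Rintegral_cst// mul0r.
have iE u x : L2 u -> 0 < x -> mu.-integrable Rpos (EFin \o (fun t => u t * expR (- x *
    t))).
  move=> uL x0; apply: eq_integrable (lcos_integrable 0 uL x0) => // t _ /=.
  by rewrite mul0r cos0 mulr1.
have z1 : {ae mu, forall t, Rpos t -> Re (h t) = 0}.
  apply: laplace_eq0 => x x0; first exact: (iE (fun t => Re (h t))).
  have := h0 _ x0; rewrite laplaceE//= => /(congr1 Re) /=.
  by rewrite S addr0 E.
have z2 : {ae mu, forall t, Rpos t -> Im (h t) = 0}.
  apply: laplace_eq0 => x x0; first exact: (iE (fun t => Im (h t))).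
  have := h0 _ x0; rewrite laplaceE//= => /(congr1 Im) /=.
  by rewrite S subr0 E.
apply: (@filterS2 _ _ (ae_filter_ringOfSetsType mu) _ _ _ _ z1 z2) => t a1 a2 Dt; have
    h00 : h t = 0.
  by apply: eq_complexP; rewrite /= ?a1 ?a2.
by apply/eqP; rewrite -subr_eq0 -h00 /h mul1r mulN1r.
Qed.

Lemma eq_Rpos_laplace f g (z : R[i]) : Lb2 l f -> Lb2 l g -> Cplus z ->
  eq_Rpos f g -> laplace f z = laplace g z.
Proof.
move=> fL gL z0 fg; have [f1 f2] := Lb2_cintegrable0 fL z0.
have [g1 g2] := Lb2_cintegrable0 gL z0.
rewrite /laplace /cintegral; congr (_ +i* _); congr fine;
  apply: ae_eq_integral => //; try exact: measurable_int f1;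
  try exact: measurable_int f2; try exact: measurable_int g1;
  try exact: measurable_int g2.
  by apply: (@filterS _ _ (ae_filter_ringOfSetsType mu) _ _ _ fg) => t fgt Dt /=;
      rewrite fgt.
by apply: (@filterS _ _ (ae_filter_ringOfSetsType mu) _ _ _ fg) => t fgt Dt /=; rewrite
    fgt.
Qed.

Lemma eq_Rpos_sqnorm f g : Lb2 l f -> Lb2 l g -> eq_Rpos f g ->
  Lb2_sqnorm l f = Lb2_sqnorm l g.
Proof.
have mF h : Lb2 l h -> measurable_fun Rpos (fun t =>
    (normc (h t) ^+ 2 * (Gamma (1 + l%:R) / (2 ^+ l * t ^+ (1 + l))))%:E).
  move=> /Lb2P[h1 h2]; apply/measurable_EFinP.
  apply: (eq_measurable_fun (fun t => cl * (Re (h t) ^+ 2 * weight t + Im (h t) ^+ 2 *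
      weight t))).
    by move=> t /set_mem Dt; rewrite sqnormE.
  have mw := measurable_weight.
  apply: measurable_funM => //; apply: measurable_funD; apply: measurable_funM => //;
    apply: measurable_funX; [exact: h1.1|exact: h2.1].
move=> fL gL fg; apply: ae_eq_integral => //; try exact: mF.
by apply: (@filterS _ _ (ae_filter_ringOfSetsType mu) _ _ _ fg) => t fgt Dt /=; rewrite
    fgt.
Qed.

End laplace_Lb2.

(** * The Laplace transform maps into the Bergman space *)

Section bergman_norm.
Variables (R : realType) (l : nat).
Notation mu := (@lebesgue_measure R).
Notation Rpos := (`]0%R, +oo[%classic : set R).
Notation Re := (@complex.Re R).
Notation Im := (@complex.Im R).
Notation normc := (@Normc.normc R).
Notation L2 := (wsqint mu Rpos (weight l)).

Let mRp : measurable (Rpos : set (measurableTypeR R)). Proof. exact: measurable_itv. Qed.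

Section real_function.
Variable u : R -> R.
Hypothesis uL : L2 u.

Let mX : measurable ([set: measurableTypeR R] `*` (Rpos : set (measurableTypeR R))).
Proof. exact: measurableX. Qed.

Let m22 : measurable_fun setT (fun p : (R * R) * R => - p.1.2 * p.2).
Proof.
apply: measurable_funM => //; apply: measurableT_comp => //.
exact: measurableT_comp measurable_snd measurable_fst.
Qed.

Let m12 : measurable_fun setT (fun p : (R * R) * R => p.1.1 * p.2).
Proof.
apply: measurable_funM => //.
exact: measurableT_comp measurable_fst measurable_fst.
Qed.

Lemma measurable_lcos : measurable_fun ([set: R] `*` Rpos) (fun z : R * R => lcos u z.2
    z.1).
Proof.
apply: (@measurable_Rintegral_on _ _ _ _ R mu ([set: R] `*` Rpos) Rpos mX mRp
  (fun p : (R * R) * R => u p.2 * (expR (- p.1.2 * p.2) * cos (p.1.1 * p.2)))).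
apply: measurable_funM; first exact: measurable_snd_on uL.1.
apply: measurable_funTS; apply: measurable_funM.
  exact: measurableT_comp m22.
apply: (@measurableT_comp _ _ _ _ _ _ (@cos R)) m12.
exact: continuous_measurable_fun (@continuous_cos R).
Qed.

Lemma measurable_lsin : measurable_fun ([set: R] `*` Rpos) (fun z : R * R => lsin u z.2
    z.1).
Proof.
apply: (@measurable_Rintegral_on _ _ _ _ R mu ([set: R] `*` Rpos) Rpos mX mRp
  (fun p : (R * R) * R => u p.2 * (expR (- p.1.2 * p.2) * sin (p.1.1 * p.2)))).
apply: measurable_funM; first exact: measurable_snd_on uL.1.
apply: measurable_funTS; apply: measurable_funM.
  exact: measurableT_comp m22.
apply: (@measurableT_comp _ _ _ _ _ _ (@sin R)) m12.
exact: continuous_measurable_fun (@continuous_sin R).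
Qed.

Let Q (z : R * R) := z.2 ^+ l * (lcos u z.2 z.1 ^+ 2 + lsin u z.2 z.1 ^+ 2).

Let mQ : measurable_fun ([set: R] `*` Rpos) Q.
Proof.
apply: measurable_funM.
  by apply: measurable_funTS; apply: measurable_funX.
by apply: measurable_funD; apply: measurable_funX; [exact: measurable_lcos|exact:
    measurable_lsin].
Qed.

Let Q0 y x : Rpos x -> 0 <= Q (y, x).
Proof.
rewrite /= in_itv/= andbT => x0.
by rewrite /Q/= mulr_ge0 ?exprn_ge0 ?(ltW x0)// addr_ge0 ?sqr_ge0.
Qed.

Lemma lsinN (x y : R) : 0 < x -> lsin u x (- y) = - lsin u x y.
Proof.
move=> x0; rewrite -[RHS]mulN1r /lsin -RintegralZl//; last exact: (lsin_integrable y uL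
    x0).
by apply: eq_Rintegral => t _; rewrite (mulNr y) sinN; ring.
Qed.

Lemma lcosN (x y : R) : lcos u x (- y) = lcos u x y.
Proof. by apply: eq_Rintegral => t _; rewrite (mulNr y) cosN. Qed.

Lemma lcos_lsin_half :
  (\int[mu]_(y in Rpos) \int[mu]_(x in Rpos) (Q (y, x))%:E < +oo)%E.
Proof.
rewrite (@tonelli_on _ _ _ _ _ mu mu Rpos Rpos mRp mRp (EFin \o Q)); last 2 first.
- apply/measurable_EFinP; apply: measurable_funS mQ => //.
  by move=> z [? ?]; split.
- by move=> y x _ Dx; rewrite lee_fin Q0.
pose G (z : R * R) := (z.1 ^+ l * (u z.2 ^+ 2 * expR (- (z.1 + z.1) * z.2)))%:E.
have mG : measurable_fun (Rpos `*` Rpos) G.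
  apply/measurable_EFinP; apply: measurable_funM.
    by apply: measurable_funTS; apply: measurable_funX.
  apply: measurable_funM.
    have mu2 : measurable_fun Rpos (fun t => u t ^+ 2) by apply: measurable_funX;
        exact: uL.1.
    exact: measurable_snd_on mu2.
  have m : measurable_fun setT (fun z : R * R => - (z.1 + z.1) * z.2).
    apply: measurable_funM; last exact: measurable_snd.
    apply: measurableT_comp => //.
    exact: measurable_funD measurable_fst measurable_fst.
  by apply: measurable_funTS; exact: measurableT_comp m.
have G0 (x t : R) : Rpos x -> Rpos t -> (0 <= G (x, t))%E.
  rewrite /= !in_itv/= !andbT => x0 t0.
  by rewrite lee_fin mulr_ge0 ?exprn_ge0 ?(ltW x0)// mulr_ge0 ?sqr_ge0 ?expR_ge0.
apply: (@le_lt_trans _ _ (pi%:E * \int[mu]_(x in Rpos) \int[mu]_(t in Rpos) G (x, t))%E).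
  rewrite -ge0_integralZl//; last 3 first.
  - exact: (@measurable_integral_on _ _ _ _ _ mu Rpos Rpos mRp mRp _ mG G0).
  - by move=> x Dx; apply: integral_ge0 => t Dt; exact: G0.
  - by rewrite lee_fin pi_ge0.
  apply: ge0_le_integral => //.
  - by move=> x Dx; apply: integral_ge0 => y _; rewrite lee_fin Q0.
  - apply: (@measurable_integral_on _ _ _ _ _ mu Rpos Rpos mRp mRp (fun z => (Q (z.2,
      z.1))%:E)).
      apply/measurable_EFinP.
      apply: (@measurable_comp _ _ _ _ _ _ ([set: R] `*` Rpos) Q (Rpos `*` Rpos) (fun z
          : R * R => (z.2, z.1))) => //.
        by move=> _ [z [? ?] <-].
      apply: measurable_funTS.
      by apply/measurable_fun_pairP; split; [exact: measurable_snd|exact: measurable_fst].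
    by move=> x y Dx _; rewrite lee_fin Q0.
  - apply: emeasurable_funM => //.
    exact: (@measurable_integral_on _ _ _ _ _ mu Rpos Rpos mRp mRp _ mG G0).
  move=> x Dx; have x0 : 0 < x by move: Dx; rewrite /= in_itv/= andbT.
  pose v t := u t * expR (- x * t).
  have vi : mu.-integrable Rpos (EFin \o v).
    apply: eq_integrable (lcos_integrable 0 uL x0) => // t _ /=.
    by rewrite mul0r cos0 mulr1.
  have v2i : mu.-integrable Rpos (EFin \o (fun t => v t ^+ 2)).
    have mv := integrable_EFin_measurable vi.
    (* Since [t^(l+1) <= K e^{2xt}], the function [v^2] is at most [K] times [u^2] against the
       weight. *)
    have [K K0 HK] := exprn_le_expR l.+1 (addr_gt0 x0 x0).
    apply: le_integrable_EFin (integrable_EFinZl mRp K uL.2) => //.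
      exact: measurable_funX.
    move=> t Dt; have t0 : 0 < t by move: Dt; rewrite /= in_itv/= andbT.
    rewrite ger0_norm ?sqr_ge0// /v exprMn [leRHS]mulrCA ler_wpM2l ?sqr_ge0//.
    rewrite -expRM_natl /weight ler_pdivlMr ?exprn_gt0//.
    apply: le_trans (ler_wpM2l (expR_ge0 _) (HK _ (ltW t0))) _.
    rewrite mulrCA -expRD (_ : _ + _ = 0) ?expR0 ?mulr1//.
    by rewrite mulr2n; ring.
  have := plancherel_le vi v2i.
  have -> : fcos v = lcos u x.
    by apply/funext => y; apply: eq_Rintegral => t _; rewrite /v mulrA.
  have -> : fsin v = lsin u x.
    by apply/funext => y; apply: eq_Rintegral => t _; rewrite /v mulrA.
  move=> H.
  have mLx : measurable_fun Rpos (fun y => lcos u x y ^+ 2 + lsin u x y ^+ 2).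
    have -> : lcos u x = fcos v.
      by apply/funext => y; apply: eq_Rintegral => t _; rewrite /v mulrA.
    have -> : lsin u x = fsin v.
      by apply/funext => y; apply: eq_Rintegral => t _; rewrite /v mulrA.
    by apply: measurable_funD; apply: measurable_funX; [exact: measurable_fcos|exact:
        measurable_fsin].
  rewrite (_ : (\int[mu]_(y in Rpos) (EFin \o Q) (y, x))%E = ((x ^+ l)%:E *
      \int[mu]_(y in Rpos) (lcos u x y ^+ 2 + lsin u x y ^+ 2)%:E)%E); last first.
    rewrite -ge0_integralZl//; last 3 first.
    - exact/measurable_EFinP.
    - by move=> y _; rewrite lee_fin addr_ge0 ?sqr_ge0.
    - by rewrite lee_fin exprn_ge0// ltW.
  have xl0 : (0 <= (x ^+ l)%:E)%E by rewrite lee_fin exprn_ge0// ltW.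
  apply: (le_trans (lee_wpmul2l xl0 H)).
  rewrite EFinM muleCA; apply: lee_wpmul2l; first by rewrite lee_fin pi_ge0.
  rewrite RintegralK// -ge0_integralZl//; last 2 first.
  - by apply/measurable_EFinP; exact: integrable_EFin_measurable v2i.
  - by move=> t _; rewrite lee_fin sqr_ge0.
  rewrite le_eqVlt; apply/orP; left; apply/eqP; apply: eq_integral => t _.
  rewrite -EFinM /G /v /= exprMn -expRM_natl; congr (_ * (_ * expR _))%:E.
  by rewrite mulr2n; ring.
apply: lte_mul_pinfty; [by rewrite lee_fin pi_ge0|by []|].
rewrite (@tonelli_on _ _ _ _ _ mu mu Rpos Rpos mRp mRp G mG G0).
apply: (@le_lt_trans _ _ (\int[mu]_(t in Rpos) (l`!%:R / 2 ^+ l.+1 * (u t ^+ 2 * weight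
    l t))%:E)%E); last first.
  by apply: integrable_lty => //; exact: integrable_EFinZl uL.2.
rewrite le_eqVlt; apply/orP; left; apply/eqP; apply: eq_integral.
move=> t /set_mem Dt; have t0 : 0 < t by move: Dt; rewrite /= in_itv/= andbT.
have tt0 : 0 < t + t by rewrite addr_gt0.
transitivity (\int[mu]_(x in Rpos) ((u t ^+ 2)%:E * (x ^+ l * expR (- (t + t) *
    x))%:E))%E.
  apply: eq_integral => x _; rewrite -EFinM /G/=; congr EFin; rewrite mulrCA.
  by congr (_ * (_ * expR _)); ring.
have Ei := integrable_exprn_expR l tt0.
rewrite integralZl//.
rewrite -(@RintegralK _ _ R mu Rpos mRp _ Ei).
rewrite -mcosE0 mcos0// -EFinM; congr EFin.
rewrite /weight (_ : t + t = 2 * t) ?exprMn; last by ring.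
field.
by rewrite !expf_neq0 // gt_eqF.
Qed.

(** [lcos] is even and [lsin] odd in [y], so the two half-lines contribute equally. *)
Lemma lcos_lsin_integral_lty :
  (\int[mu]_y \int[mu]_(x in Rpos) (Q (y, x))%:E < +oo)%E.
Proof.
pose H y := (\int[mu]_(x in Rpos) (Q (y, x))%:E)%E.
have mH : measurable_fun setT H.
  apply: (@measurable_integral_on _ _ _ _ _ mu setT Rpos measurableT mRp (EFin \o Q)).
    exact/measurable_EFinP.
  by move=> y x _ Dx; rewrite lee_fin Q0.
have H0 y : (0 <= H y)%E by apply: integral_ge0 => x Dx; rewrite lee_fin Q0.
have HN y : H (- y)%R = H y.
  apply: eq_integral => x; rewrite inE/= in_itv/= andbT => x0.
  by rewrite /Q/= lcosN lsinN// sqrrN.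
have mneg : measurable (`]-oo, 0] : set (measurableTypeR R)) by exact: measurable_itv.
have Hpos : (\int[mu]_(y in `[0%R, +oo[) H y < +oo)%E.
  rewrite -integral_itv_obnd_cbnd; last exact: measurable_funTS mH.
  exact: lcos_lsin_half.
have Hsplit : (\int[mu]_y H y <=
    \int[mu]_(y in `]-oo, 0%R]) H y + \int[mu]_(y in `[0%R, +oo[) H y)%E.
  have -> : (\int[mu]_y H y = \int[mu]_(y in `]-oo, 0%R] `|` `]0%R, +oo[) H y)%E.
    congr (integral _ _ _); apply/seteqP; split=> // y _ /=.
    by rewrite !in_itv/= andbT; case: (leP y 0); [left|right].
  rewrite ge0_integral_setU//.
  - apply: leeD2l; rewrite integral_itv_obnd_cbnd//.
    exact: measurable_funTS mH.
  - exact: measurable_funTS mH.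
  - rewrite disj_set2E; apply/eqP/seteqP; split=> // y [] /=.
    by rewrite !in_itv/= andbT => y0; rewrite ltNge y0.
apply: (le_lt_trans Hsplit).
have -> : (\int[mu]_(y in `]-oo, 0%R]) H y = \int[mu]_(y in `[0%R, +oo[) H y)%E.
  rewrite (@ge0_integration_by_substitution0 _ H mH H0).
  by apply: eq_integral => y _; rewrite HN.
exact: lte_add_pinfty.
Qed.

End real_function.

Lemma bergman_sqnorm_laplace_lty (f : R -> R[i]) : Lb2 l f ->
  (bergman_sqnorm l (laplace f) < +oo)%E.
Proof.
move=> fL; have [f1L f2L] := (Lb2P l f).1 fL.
set f1 := (fun t => Re (f t)) in f1L; set f2 := (fun t => Im (f t)) in f2L.
rewrite /bergman_sqnorm; apply: lte_mul_pinfty.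
- by rewrite lee_fin invr_ge0 pi_ge0.
- by [].
pose Q u (z : R * R) := z.2 ^+ l * (lcos u z.2 z.1 ^+ 2 + lsin u z.2 z.1 ^+ 2).
have mQ u : L2 u -> measurable_fun ([set: R] `*` Rpos) (fun z => (Q u z)%:E).
  move=> uL; apply/measurable_EFinP; apply: measurable_funM.
    by apply: measurable_funTS; apply: measurable_funX.
  by apply: measurable_funD; apply: measurable_funX; [exact: measurable_lcos|exact:
      measurable_lsin].
have Q0 u (y x : R) : [set: R] y -> Rpos x -> (0 <= (Q u (y, x))%:E)%E.
  move=> _; rewrite /= in_itv/= andbT => x0.
  by rewrite lee_fin /Q/= mulr_ge0 ?exprn_ge0 ?(ltW x0)// addr_ge0 ?sqr_ge0.
pose Iq u y := (\int[mu]_(x in Rpos) (Q u (y, x))%:E)%E.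
have mI u : L2 u -> measurable_fun setT (Iq u).
  move=> uL; exact: (@measurable_integral_on _ _ _ _ _ mu setT Rpos measurableT mRp _
      (mQ u uL) (Q0 u)).
have I0 u y : (0 <= Iq u y)%E by apply: integral_ge0 => x; exact: Q0.
have Ilty u : L2 u -> (\int[mu]_y Iq u y < +oo)%E by exact: lcos_lsin_integral_lty.
pose N (z : R * R) := z.2 ^+ l * ((lcos f1 z.2 z.1 + lsin f2 z.2 z.1) ^+ 2 +
   (lcos f2 z.2 z.1 - lsin f1 z.2 z.1) ^+ 2).
have mN : measurable_fun ([set: R] `*` Rpos) (fun z => (N z)%:E).
  apply/measurable_EFinP; apply: measurable_funM.
    by apply: measurable_funTS; apply: measurable_funX.
  apply: measurable_funD; apply: measurable_funX.
    by apply: measurable_funD; [exact: measurable_lcos|exact: measurable_lsin].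
  by apply: measurable_funB; [exact: measurable_lcos|exact: measurable_lsin].
have N0 (y x : R) : [set: R] y -> Rpos x -> (0 <= (N (y, x))%:E)%E.
  move=> _; rewrite /= in_itv/= andbT => x0.
  by rewrite lee_fin /N/= mulr_ge0 ?exprn_ge0 ?(ltW x0)// addr_ge0 ?sqr_ge0.
have -> : (\int[mu]_y \int[mu]_(x in Rpos) (x ^+ l * normc (laplace f (x +i* y)) ^+
    2)%:E =
    \int[mu]_y \int[mu]_(x in Rpos) (N (y, x))%:E)%E.
  apply: eq_integral => y _; apply: eq_integral => x /set_mem Dx.
  have x0 : Cplus (x +i* y) by move: Dx; rewrite /= in_itv/= andbT.
  by rewrite normc_sqr (laplaceE fL x0).
(* The transform of [f1 + i f2] is split by [|A + B|^2 <= 2 (|A|^2 + |B|^2)], which is enough for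
   finiteness. *)
apply: (@le_lt_trans _ _ (\int[mu]_y (2%:E * (Iq f1 y + Iq f2 y)))%E).
  apply: ge0_le_integral => //.
  - by move=> y _; apply: integral_ge0 => x; exact: N0.
  - exact: (@measurable_integral_on _ _ _ _ _ mu setT Rpos measurableT mRp _ mN N0).
  - by apply: emeasurable_funM => //; apply: emeasurable_funD; exact: mI.
  move=> y _.
  have mQy u : L2 u -> measurable_fun Rpos (fun x => (Q u (y, x))%:E).
    move=> uL; apply: (measurable_comp (F := [set: R] `*` Rpos) (g := fun x => (y, x))
        _ _ (mQ u uL)).
    - exact: measurableX.
    - by move=> _ [x Dx <-].
    - exact: measurable_funTS (pair1_measurable y).
  rewrite -(ge0_integralD mu mRp (fun x Dx => Q0 f1 y x I Dx) (mQy _ f1L)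
    (fun x Dx => Q0 f2 y x I Dx) (mQy _ f2L)).
  rewrite -ge0_integralZl//; last 2 first.
  - by apply: emeasurable_funD; exact: mQy.
  - by move=> x Dx; apply: adde_ge0; exact: Q0.
  apply: ge0_le_integral => //.
  - by move=> x; exact: N0.
  - apply: (measurable_comp (F := [set: R] `*` Rpos) (g := fun x => (y, x)) _ _ mN).
    + exact: measurableX.
    + by move=> _ [x Dx <-].
    + exact: measurable_funTS (pair1_measurable y).
  - by apply: emeasurable_funM => //; apply: emeasurable_funD; exact: mQy.
  move=> x; rewrite /= in_itv/= andbT => x0.
  rewrite -EFinD -EFinM lee_fin /N /Q /= -mulrDr mulrCA ler_wpM2l ?exprn_ge0 ?(ltW x0)//.
  move: (lcos f1 x y) (lsin f1 x y) (lcos f2 x y) (lsin f2 x y) => a b c d.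
  have := sqr_ge0 (a - d); have := sqr_ge0 (c + b); rewrite !expr2; lra.
rewrite ge0_integralZl//; last 2 first.
- by apply: emeasurable_funD; exact: mI.
- by move=> y _; exact: adde_ge0.
rewrite ge0_integralD//; [|exact: mI|exact: mI].
apply: lte_mul_pinfty => //.
by apply: lte_add_pinfty; exact: Ilty.
Qed.

End bergman_norm.

(** * Second-order Taylor estimate for the complex exponential *)

Section taylor.
Variable R : realType.
Implicit Types a b : R.

Lemma derive_bounded_le (f df : R -> R) b (M : R) :
  (forall x : R, is_derive x 1 f (df x)) -> (forall c, `|c| <= `|b| -> `|df c| <= M) ->
  `|f b - f 0| <= M * `|b|.
Proof.
move=> fd dfM.
have cf : continuous f.
  by move=> t; apply: differentiable_continuous; apply/derivable1_diffP; exact: ex_derive.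
have [b0|b0] := leP 0 b.
  have [c] := @MVT_segment R f df 0 b b0 (fun x _ => fd x) (continuous_subspaceT cf).
  rewrite in_itv/= => /andP[c0 cb] ->; rewrite subr0 normrM ler_wpM2r// dfM//.
  by rewrite !ger0_norm.
have [c] := @MVT_segment R f df b 0 (ltW b0) (fun x _ => fd x) (continuous_subspaceT cf).
rewrite in_itv/= => /andP[c0 cb] E; rewrite distrC E sub0r normrM normrN ler_wpM2r//
    dfM//.
by rewrite !ler0_norm ?(ltW b0)// lerN2.
Qed.

Lemma normr_sin_le b : `|sin b| <= `|b|.
Proof.
have := @derive_bounded_le sin cos b 1 (@is_derive_sin R) (fun c _ => cos_max c).
by rewrite sin0 subr0 mul1r.
Qed.

Lemma normr_cosB1_le b : `|cos b - 1| <= b ^+ 2.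
Proof.
have := @derive_bounded_le cos (fun x => - sin x) b `|b| (@is_derive_cos R).
rewrite cos0 -expr2 real_normK ?num_real//; apply=> c cb.
by rewrite normrN; exact: le_trans (normr_sin_le c) cb.
Qed.

Lemma normr_sinB_le b : `|sin b - b| <= b ^+ 2.
Proof.
have cos1 (c : R) : `|cos c - 1| <= `|c|.
  have := @derive_bounded_le cos (fun x => - sin x) c 1 (@is_derive_cos R).
  by rewrite cos0 mul1r; apply=> x _; rewrite normrN; exact: sin_max.
have d (x : R) : is_derive x 1 (fun x => sin x - x) (cos x - 1).
  by have := is_deriveB (is_derive_sin x) (is_derive_id x (1 : R)).
have := @derive_bounded_le _ _ b `|b| d.
rewrite sin0 !subr0 -expr2 real_normK ?num_real//; apply=> c cb.
exact: le_trans (cos1 c) cb.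
Qed.

Lemma expRB1_le a : expR a - 1 <= a * expR a.
Proof.
have := expR_ge1Dx (- a); rewrite expRN -(ler_pM2r (expR_gt0 a)) mulVf ?gt_eqF
    ?expR_gt0//.
by rewrite mulrDl mul1r mulNr; lra.
Qed.

Lemma normr_expRB1_le a : `|expR a - 1| <= `|a| * expR `|a|.
Proof.
have h1 := expR_ge1Dx a; have h2 := expRB1_le a.
have e1 : 1 <= expR `|a| by rewrite -[leLHS]expR0 ler_expR.
have ea : expR a <= expR `|a| by rewrite ler_expR ler_norm.
have a0 := normr_ge0 a; have := ler_norm a; have := ler_norm (- a); rewrite normrN =>
    l1 l2.
rewrite ler_norml; apply/andP; split; first by nra.
have [p|n] := leP 0 a; first by have := expR_gt0 a; nra.
by have := expR_gt0 a; nra.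
Qed.

Lemma normr_expRB1x_le a : `|expR a - 1 - a| <= a ^+ 2 * expR `|a|.
Proof.
have h1 := expR_ge1Dx a; have h2 := expRB1_le a.
rewrite ger0_norm; last lra.
apply: (@le_trans _ _ (a * (expR a - 1))); first lra.
apply: le_trans (ler_norm _) _; rewrite normrM -real_normK ?num_real// expr2 -mulrA.
by rewrite ler_wpM2l// normr_expRB1_le.
Qed.

(** The constant 4 counts two error terms in the real part and two in the imaginary part, each at
    most [r^2 e^r] with [r] the modulus of [w]. *)
Lemma cexp_taylor (w : R[i]) :
  Normc.normc (cexp w - 1 - w) <= 4 * (Normc.normc w ^+ 2 * expR (Normc.normc w)).
Proof.
have aw := normr_Re_le w; have bw := normr_Im_le w.
have r0 := normc_ge0 w; apply: le_trans (normc_le_parts _) _.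
rewrite !(cReD, cImD, cReN, cImN) Re_cexp Im_cexp /=.
move: (complex.Re w) (complex.Im w) (Normc.normc w) aw bw r0 => a b r aw bw r0.
have E1 : 1 <= expR r by rewrite -[leLHS]expR0 ler_expR.
have Ea : expR `|a| <= expR r by rewrite ler_expR.
have Eaa : expR a <= expR r by rewrite ler_expR (le_trans (ler_norm _)).
have a2 : a ^+ 2 <= r ^+ 2 by rewrite -[leLHS]real_normK ?num_real// lerXn2r ?nnegrE.
have b2 : b ^+ 2 <= r ^+ 2 by rewrite -[leLHS]real_normK ?num_real// lerXn2r ?nnegrE.
have r20 : 0 <= r ^+ 2 by exact: sqr_ge0.
have h1 : `|expR a * cos b - 1 - a| <= 2 * (r ^+ 2 * expR r).
  rewrite (_ : _ - a = (expR a - 1 - a) + expR a * (cos b - 1)); last by ring.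
  rewrite [leRHS]mulrDl mul1r; apply: le_trans (ler_normD _ _) _; apply: lerD.
    apply: le_trans (normr_expRB1x_le a) _.
    by apply: ler_pM => //; rewrite ?sqr_ge0 ?expR_ge0.
  rewrite normrM (ger0_norm (expR_ge0 _)) mulrC.
  apply: ler_pM => //; rewrite ?expR_ge0//.
  exact: le_trans (normr_cosB1_le b) b2.
have h2 : `|expR a * sin b - 0 - b| <= 2 * (r ^+ 2 * expR r).
  rewrite (_ : _ - b = (expR a - 1) * sin b + (sin b - b)); last by ring.
  rewrite [leRHS]mulrDl mul1r; apply: le_trans (ler_normD _ _) _; apply: lerD.
    rewrite normrM; apply: (@le_trans _ _ ((r * expR r) * r)); last by rewrite expr2; lra.
    apply: ler_pM => //.
      by apply: le_trans (normr_expRB1_le a) _; apply: ler_pM => //; rewrite ?expR_ge0.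
    exact: le_trans (normr_sin_le b) bw.
  apply: le_trans (normr_sinB_le b) _; apply: le_trans b2 _.
  by rewrite ler_peMr.
move: h1 h2; rewrite oppr0 addr0; lra.
Qed.
End taylor.

(** * Analyticity of the Laplace transform *)

Section analytic.
Variables (R : realType) (l : nat).
Notation mu := (@lebesgue_measure R).
Notation Rpos := (`]0%R, +oo[%classic : set R).
Notation Re := (@complex.Re R).
Notation Im := (@complex.Im R).
Notation normc := (@Normc.normc R).

Let mRp : measurable (Rpos : set (measurableTypeR R)). Proof. exact: measurable_itv. Qed.

Definition laplace_derivative (f : R -> R[i]) (z : R[i]) : R[i] :=
  cintegral Rpos (fun t => - (t%:C * (f t * cexp (- (z * t%:C))))).

Lemma laplace_taylor (f : R -> R[i]) (z : R[i]) : Lb2 l f -> Cplus z ->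
  exists2 M, 0 <= M & forall h, normc h <= Re z / 2 -> Cplus (z + h) ->
  normc (laplace f (z + h) - laplace f z - h * laplace_derivative f z) <= M * normc h
      ^+ 2.
Proof.
move=> fL z0; have [f1 f2] := (Lb2P l f).1 fL.
have x0 : 0 < Re z by exact: z0.
have x2 : 0 < Re z / 2 by rewrite divr_gt0.
(* The dominating function: 4 and [t ^+ 2] come from [cexp_taylor] at [- h t], and since
   [|h| <= Re z / 2], the growth [e^{|h|t}] consumes at most half of the decay [e^{- Re z t}]. *)
pose g t := 4 * (`|Re (f t) * (t ^+ 2 * (expR (- (Re z / 2) * t) * 1))| +
                 `|Im (f t) * (t ^+ 2 * (expR (- (Re z / 2) * t) * 1))|).
have gi : mu.-integrable Rpos (EFin \o g).
  have n1 (t : R) : `|(fun _ : R => 1 : R) t| <= 1 by rewrite normr1.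
  have m1 : measurable_fun setT (fun _ : R => 1 : R) by exact: measurable_cst.
  have i1 := L2_integrable 2 f1 x2 m1 n1.
  have i2 := L2_integrable 2 f2 x2 m1 n1.
  apply: (@integrable_EFinZl _ _ R mu Rpos mRp 4); apply: (@integrable_EFinD _ _ R mu
      Rpos mRp).
    exact: integrable_norm i1.
  exact: integrable_norm i2.
have g0 t : 0 <= g t by rewrite mulr_ge0// addr_ge0.
exists (2 * \int[mu]_(t in Rpos) g t); first by rewrite mulr_ge0// Rintegral_ge0.
move=> h hz zh0; pose q t := (f t * cexp (- ((z + h) * t%:C))) +
  ((-1) * (f t * cexp (- (z * t%:C))) + h * (t%:C * (f t * cexp (- (z * t%:C))))).
have i1 := Lb2_cintegrable0 fL zh0; have i2 := Lb2_cintegrable0 fL z0.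
have i3 : cintegrable (fun t => t%:C * (f t * cexp (- (z * t%:C)))).
  exact: Lb2_cintegrable 1 fL z0.
have i2' := cintegrableZ (-1) i2; have i3' := cintegrableZ h i3.
have i23 := cintegrableD i2' i3'.
rewrite (_ : _ - _ = cintegral Rpos q); last first.
  rewrite /q (cintegralD i1 i23) (cintegralD i2' i3') (cintegralZ _ i2) (cintegralZ _ i3).
  rewrite -/(laplace f (z + h)) -/(laplace f z) /laplace_derivative.
  rewrite (_ : cintegral Rpos (fun t => - _) =
      -1 * cintegral Rpos (fun t => t%:C * (f t * cexp (- (z * t%:C))))); first by ring.
  by rewrite -(cintegralZ _ i3); apply: eq_cintegral => t _; rewrite mulN1r.
have i123 : cintegrable q by exact: cintegrableD.
have hgi := integrable_EFinZl mRp (normc h ^+ 2) gi.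
apply: le_trans (normc_cintegral_le i123 hgi _) _; last first.
  by rewrite RintegralZl//; lra.
move=> t; rewrite /= in_itv/= andbT => t0.
have -> : q t = (f t * cexp (- (z * t%:C))) * (cexp (- (h * t%:C)) - 1 - - (h * t%:C)).
  by rewrite /q mulrDl opprD cexpD; ring.
rewrite (Normc.normcM (f t * _)) (Normc.normcM (f t)).
have T := cexp_taylor (- (h * t%:C)).
have nht : normc (- (h * t%:C)) = normc h * t.
  have -> : normc (- (h * t%:C)) = normc (h * t%:C) by case: (h * _) => a b /=; rewrite
      !sqrrN.
  by rewrite Normc.normcM /= expr0n addr0 sqrtr_sqr ger0_norm// ltW.
rewrite nht in T.
have nn : 0 <= normc (f t) * normc (cexp (- (z * t%:C))) by rewrite mulr_ge0 ?normc_ge0.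
apply: (le_trans (ler_wpM2l nn T)).
rewrite normc_cexp cReN cReM /= mulr0 subr0.
have E : expR (- (Re z * t)) * expR (normc h * t) <= expR (- (Re z / 2) * t).
  rewrite -expRD ler_expR.
  have := ler_wpM2r (ltW t0) hz; lra.
have F := normc_le_parts (f t).
have te0 : 0 <= t ^+ 2 * expR (- (Re z / 2) * t) by rewrite mulr_ge0 ?expR_ge0 ?sqr_ge0.
rewrite /g !mulr1 (normrM (Re _)) (normrM (Im _)) (ger0_norm te0).
apply: (@le_trans _ _ (normc h ^+ 2 * (4 * (normc (f t) * (t ^+ 2 * (expR (- (Re z *
    t)) * expR (normc h * t))))))).
  by rewrite exprMn le_eqVlt; apply/orP; left; apply/eqP; ring.
rewrite -mulrDl ler_wpM2l ?sqr_ge0// ler_wpM2l//.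
apply: ler_pM => //; first exact: normc_ge0.
  by rewrite mulr_ge0 ?sqr_ge0// mulr_ge0 ?expR_ge0.
by rewrite ler_wpM2l ?sqr_ge0.
Qed.

Lemma analytic_laplace (f : R -> R[i]) : Lb2 l f -> analytic_Cplus (laplace f).
Proof.
move=> fL z z0; have x0 : 0 < Re z by exact: z0.
have [M M0 HM] := laplace_taylor fL z0.
apply: (cvgP (laplace_derivative f z : R[i]^o)); apply/cvgrPdist_le => e e0.
(* Norms on [R[i]] take values in [R[i]], so the radius [e] is a positive complex number, that is, a
   positive real one. *)
have [er er0 eE] : exists2 er : R, 0 < er & e = er%:C.
  by move: e0; case: e => a b; rewrite ltcE /= => /andP[/eqP-> a0]; exists a.
(* [M] may be 0, and the radius below divides by this bound. *)
have M1 : 0 < M + 1 by rewrite ltr_wpDl.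
near=> h.
have h0 : h != 0 by near: h; exact: nbhs_dnbhs_neq.
have hx : normc h < Re z / 2.
  rewrite -ltcR; near: h; apply: dnbhs0_lt; rewrite ltcR; by rewrite divr_gt0.
have he : normc h < er / (M + 1).
  rewrite -ltcR; near: h; apply: dnbhs0_lt; rewrite ltcR; by rewrite divr_gt0.
have zh0 : Cplus (z + h).
  rewrite /Cplus /= cReD; have := normr_Re_le h; rewrite ler_norml => /andP[+ _].
  by lra.
have H := HM h (ltW hx) zh0.
have nh0 : 0 < normc h.
  by rewrite lt_def normc_ge0 andbT; apply: contra h0 => /eqP/Normc.eq0_normc ->.
rewrite (_ : _ - _ = - (h^-1 * (laplace f (z + h) - laplace f z - h *
    laplace_derivative f z))); last first.
  rewrite /GRing.scale /= mulr1 (addrC h z) [in RHS]mulrBr mulKf//.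
  by rewrite opprB.
rewrite normrN eE -[leLHS]/((normc _)%:C) lecR Normc.normcM Normc.normcV.
rewrite ler_pdivrMl//; apply: (le_trans H); rewrite expr2 mulrCA ler_wpM2l ?(ltW nh0)//.
have : normc h * (M + 1) < er by rewrite -ltr_pdivlMr.
by rewrite mulrDr mulr1 mulrC; have := normc_ge0 h; lra.
Unshelve. all: by end_near. Qed.
End analytic.

(** * Conjugations transported by the Laplace transform *)

Section conjugations.
Variables (R : realType) (l : nat).
Notation mu := (@lebesgue_measure R).
Notation Rpos := (`]0%R, +oo[%classic : set R).
Notation Re := (@complex.Re R).
Notation normc := (@Normc.normc R).
Implicit Types (f g : R -> R[i]) (F G : R[i] -> R[i]) (z : R[i]).

Let mRp : measurable (Rpos : set (measurableTypeR R)). Proof. exact: measurable_itv. Qed.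

Lemma Cplus_near z : Cplus z -> \forall w \near (z : R[i]^o), Cplus w.
Proof.
move=> z0; have x0 : 0 < Re z by exact: z0.
have e0 : 0 < (Re z)%:C by rewrite ltcR.
near=> w; rewrite /Cplus /=.
have : normc (z - w) < Re z.
  rewrite -ltcR; near: w.
  exact: (@cvgr_dist_lt _ R[i]^o _ (nbhs (z : R[i]^o)) _ id z cvg_id _ e0).
move=> H; have := normr_Re_le (z - w); rewrite cReD cReN ler_norml => /andP[_].
by lra.
Unshelve. all: by end_near. Qed.

Lemma bergman_ext F G : (forall z, Cplus z -> F z = G z) -> bergman l F -> bergman l G.
Proof.
move=> FG [aF nF]; split.
  move=> z z0; apply: near_eq_derivable (aF z z0).
  by near=> w; apply: FG; near: w; exact: Cplus_near.
apply: le_lt_trans nF; rewrite le_eqVlt; apply/orP; left; apply/eqP.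
rewrite /bergman_sqnorm; congr (_ * _)%E; apply: eq_integral => y _.
apply: eq_integral => x; rewrite inE /= in_itv /= andbT => x0.
by rewrite FG.
Unshelve. all: by end_near. Qed.

Lemma bergman_laplace f : Lb2 l f -> bergman l (laplace f).
Proof. by move=> fL; split; [exact: analytic_laplace fL|exact:
    bergman_sqnorm_laplace_lty]. Qed.

(** A single preimage [g] decides everything: it puts [F] in [bergman], which excludes the junk
    value, and injectivity identifies the chosen representative with [g] almost everywhere. *)
Lemma laplace_invP F g : Lb2 l g -> (forall z, Cplus z -> laplace g z = F z) ->
  [/\ Lb2 l (laplace_inv l F), (forall z, Cplus z -> laplace (laplace_inv l F) z = F z) &
      eq_Rpos (laplace_inv l F) g].
Proof.
move=> gL gF.
have [_ hL hF] : [/\ bergman l F, Lb2 l (laplace_inv l F) &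
    forall z, Cplus z -> laplace (laplace_inv l F) z = F z].
  rewrite /laplace_inv; case: xgetP => [h -> //|/(_ g)[]].
  by split=> //; apply: bergman_ext (bergman_laplace gL).
split=> //; apply: laplace_inj hL gL _ => z z0.
by rewrite hF// gF.
Qed.

Lemma eq_Rpos_sym f g : eq_Rpos f g -> eq_Rpos g f.
Proof. by apply: (@filterS _ _ (ae_filter_ringOfSetsType mu)) => t fg /fg. Qed.

Lemma eq_Rpos_trans f g h : eq_Rpos f g -> eq_Rpos g h -> eq_Rpos f h.
Proof.
by apply: (@filterS2 _ _ (ae_filter_ringOfSetsType mu)) => t fg gh Dt; rewrite fg ?gh.
Qed.

Section transported_conjugation.
Variable C : (R[i] -> R[i]) -> R[i] -> R[i].
Hypothesis C_local : forall F G, (forall z, Cplus z -> F z = G z) ->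
  forall z, Cplus z -> C F z = C G z.
Hypothesis C_antilinear : forall c d F G z, Cplus z ->
  C (fun w => c * F w + d * G w) z = conjc c * C F z + conjc d * C G z.
Hypothesis C_involutive : forall F z, Cplus z -> C (C F) z = F z.
(** The analytic content of a given conjugation is confined to this hypothesis; the three preceding
    ones are algebraic. It carries the norm equality because the isometry clause is read in
    [Lb2]. *)
Hypothesis C_lift : forall f, Lb2 l f -> exists g, [/\ Lb2 l g,
  Lb2_sqnorm l g = Lb2_sqnorm l f & forall z, Cplus z -> laplace g z = C (laplace f) z].

Notation T := (laplace_inv l \o C \o @laplace R).

Lemma transported_spec f : Lb2 l f ->
  [/\ Lb2 l (T f), (forall z, Cplus z -> laplace (T f) z = C (laplace f) z) &
      Lb2_sqnorm l (T f) = Lb2_sqnorm l f].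
Proof.
move=> fL; have [g [gL gn gC]] := C_lift fL.
have [TL TC Tg] := laplace_invP gL gC.
by split=> //; rewrite -gn; exact: eq_Rpos_sqnorm.
Qed.

Lemma transportedE f g : Lb2 l g -> (forall z, Cplus z -> laplace g z = C (laplace f)
    z) ->
  eq_Rpos (T f) g.
Proof. by move=> gL gC; have [_ _] := laplace_invP gL gC. Qed.

Lemma is_conjugation_transported : is_conjugation_Lb2 l T.
Proof.
split.
- by move=> f /transported_spec[].
- move=> f g fL gL fg; have [TgL TgC _] := transported_spec gL.
  apply: transportedE => // z z0; rewrite TgC//; apply: C_local => // w w0.
  exact: (eq_Rpos_laplace gL fL w0 (eq_Rpos_sym fg)).
- move=> c d f g fL gL; have [TfL TfC _] := transported_spec fL.
  have [TgL TgC _] := transported_spec gL.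
  apply: transportedE; first exact: Lb2D.
  move=> z z0; rewrite (laplaceD _ _ TfL TgL z0) TfC// TgC// -C_antilinear//.
  by apply: C_local => // w w0; rewrite (laplaceD _ _ fL gL w0).
- by move=> f /transported_spec[].
- move=> f fL; have [TfL TfC _] := transported_spec fL.
  apply: transportedE => // z z0; rewrite -[LHS]C_involutive//.
  by apply: C_local => // w w0; rewrite TfC.
Qed.
End transported_conjugation.

End conjugations.

(** * The right half-plane *)

Section complex_plane.
Variable R : realType.
Implicit Types z w : R[i].
Notation Re := (@complex.Re R).
Notation Im := (@complex.Im R).

Lemma Cplus_neq0 z : Cplus z -> z != 0.
Proof. by case: z => x y x0; rewrite eq_complex /= negb_and gt_eqF. Qed.

Lemma CplusJ z : Cplus z -> Cplus (conjc z).
Proof. by rewrite /Cplus /= cReJ. Qed.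

Lemma CplusV z : Cplus z -> Cplus z^-1.
Proof.
case: z => x y; rewrite /Cplus /= => x0.
by rewrite divr_gt0// ltr_wpDr ?sqr_ge0// exprn_gt0.
Qed.

Lemma CplusD z w : Cplus z -> Cplus w -> Cplus (z + w).
Proof. by rewrite /Cplus /= cReD; exact: addr_gt0. Qed.

Lemma CplusDi z (a : R) : Cplus z -> Cplus (z + a *i).
Proof. by case: z => x y; rewrite /Cplus /= addr0. Qed.

(** On both sides the bases multiply out to [z w + 1]. With [n = l + 2] this is the exchange of
    kernel transforms under [calC_star]. *)
Lemma invf_addfV (z w : R[i]) n : z != 0 -> w != 0 ->
  (z ^+ n)^-1 * ((w + z^-1) ^+ n)^-1 = (w ^+ n)^-1 * ((w^-1 + z) ^+ n)^-1.
Proof.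
move=> z0 w0; rewrite -!invfM -!exprMn; congr ((_ ^+ _)^-1).
by rewrite !mulrDr !mulfV// addrC (mulrC w).
Qed.

Lemma conjcX z n : conjc (z ^+ n) = conjc z ^+ n. Proof. exact: rmorphXn. Qed.
Lemma conjcV z : conjc z^-1 = (conjc z)^-1. Proof. exact: fmorphV. Qed.
Lemma conjcM z w : conjc (z * w) = conjc z * conjc w. Proof. exact: rmorphM. Qed.
Lemma conjcN z : conjc (- z) = - conjc z. Proof. exact: rmorphN. Qed.
Lemma conjcD z w : conjc (z + w) = conjc z + conjc w. Proof. exact: rmorphD. Qed.
Lemma conjc_real (x : R) : conjc x%:C = x%:C.
Proof. by rewrite /= oppr0. Qed.
End complex_plane.

(** * The conjugations calC *)

Section translation.
Variables (R : realType) (l : nat) (a : R).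
Notation mu := (@lebesgue_measure R).
Notation Rpos := (`]0%R, +oo[%classic : set R).
Notation Re := (@complex.Re R).
Notation Im := (@complex.Im R).
Notation normc := (@Normc.normc R).

Lemma calC_local (F G : R[i] -> R[i]) : (forall z, Cplus z -> F z = G z) ->
  forall z, Cplus z -> calC a F z = calC a G z.
Proof. by move=> FG z z0; rewrite /calC FG//; apply: CplusDi; exact: CplusJ. Qed.

Lemma calC_antilinear c d (F G : R[i] -> R[i]) z :
  calC a (fun w => c * F w + d * G w) z = conjc c * calC a F z + conjc d * calC a G z.
Proof. by rewrite /calC conjcD !conjcM. Qed.

Lemma calC_involutive (F : R[i] -> R[i]) z : calC a (calC a F) z = F z.
Proof.
rewrite /calC conjcK; congr F; case: z => x y.
by apply/eqP; rewrite eq_complex /= !addr0 opprD !opprK subrK !eqxx.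
Qed.

Definition modulated (f : R -> R[i]) (t : R) : R[i] :=
  conjc (f t * cexp (- ((a *i) * t%:C))).

Lemma normc_modulated f t : normc (modulated f t) = normc (f t).
Proof.
apply/eqP; rewrite -(eqrXn2 (n := 2)) ?normc_ge0//.
rewrite /modulated normc_sqr cReJ cImJ sqrrN -normc_sqr (Normc.normcM (f t)).
by rewrite normc_cexp cReN cReM /= !(mulr0, mul0r) subrr oppr0 expR0 mulr1.
Qed.

Lemma Lb2_sqnorm_modulated f : Lb2_sqnorm l (modulated f) = Lb2_sqnorm l f.
Proof. by apply: eq_integral => t _; rewrite normc_modulated. Qed.

Lemma Lb2_modulated f : Lb2 l f -> Lb2 l (modulated f).
Proof.
move=> [[m1 m2] foo]; split; last by rewrite Lb2_sqnorm_modulated.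
have mc : measurable_fun Rpos (fun t : R => cos (a * t)).
  by apply: measurable_funTS; exact: continuous_measurable_fun (@continuous_cosM R a).
have ms : measurable_fun Rpos (fun t : R => sin (a * t)).
  by apply: measurable_funTS; exact: continuous_measurable_fun (@continuous_sinM R a).
have E t : cexp (- ((a *i) * t%:C)) = cos (a * t) +i* (- sin (a * t)).
  by apply: eq_complexP; rewrite ?Re_cexpN ?Im_cexpN /= oppr0 mul0r expR0 mul1r.
split.
  rewrite (_ : (fun t => _) = fun t => Re (f t) * cos (a * t) + Im (f t) * sin (a * t)).
    by apply: measurable_funD; exact: measurable_funM.
  by apply/funext => t; rewrite /modulated E cReJ cReM /=; ring.
rewrite (_ : (fun t => _) = fun t => Re (f t) * sin (a * t) - Im (f t) * cos (a * t)).
  by apply: measurable_funB; exact: measurable_funM.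
by apply/funext => t; rewrite /modulated E cImJ cImM /=; ring.
Qed.

Lemma laplace_modulated f z : Lb2 l f -> Cplus z ->
  laplace (modulated f) z = calC a (laplace f) z.
Proof.
move=> fL z0; have z1 : Cplus (conjc z + a *i) by apply: CplusDi; exact: CplusJ.
rewrite /calC /laplace -cintegralJ; last exact: Lb2_cintegrable0 fL z1.
apply: eq_cintegral => t _; rewrite /modulated.
have -> : cexp (- (z * t%:C)) = conjc (cexp (- (conjc z * t%:C))).
  by rewrite -cexpJ conjcN conjcM conjcK conjc_real.
rewrite -conjcM; congr conjc; rewrite -mulrA -cexpD; congr (_ * cexp _); ring.
Qed.

Lemma calC_lift f : Lb2 l f -> exists g, [/\ Lb2 l g,
  Lb2_sqnorm l g = Lb2_sqnorm l f & forall z, Cplus z -> laplace g z = calC a (laplace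
      f) z].
Proof.
move=> fL; exists (modulated f); split; first exact: Lb2_modulated.
  exact: Lb2_sqnorm_modulated.
by move=> z; exact: laplace_modulated.
Qed.
End translation.

(** * Evaluation kernels in Lb2 *)

Section kernels.
Variables (R : realType) (l : nat).
Notation mu := (@lebesgue_measure R).
Notation Rpos := (`]0%R, +oo[%classic : set R).
Notation Re := (@complex.Re R).
Notation Im := (@complex.Im R).
Notation L2 := (wsqint mu Rpos (weight l)).
Notation dot := (wdot mu Rpos (weight l)).

Let mRp : measurable (Rpos : set (measurableTypeR R)). Proof. exact: measurable_itv. Qed.

Lemma L2_kernel (x : R) (h : R -> R) : 0 < x -> measurable_fun setT h ->
  (forall t, `|h t| <= 1) -> L2 (fun t => t ^+ l.+1 * (expR (- x * t) * h t)).
Proof.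
move=> x0 mh h1; have mk : measurable_fun Rpos (fun t => t ^+ l.+1 * (expR (- x * t) *
    h t)).
  apply: measurable_funTS; under eq_fun do rewrite mulrA.
  by apply: measurable_funM => //; exact: measurable_exprn_expR.
split=> //.
have i0 := integrable_exprn_expR l.+1 (addr_gt0 x0 x0).
apply: (@le_integrable_EFin _ _ R mu Rpos mRp _ _ _ _ i0).
  by apply: measurable_funM; [exact: measurable_funX|exact: measurable_weight].
move=> t Dt; have t0 : 0 < t by move: Dt; rewrite /= in_itv/= andbT.
have tl0 : 0 <= t ^+ l.+1 by rewrite exprn_ge0// ltW.
rewrite (_ : _ * weight l t = t ^+ l.+1 * (t ^+ l.+1 * weight l t) * (expR (- x * t) ^+
    2 * h t ^+ 2)).
  rewrite weightK// mulr1 -expRM_natl normrM ger0_norm// ler_wpM2l//.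
  rewrite normrM ger0_norm ?expR_ge0// (_ : - (x + x) * t = 2 * (- x * t)); last by ring.
  rewrite ler_piMr ?expR_ge0// normrX exprn_ile1//.
by rewrite !exprMn; ring.
Qed.

(** The factor [t^(l+1)] cancels the weight, so that pairing with [pcos z] and [psin z] evaluates
    the Laplace transform at [z]: up to a scalar these are the parts of the reproducing kernel. *)
Definition pcos (z : R[i]) (t : R) : R := t ^+ l.+1 * (expR (- Re z * t) * cos (Im z *
    t)).
Definition psin (z : R[i]) (t : R) : R := t ^+ l.+1 * (expR (- Re z * t) * sin (Im z *
    t)).

Lemma L2_pcos z : Cplus z -> L2 (pcos z).
Proof.
move=> z0; apply: L2_kernel => // [|t]; last exact: cos_max.
by apply: continuous_measurable_fun; exact: continuous_cosM.
Qed.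

Lemma L2_psin z : Cplus z -> L2 (psin z).
Proof.
move=> z0; apply: L2_kernel => // [|t]; last exact: sin_max.
by apply: continuous_measurable_fun; exact: continuous_sinM.
Qed.

Lemma dot_pcos u z : dot u (pcos z) = lcos u (Re z) (Im z).
Proof.
apply: eq_Rintegral => t /set_mem Dt.
by rewrite /pcos mulrA mulrAC -[_ * t ^+ _ * _]mulrA weightK// mulr1.
Qed.

Lemma dot_psin u z : dot u (psin z) = lsin u (Re z) (Im z).
Proof.
apply: eq_Rintegral => t /set_mem Dt.
by rewrite /psin mulrA mulrAC -[_ * t ^+ _ * _]mulrA weightK// mulr1.
Qed.

Definition ckernel (v : R[i]) (t : R) : R[i] := (t ^+ l.+1)%:C * cexp (- (v * t%:C)).

Lemma Re_ckernel v t : Re (ckernel v t) = pcos v t.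
Proof. by rewrite /ckernel cReM Re_cexpN /= mul0r subr0. Qed.

Lemma Im_ckernel v t : Im (ckernel v t) = - psin v t.
Proof. by rewrite /ckernel cImM Im_cexpN /= mul0r addr0 mulrN. Qed.

Lemma L2N u : L2 u -> L2 (fun t => - u t).
Proof.
move=> /(sqintZ mRp (-1)); congr (wsqint _ _ _ _).
by apply/funext => t; rewrite mulN1r.
Qed.

Lemma Lb2_ckernel v : Cplus v -> Lb2 l (ckernel v).
Proof.
move=> v0; apply/Lb2P; split.
  by rewrite (funext (Re_ckernel v)); exact: L2_pcos.
by rewrite (funext (Im_ckernel v)); apply: L2N; exact: L2_psin.
Qed.

Lemma Lb2Z c (f : R -> R[i]) : Lb2 l f -> Lb2 l (fun t => c * f t).
Proof.
move=> fL; have := Lb2D c 0 fL fL; congr (Lb2 l _).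
by apply/funext => t; rewrite mul0r addr0.
Qed.

Lemma laplaceZ c (f : R -> R[i]) (z : R[i]) : Lb2 l f -> Cplus z ->
  laplace (fun t => c * f t) z = c * laplace f z.
Proof.
move=> fL z0; have := laplaceD c 0 fL fL z0; rewrite mul0r addr0 => <-.
by apply: eq_cintegral => t _; rewrite mul0r addr0.
Qed.

Lemma laplace_ckernel v z : Cplus v -> Cplus z ->
  laplace (ckernel v) z = (l.+1)`!%:R / (z + v) ^+ l.+2.
Proof.
move=> v0 z0; rewrite -(moment_complex _ (CplusD z0 v0)) /laplace /cintegral /mcos /msin.
have E t : ckernel v t * cexp (- (z * t%:C)) = (t ^+ l.+1)%:C * cexp (- ((z + v) * t%:C)).
  by rewrite /ckernel -mulrA -cexpD; congr (_ * cexp _); ring.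
congr (_ +i* _).
  by apply: eq_Rintegral => t _; rewrite E cReM Re_cexpN /= mul0r subr0.
rewrite -[RHS]mulN1r -RintegralZl//; last exact: integrable_msin (CplusD z0 v0).
by apply: eq_Rintegral => t _; rewrite E cImM Im_cexpN /=; ring.
Qed.
End kernels.

(** * The conjugation calC_star *)

Section inversion.
Variables (R : realType) (l : nat).
Notation mu := (@lebesgue_measure R).
Notation Rpos := (`]0%R, +oo[%classic : set R).
Notation Re := (@complex.Re R).
Notation Im := (@complex.Im R).
Notation L2 := (wsqint mu Rpos (weight l)).
Notation dot := (wdot mu Rpos (weight l)).
Implicit Types (u v : R -> R) (z w : R[i]).

Let mRp : measurable (Rpos : set (measurableTypeR R)). Proof. exact: measurable_itv. Qed.

Lemma calC_star_local (F G : R[i] -> R[i]) : (forall z, Cplus z -> F z = G z) ->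
  forall z, Cplus z -> calC_star l F z = calC_star l G z.
Proof. by move=> FG z z0; rewrite /calC_star FG//; apply: CplusV; exact: CplusJ. Qed.

Lemma calC_star_antilinear c d (F G : R[i] -> R[i]) z :
  calC_star l (fun w => c * F w + d * G w) z =
  conjc c * calC_star l F z + conjc d * calC_star l G z.
Proof. by rewrite /calC_star conjcD !conjcM; ring. Qed.

Lemma calC_star_involutive (F : R[i] -> R[i]) z : Cplus z ->
  calC_star l (calC_star l F) z = F z.
Proof.
move=> z0; rewrite /calC_star conjcM !conjcV !conjcX !conjcV !conjcK !invrK.
by rewrite exprVn invrK mulrA mulVf ?mul1r// expf_neq0// Cplus_neq0.
Qed.

Definition cpx u (t : R) : R[i] := (u t)%:C.

Lemma Lb2_cpx u : L2 u -> Lb2 l (cpx u).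
Proof. by move=> uL; apply/Lb2P; split => //; exact: sqint0. Qed.

Lemma laplace_cpx u z : L2 u -> Cplus z ->
  laplace (cpx u) z = dot u (pcos l z) +i* (- dot u (psin l z)).
Proof.
move=> uL z0; have [i1 i2] := Lb2_cintegrable0 (Lb2_cpx uL) z0.
rewrite dot_pcos dot_psin /laplace /cintegral; congr (_ +i* _).
  by apply: eq_Rintegral => t _; rewrite cReM Re_cexpN /= mul0r subr0.
rewrite -[RHS]mulN1r /lsin -RintegralZl//; last exact: lsin_integrable uL z0.
by apply: eq_Rintegral => t _; rewrite cImM Im_cexpN /=; ring.
Qed.

(** Turns [calC_star] on transforms of real functions into a complex-linear map, so that a real
    construction suffices in [hankel]. *)
Lemma laplace_cpxJ u z : L2 u -> Cplus z ->
  conjc (laplace (cpx u) (conjc z)) = laplace (cpx u) z.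
Proof.
move=> uL z0; have i := Lb2_cintegrable0 (Lb2_cpx uL) (CplusJ z0).
rewrite /laplace -cintegralJ//; apply: eq_cintegral => t _.
by rewrite conjcM conjc_real -cexpJ conjcN conjcM conjcK conjc_real.
Qed.

Lemma cpx_pcos (x t : R) : cpx (pcos l x%:C) t = ckernel l x%:C t.
Proof.
apply: eq_complexP; rewrite ?Re_ckernel ?Im_ckernel //=.
by rewrite /psin /= mul0r sin0 !mulr0 oppr0.
Qed.

Lemma Cplus_real (x : R) : 0 < x -> Cplus (x%:C : R[i]).
Proof. by []. Qed.

(* The linear span of the pairs (k_x, x^{-(l+2)} k_{1/x}) for the kernels
   k_x(t) = t^{l+1} e^{-xt}, x > 0, which calC_star exchanges. *)
Inductive kspan : (R -> R) -> (R -> R) -> Prop :=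
| kspan0 : kspan (fun=> 0) (fun=> 0)
| kspanD c x u u' : 0 < x -> kspan u u' ->
    kspan (fun t => u t + c * pcos l x%:C t)
          (fun t => u' t + c * (x^-1 ^+ l.+2 * pcos l x^-1%:C t)).

Lemma kspan_L2 u u' : kspan u u' -> L2 u /\ L2 u'.
Proof.
have mw := @measurable_weight R l; have w0 := @weight_gt0 R l.
elim=> [|c x v v' x0 _ [vL v'L]]; first by split; exact: sqint0.
have xV0 : 0 < x^-1 by rewrite invr_gt0.
have k1 := L2_pcos l (Cplus_real x0); have k2 := L2_pcos l (Cplus_real xV0).
by split; apply: sqintD => //; do ?apply: sqintZ.
Qed.

Lemma kspan_linear c u u' v v' : kspan u u' -> kspan v v' ->
  kspan (fun t => u t + c * v t) (fun t => u' t + c * v' t).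
Proof.
move=> ku; elim=> [|b x s s' x0 _ IH].
  by move: ku; congr kspan; apply/funext => t; rewrite mulr0 addr0.
by have := kspanD (c * b) x0 IH; congr kspan; apply/funext => t; ring.
Qed.

Lemma kspan_laplace u u' w : kspan u u' -> Cplus w ->
  laplace (cpx u') w = (w ^+ l.+2)^-1 * laplace (cpx u) w^-1.
Proof.
move=> ku w0; have wV0 := CplusV w0.
elim: ku => [|c x v v' x0 kv IH].
  have z0 s : Cplus s -> laplace (cpx (fun=> 0)) s = 0.
    move=> s0; have := laplaceZ 0 (Lb2_cpx (@sqint0 _ _ R mu Rpos (weight l) mRp)) s0.
    rewrite mul0r => <-; apply: eq_cintegral => t _.
    by rewrite (_ : cpx _ t = 0) ?mulr0.
  by rewrite !z0// mulr0.
have xV0 : 0 < x^-1 by rewrite invr_gt0.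
have [vL v'L] := kspan_L2 kv.
have k1 := Lb2_ckernel l (Cplus_real x0); have k2 := Lb2_ckernel l (Cplus_real xV0).
have E1 : cpx (fun t => v t + c * pcos l x%:C t) =
    (fun t => 1 * cpx v t + c%:C * ckernel l x%:C t).
  by apply/funext => t; rewrite -cpx_pcos /cpx rmorphD rmorphM mul1r.
have E2 : cpx (fun t => v' t + c * (x^-1 ^+ l.+2 * pcos l x^-1%:C t)) =
    (fun t => 1 * cpx v' t + (c * x^-1 ^+ l.+2)%:C * ckernel l x^-1%:C t).
  by apply/funext => t; rewrite -cpx_pcos /cpx mulrA rmorphD rmorphM mul1r.
rewrite E1 E2 (laplaceD _ _ (Lb2_cpx v'L) k2 w0) (laplaceD _ _ (Lb2_cpx vL) k1 wV0).
rewrite {}IH !laplace_ckernel// !mul1r mulrDr; congr (_ + _).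
rewrite rmorphM rmorphXn /= (_ : x^-1%:C = x%:C^-1); last exact: (fmorphV (real_complex
    R)).
have xC : x%:C != 0 :> R[i] by rewrite Cplus_neq0.
have wC := Cplus_neq0 w0.
have key := invf_addfV l.+2 xC wC.
rewrite exprVn; move: (_^-1) ((w + _) ^+ _)^-1 ((w ^+ _)^-1) ((w^-1 + _) ^+ _)^-1 key.
move=> A B D E key; transitivity (c%:C * (l.+1)`!%:R * (A * B)); first by ring.
by rewrite key; ring.
Qed.

(** [kspan_laplace] at the real point [1 / y], read as a pairing. *)
Lemma kspan_dot_kernel u u' (y : R) : kspan u u' -> 0 < y ->
  dot u' (pcos l y^-1%:C) = y ^+ l.+2 * dot u (pcos l y%:C).
Proof.
move=> ku y0; have [uL u'L] := kspan_L2 ku.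
have yV0 : 0 < y^-1 by rewrite invr_gt0.
have := kspan_laplace ku (Cplus_real yV0).
rewrite (_ : (y^-1%:C)^-1 = y%:C :> R[i]); last first.
  by rewrite -(fmorphV (real_complex R)) invrK.
rewrite !laplace_cpx//= => /(congr1 Re) /=.
rewrite -(rmorphXn (real_complex R)) -(fmorphV (real_complex R)) exprVn invrK.
by rewrite cReM /= mul0r subr0.
Qed.

(** Induction on the second pair alone: against a kernel, [kspan_dot_kernel] produces [x^(l+2)],
    which cancels the coefficient [x^{-(l+2)}] of the image kernel. *)
Lemma kspan_isometric u u' v v' : kspan u u' -> kspan v v' -> dot u v = dot u' v'.
Proof.
have mw := @measurable_weight R l; have w0 := @weight_gt0 R l.
move=> ku; have [uL u'L] := kspan_L2 ku.
elim=> [|c x s s' x0 ks IH].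
  by rewrite /wdot; apply: eq_Rintegral => t _; rewrite !mulr0.
have xV0 : 0 < x^-1 by rewrite invr_gt0.
have [sL s'L] := kspan_L2 ks.
have k1 := L2_pcos l (Cplus_real x0); have k2 := L2_pcos l (Cplus_real xV0).
have k1c := sqintZ mRp c k1; have k2x := sqintZ mRp (x^-1 ^+ l.+2) k2.
have k2c := sqintZ mRp c k2x.
rewrite (dotC mu Rpos (weight l) u) (dotC mu Rpos (weight l) u') (dotDl mRp mw w0 sL
    k1c uL) (dotDl mRp mw w0 s'L k2c u'L).
rewrite (dotZl mRp mw w0 c k1 uL) (dotZl mRp mw w0 c k2x u'L) (dotZl mRp mw w0 _ k2 u'L).
rewrite (dotC mu Rpos (weight l) s) IH (dotC mu Rpos (weight l) u'); congr (_ + c * _).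
rewrite (dotC mu Rpos (weight l) (pcos l x^-1%:C)) (kspan_dot_kernel ku x0) mulrA
    -exprMn mulVf ?gt_eqF//.
by rewrite expr1n mul1r dotC.
Qed.

Lemma kspan_total u : L2 u -> (forall v v', kspan v v' -> dot u v = 0) -> dot u u = 0.
Proof.
move=> uL u0.
have k0 x : 0 < x -> lcos u x 0 = 0.
  move=> x0; rewrite -[LHS](dot_pcos l u x%:C) -[RHS](u0 _ _ (kspanD 1 x0 kspan0)).
  by apply: eq_Rintegral => t _; rewrite add0r mul1r.
have E x : lcos u x 0 = \int[mu]_(t in Rpos) (u t * expR (- x * t)).
  by apply: eq_Rintegral => t _; rewrite mul0r cos0 mulr1.
have ae0 : {ae mu, forall t, Rpos t -> u t = 0}.
  apply: laplace_eq0 => x x0; last by rewrite -E k0.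
  apply: eq_integrable (lcos_integrable 0 uL x0) => // t _ /=.
  by rewrite mul0r cos0 mulr1.
have m2 : measurable_fun Rpos (fun t => (u t * u t * weight l t)%:E).
  apply/measurable_EFinP; apply: measurable_funM; last exact: measurable_weight.
  by apply: measurable_funM; exact: uL.1.
rewrite /wdot /Rintegral (@ae_eq_integral _ _ R mu Rpos (cst 0%E))//.
  by rewrite integral0.
by apply: (@filterS _ _ (ae_filter_ringOfSetsType mu) _ _ _ ae0) => t h Dt /=; rewrite
    h// !mul0r.
Qed.

(** Up to a change of variables this map is the Hankel transform of order [l + 1]; here it is known
    through its effect on Laplace transforms. That effect holds on [kspan] for every complex [w] and
    passes to the limit by the duality clause of [isometric_extension]. *)
Lemma hankel u : L2 u -> exists g, [/\ L2 g, dot g g = dot u u &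
  forall w, Cplus w -> laplace (cpx g) w = (w ^+ l.+2)^-1 * laplace (cpx u) w^-1].
Proof.
have mw := @measurable_weight R l; have w0 := @weight_gt0 R l.
move=> uL.
have [g [gL gu gpq]] := isometric_extension mRp mw w0 kspan0 kspan_linear kspan_L2
  (fun v v' kv => kspan_isometric kv kv) kspan_total uL.
exists g; split=> // w wC; have wV := CplusV wC.
set b := (w ^+ l.+2)^-1.
have pV := L2_pcos l wV; have sV := L2_psin l wV.
have pW := L2_pcos l wC; have sW := L2_psin l wC.
have D v c d : L2 v -> dot v (fun t => c * pcos l w^-1 t + d * psin l w^-1 t) =
    c * dot v (pcos l w^-1) + d * dot v (psin l w^-1).
  move=> vL; rewrite dotC (dotDl mRp mw w0 (sqintZ mRp c pV) (sqintZ mRp d sV) vL).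
  by rewrite (dotZl mRp mw w0 c pV vL) (dotZl mRp mw w0 d sV vL) dotC (dotC mu Rpos
      (weight l) v (psin _ _)).
have LV c d := sqintD mRp mw w0 (sqintZ mRp c pV) (sqintZ mRp d sV).
(* The coefficients are read off from the parts of [b (X - iY)], where [X] and [Y] are the pairings
   with [pcos] and [psin] at [1 / w]; the fixed combination on the right is the [q] matched to
   [p = pcos l w]. *)
have ec : dot g (pcos l w) = Re b * dot u (pcos l w^-1) + Im b * dot u (psin l w^-1).
  rewrite -D//; apply: gpq => // v v' kv; have [vL v'L] := kspan_L2 kv.
  have := kspan_laplace kv wC; rewrite !laplace_cpx// => /(congr1 Re).
  by rewrite cReM -/b D//= => ->; ring.
have es : dot g (psin l w) = - Im b * dot u (pcos l w^-1) + Re b * dot u (psin l w^-1).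
  rewrite -D//; apply: gpq => // v v' kv; have [vL v'L] := kspan_L2 kv.
  have := kspan_laplace kv wC; rewrite !laplace_cpx// => /(congr1 Im).
  by rewrite cImM -/b D//= => /(congr1 -%R); rewrite opprK => ->; ring.
rewrite !laplace_cpx// ec es; apply: eq_complexP; rewrite ?cReM ?cImM /=; ring.
Qed.

Lemma cpx_decomposition (f : R -> R[i]) :
  f = (fun t => 1 * cpx (fun t => Re (f t)) t + 'i * cpx (fun t => Im (f t)) t).
Proof.
apply/funext => t; apply: eq_complexP; rewrite ?cReD ?cImD ?cReM ?cImM /cpx /=; ring.
Qed.

Lemma calC_star_lift (f : R -> R[i]) : Lb2 l f -> exists g, [/\ Lb2 l g,
  Lb2_sqnorm l g = Lb2_sqnorm l f &
  forall z, Cplus z -> laplace g z = calC_star l (laplace f) z].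
Proof.
move=> fL; have [f1 f2] := (Lb2P l f).1 fL.
have [g1 [g1L g1n g1l]] := hankel f1; have [g2 [g2L g2n g2l]] := hankel f2.
(* The sign of ['i] reflects antilinearity applied to [f = f1 + i f2]. *)
pose g t := 1 * cpx g1 t + (- 'i) * cpx g2 t.
have gL : Lb2 l g by apply: Lb2D; exact: Lb2_cpx.
have Reg : (fun t => Re (g t)) = g1.
  by apply/funext => t; rewrite /g cReD !cReM /cpx /=; ring.
have Img : (fun t => Im (g t)) = (fun t => -1 * g2 t).
  by apply/funext => t; rewrite /g cImD !cImM /cpx /=; ring.
have g2L' := sqintZ mRp (-1) g2L.
exists g; split=> //.
  rewrite !Lb2_sqnormE ?Reg ?Img// -g1n -g2n; congr (_ * (_ + _))%:E.
  by apply: eq_Rintegral => t _; ring.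
move=> z z0; have zJV : Cplus (conjc z)^-1 by apply: CplusV; exact: CplusJ.
have zV := CplusV z0.
rewrite /calC_star (laplaceD _ _ (Lb2_cpx g1L) (Lb2_cpx g2L) z0) (g1l _ z0) (g2l _ z0).
rewrite [in RHS](cpx_decomposition f) (laplaceD _ _ (Lb2_cpx f1) (Lb2_cpx f2) zJV).
rewrite conjcD !conjcM -conjcV !laplace_cpxJ// addn2.
have -> : conjc 1 = 1 :> R[i] by rewrite conjc_real.
have -> : conjc 'i = - 'i :> R[i] by apply: eq_complexP; rewrite /= ?oppr0.
by ring.
Qed.
End inversion.

Theorem proposition9p2 (R : realType) (l : nat) (a : R) :
  [/\ is_conjugation_Lb2 l (laplace_inv l \o calC a \o @laplace R),
      forall z : R[i], Cplus z ->
        eq_Rpos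
          ((laplace_inv l \o calC a \o @laplace R)
             (fun t => (2 ^+ l / l`!%:R * t ^+ (l + 1))%:C *
                       cexp (- (t%:C * conjc z))))
          (fun t => (2 ^+ l / l`!%:R * t ^+ (l + 1))%:C *
                    cexp (- (t%:C * (z - a *i))))
    & forall h : R -> R[i], Lb2 l h ->
        eq_Rpos ((laplace_inv l \o @calJ R \o @laplace R) h)
                (fun t => conjc (h t))]
  /\
  (is_conjugation_Lb2 l (laplace_inv l \o calC_star l \o @laplace R) /\
   forall z : R[i], Cplus z ->
     eq_Rpos
       ((laplace_inv l \o calC_star l \o @laplace R)
          (fun t => (2 ^+ l / l`!%:R * t ^+ (l + 1))%:C *
                    cexp (- (t%:C * conjc z))))
       (fun t => 2 ^+ l / (z ^+ (l + 2) * l`!%:R) * (t ^+ (l + 1))%:C *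
                 cexp (- (t%:C / z)))).
Proof.
have KE (z : R[i]) : (fun t => (2 ^+ l / l`!%:R * t ^+ (l + 1))%:C * cexp (- (t%:C *
    conjc z))) =
    (fun t => (2 ^+ l / l`!%:R)%:C * ckernel l (conjc z) t).
  by apply/funext => t; rewrite /ckernel addn1 rmorphM -mulrA (mulrC t%:C).
have KL (z : R[i]) : Cplus z -> Lb2 l (fun t => (2 ^+ l / l`!%:R)%:C * ckernel l (conjc
    z) t).
  by move=> z0; apply/Lb2Z/Lb2_ckernel; exact: CplusJ.
(* Gives the operator in closed form on all of [Lb2]; the kernel formula and the case [a = 0] are
   both read off from it. *)
have modE b f : Lb2 l f ->
    eq_Rpos ((laplace_inv l \o calC b \o @laplace R) f) (modulated b f).
  move=> fL; apply: transportedE; first exact: Lb2_modulated.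
  by move=> z z0; exact: laplace_modulated fL z0.
split; [split|split].
- apply: is_conjugation_transported.
  + exact: calC_local.
  + by move=> c d F G z _; exact: calC_antilinear.
  + by move=> F z _; exact: calC_involutive.
  + exact: calC_lift.
- move=> z z0; rewrite KE; apply: (eq_Rpos_trans (modE a _ (KL z z0))).
  apply: aeW => t _; rewrite /modulated /ckernel addn1 -(mulrA _%:C) -(mulrA _%:C) -cexpD.
  rewrite 2!conjcM 2!conjc_real -cexpJ [in RHS](rmorphM (real_complex R)) -[RHS]mulrA.
  rewrite conjcD !conjcN (conjcM (conjc z)) (conjcM (a *i)) conjcK !conjc_real.
  have -> : conjc (a *i) = - (a *i) by apply: eq_complexP; rewrite /= ?oppr0.
  by congr (_ * (_ * cexp _)); ring.
- move=> h hL; apply: (eq_Rpos_trans (modE 0 _ hL)).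
  apply: aeW => t _; rewrite /modulated.
  have -> : 0 *i = 0 :> R[i] by [].
  by rewrite mul0r oppr0 cexp0 mulr1.
- apply: is_conjugation_transported.
  + exact: calC_star_local.
  + by move=> c d F G z _; exact: calC_star_antilinear.
  + by move=> F z; exact: calC_star_involutive.
  + exact: calC_star_lift.
- move=> z z0; rewrite KE; have zV := CplusV z0; have zJ := CplusJ z0.
  have -> : (fun t => 2 ^+ l / (z ^+ (l + 2) * l`!%:R) * (t ^+ (l + 1))%:C *
      cexp (- (t%:C / z))) =
      (fun t => 2 ^+ l / (z ^+ (l + 2) * l`!%:R) * ckernel l z^-1 t).
    by apply/funext => t; rewrite /ckernel addn1 -mulrA (mulrC t%:C).
  (* The claimed image is checked through its Laplace transform, which reduces to [invf_addfV] at
     [z] and [w]. *)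
  apply: transportedE; first by apply/Lb2Z/Lb2_ckernel.
  move=> w w0; have wJV : Cplus (conjc w)^-1 by apply: CplusV; exact: CplusJ.
  rewrite (laplaceZ _ (Lb2_ckernel l zV) w0) (laplace_ckernel l zV w0).
  rewrite /calC_star (laplaceZ _ (Lb2_ckernel l zJ) wJV) (laplace_ckernel l zJ wJV).
  rewrite !conjcM conjc_real !conjcV conjcX conjcD conjcV !conjcK addn2.
  have -> : conjc (l.+1)`!%:R = (l.+1)`!%:R :> R[i] by exact: rmorph_nat.
  rewrite (rmorphM (real_complex R)) (fmorphV (real_complex R)) (rmorphXn (real_complex
      R)) !(rmorph_nat (real_complex R)).
  have zN := Cplus_neq0 z0; have wN := Cplus_neq0 w0.
  have key := invf_addfV l.+2 zN wN.
  rewrite invfM; move: (_^-1) ((w + _) ^+ _)^-1 ((w ^+ _)^-1) ((w^-1 + _) ^+ _)^-1 key.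
  move=> A B D E key.
  transitivity (2 ^+ l / l`!%:R * (l.+1)`!%:R * (A * B)); first by ring.
  by rewrite key; ring.
Qed.
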